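(* Let $(S,E)$ be a finite non-oriented graph, let $\mathcal{N}$ be the associated step 2 nilpotent Lie algebra, $N$ the associated simply connected nilpotent Lie group, $N_\mathbb{Z}$ the standard lattice in $N$, and let $T$ and $L$ be the subgroups of $\mathrm{Aut}(N)=\mathrm{Aut}(\mathcal{N})$ defined in the context. Let $\mu$ be the $N$-invariant probability measure on $N/N_\mathbb{Z}$. Let $\Gamma$ be a countable subgroup of $T\rtimes L$ stabilizing $N_\mathbb{Z}$ (that is, $\gamma(N_\mathbb{Z})=N_\mathbb{Z}$ for all $\gamma\in\Gamma$), and assume that $\Gamma$ is Zariski dense in $T\rtimes L$. Then the following assertions are equivalent: (i) the action $\Gamma\curvearrowright(N/N_\mathbb{Z},\mu)$ has the property (T) relative to the space; (ii) the linear action of $\Gamma$ on $[\mathcal{N},\mathcal{N}]$ has no non-zero fixed vector.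
   Context: Lie algebra and group of a graph. Let $(S,E)$ be a finite simple non-oriented graph with vertex set $S$ and edge set $E\neq\emptyset$; the edge between $\alpha$ and $\beta$ is denoted $\alpha\beta$. Let $V$ be the real vector space with basis $(u_\alpha)_{\alpha\in S}$ and $W$ the real vector space with basis $(u_{\alpha\beta})_{\alpha\beta\in E}$. Put $\mathcal{N}=V\oplus W$. Fix a total order on $S$. The Lie bracket on $\mathcal{N}$ is determined by: for $\alpha<\beta$ in $S$, $[u_\alpha,u_\beta]=-[u_\beta,u_\alpha]=u_{\alpha\beta}$ if $\alpha\beta\in E$ and $[u_\alpha,u_\beta]=0$ otherwise; $W$ is central. Then $\mathcal{N}$ is 2-step nilpotent and $[\mathcal{N},\mathcal{N}]=W$. The simply connected Lie group $N$ with Lie algebra $\mathcal{N}$ is realized as the set $\mathcal{N}$ with product $(v_1,w_1)(v_2,w_2)=(v_1+v_2,\,w_1+w_2+\tfrac12[v_1,v_2])$; the exponential map is the identity and $\mathrm{Aut}(N)=\mathrm{Aut}(\mathcal{N})$. $N_\mathbb{Z}$ is the subgroup of $N$ generated by $\{(v,w): v\in\mathbb{Z}^{|S|}, w\in\mathbb{Z}^{|E|}\}$ (integer coordinates in the given bases); it is a cocompact lattice in $N$. The groups $T$ and $L$. $T=\{t_\theta:\theta\in\mathrm{Hom}(V,[\mathcal{N},\mathcal{N}])\}$, where $t_\theta(x)=x+\theta(\pi(x))$ and $\pi:\mathcal{N}=V\oplus[\mathcal{N},\mathcal{N}]\to V$ is the projection. A subset $S'\subset S$ is coherent if for all $\alpha,\beta\in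 S'$ and every $\gamma\in S$ with $\alpha\gamma\in E$, either $\gamma=\beta$ or $\beta\gamma\in E$. The maximal coherent subsets (coherent components) partition $S$; write $[S]$ for the set of components and, for $[\alpha]\in[S]$, let $V_{[\alpha]}$ be the span of $\{u_\beta:\beta\in[\alpha]\}$, so $V=\bigoplus_{[\alpha]\in[S]}V_{[\alpha]}$. Each $g\in\prod_{[\alpha]\in[S]}\mathrm{SL}(V_{[\alpha]})$ (acting block-diagonally on $V$) extends uniquely to an automorphism of $\mathcal{N}$ preserving $V$, acting on $[\mathcal{N},\mathcal{N}]$ by the linear map $P(g)$ with $P(g)[u,v]=[gu,gv]$ for $u,v\in V$. $L\cong\prod_{[\alpha]\in[S]}\mathrm{SL}(V_{[\alpha]})$ is the group of these automorphisms. The element $(t,g)\in T\rtimes L$ acts on $\mathcal{N}=V\oplus[\mathcal{N},\mathcal{N}]$ (and on $N$) by $(t,g)\cdot(x,y)=(g(x),P(g)(y)+t(g(x)))$. In particular $T\rtimes L$ acts linearly on $[\mathcal{N},\mathcal{N}]$ through $P$. Zariski density refers to $T\rtimes L$ as an algebraic subgroup of $\mathrm{GL}(\mathcal{N})$. The action on $N/N_\mathbb{Z}$ is $\gamma\cdot xN_\mathbb{Z}=\gamma(x)N_\mathbb{Z}$. Property (T) relative to the space. A measure preserving action $\Gamma\curvearrowright(X,\mu)$ of a countable group on a standard probability space has the property (T) relative to the space (also called rigidity in the sense of Popa, i.e. the inclusion $L^\infty(X)\subset L^\infty(X)\rtimes\Gamma$ has relative property (T)) if, equivalently, the following holds: for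 every sequence of Borel probability measures $\nu_n$ on $X\times X$ such that 1. $p^i_*\nu_n=\mu$ for all $n$ and $i=1,2$, where $p^i:X\times X\to X$ is the projection onto the $i$-th coordinate, 2. $\int_{X\times X}\phi(x)\psi(y)\,d\nu_n(x,y)\to\int_X\phi(x)\psi(x)\,d\mu(x)$ for all bounded Borel functions $\phi,\psi$ on $X$, 3. $\|(\gamma\times\gamma)_*\nu_n-\nu_n\|\to 0$ (total variation norm) for every $\gamma\in\Gamma$, one has $\nu_n(\Delta_X)\to 1$, where $\Delta_X$ is the diagonal of $X\times X$. *)

(* Defs.v *)
From HB Require Import structures.
From mathcomp Require Import all_boot all_order all_algebra.
From mathcomp Require Import all_classical all_reals all_analysis.
From mathcomp Require Import ring.
(* Not imported: its notations clash with those of mathcomp-analysis. *)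
From mathcomp Require mpoly.
Import Order.TTheory GRing.Theory Num.Theory numFieldNormedType.Exports.

Set Implicit Arguments.
Unset Strict Implicit.
Unset Printing Implicit Defensive.

Local Open Scope classical_set_scope.
Local Open Scope ring_scope.

Section Graph.
Context {disp : Order.disp_t} {S : finOrderType disp}.
Variable E : rel S.

Definition coherent (A : {set S}) : bool :=
  [forall a in A, forall b in A, forall c, E a c ==> (c == b) || E b c].

Definition coherent_component (A : {set S}) : bool := maxset coherent A.

End Graph.

(* A non-oriented edge is represented once, by the pair of its endpoints in
   increasing order. *)
Notation edge S E := {p : S * S | (p.1 < p.2)%O && E p.1 p.2}.

Notation vspaceV R S := 'rV[R]_#|{: S}|.
Notation vspaceW R S E := 'rV[R]_#|{: edge S E}|.
Notation lieN R S E := (vspaceV R S * vspaceW R S E)%type.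

Section LieAlgebraOfGraph.
Context {R : realType} {disp : Order.disp_t} {S : finOrderType disp}.
Variable E : rel S.

Local Notation V := (vspaceV R S).
Local Notation W := (vspaceW R S E).
Local Notation N := (lieN R S E).

Definition vcoord (v : V) (a : S) : R := v 0 (enum_rank a).
Definition vbase (a : S) : V := delta_mx 0 (enum_rank a).
Definition wbase (p : edge S E) : W := delta_mx 0 (enum_rank p).

(* The bilinear extension of [u_a, u_b] = - [u_b, u_a] = u_ab for an edge ab
   with a < b, and [u_a, u_b] = 0 when ab is not an edge. *)
Definition bracketV (u v : V) : W :=
  \sum_(p : edge S E)
    (vcoord u (val p).1 * vcoord v (val p).2
     - vcoord u (val p).2 * vcoord v (val p).1) *: wbase p.

Definition bracket (x y : N) : N := (0, bracketV x.1 y.1).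

Definition nmul (x y : N) : N :=
  (x.1 + y.1, x.2 + y.2 + 2^-1 *: bracketV x.1 y.1).
Definition nunit : N := (0, 0).
Definition ninv (x : N) : N := (- x.1, - x.2).

Definition is_subgroupN (H : set N) : Prop :=
  [/\ H nunit, forall x y, H x -> H y -> H (nmul x y)
    & forall x, H x -> H (ninv x)].

Definition integer_points : set N :=
  [set x : N | (forall i, x.1 0 i \is a Num.int) /\
               (forall i, x.2 0 i \is a Num.int)].

Definition NZ : set N := smallest is_subgroupN integer_points.

Lemma NZ_subgroup : is_subgroupN NZ.
Proof.
split=> [A [[]]//|x y Hx Hy A HA|x Hx A HA]; have [[_ HM HV] _] := HA.
  by apply: HM; [exact: Hx|exact: Hy].
by apply: HV; exact: Hx.
Qed.

Lemma bracketVDl (u u' v : V) :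
  bracketV (u + u') v = bracketV u v + bracketV u' v.
Proof.
rewrite /bracketV -big_split /=; apply: eq_bigr => p _.
by rewrite -scalerDl /vcoord !mxE; congr (_ *: _); ring.
Qed.

Lemma bracketVC (u v : V) : bracketV v u = - bracketV u v.
Proof.
rewrite /bracketV -sumrN; apply: eq_bigr => p _.
by apply/matrixP => i j; rewrite !mxE; ring.
Qed.

Lemma bracketVDr (u v v' : V) :
  bracketV u (v + v') = bracketV u v + bracketV u v'.
Proof. by rewrite 3!(bracketVC _ u) bracketVDl opprD. Qed.

Lemma bracketVNl (u v : V) : bracketV (- u) v = - bracketV u v.
Proof.
rewrite /bracketV -sumrN; apply: eq_bigr => p _.
by apply/matrixP => i j; rewrite /vcoord !mxE; ring.
Qed.

Lemma bracketVv (u : V) : bracketV u u = 0.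
Proof. by rewrite /bracketV big1 // => p _; rewrite mulrC subrr scale0r. Qed.

Lemma nmulA : associative nmul.
Proof.
move=> x y z; rewrite /nmul /= bracketVDl bracketVDr; congr pair.
  by rewrite addrA.
by apply/matrixP => i j; rewrite !mxE; ring.
Qed.

Lemma nmulV (x : N) : nmul (ninv x) x = nunit.
Proof.
by rewrite /nmul /= bracketVNl bracketVv oppr0 scaler0 !addNr addr0.
Qed.

Lemma nmul1 (x : N) : nmul x nunit = x.
Proof.
have b0 v : bracketV v 0 = 0.
  by apply: (addIr (bracketV v 0)); rewrite -bracketVDr !add0r.
by case: x => u w; rewrite /nmul /= b0 scaler0 !addr0.
Qed.

Lemma ninvK : involutive ninv.
Proof. by case=> u w; rewrite /ninv /= !opprK. Qed.

Lemma ninvM (x y : N) : ninv (nmul x y) = nmul (ninv y) (ninv x).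
Proof.
rewrite /nmul /ninv /=; congr pair; first by rewrite opprD addrC.
rewrite bracketVNl (bracketVC (- x.1)) bracketVNl.
by apply/matrixP => i j; rewrite !mxE; ring.
Qed.

(* [x NZ = y NZ] *)
Definition same_coset : rel N := fun x y => `[< NZ (nmul (ninv x) y) >].

Lemma same_coset_equiv : equiv_class_of same_coset.
Proof.
have [H1 HM HV] := NZ_subgroup; split.
- by move=> x; apply/asboolP; rewrite nmulV.
- have sym x y : same_coset x y -> same_coset y x.
    by move=> /asboolP/HV; rewrite ninvM ninvK => ?; apply/asboolP.
  by move=> x y; apply/idP/idP; exact: sym.
- move=> y x z /asboolP xy /asboolP yz; apply/asboolP.
  rewrite -[ninv x]nmul1 -(nmulV (ninv y)) ninvK nmulA -nmulA.
  exact: HM.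
Qed.

Canonical same_coset_equivRel := EquivRelPack same_coset_equiv.

Definition nilmanifold := quotient_topology {eq_quot same_coset}%qT.
HB.instance Definition _ := Topological.on nilmanifold.
HB.instance Definition _ := Quotient.on nilmanifold.
HB.instance Definition _ :=
  isPointed.Build nilmanifold (\pi_nilmanifold%qT nunit).
HB.instance Definition _ :=
  Measurable.copy nilmanifold (g_sigma_algebraType (@open nilmanifold)).

(* The map [x NZ |-> f x NZ], which is well defined when [f] is a left
   translation of [N], or an automorphism of [N] with [f @` NZ = NZ]. *)
Definition coset_map (f : N -> N) (x : nilmanifold) : nilmanifold :=
  \pi_nilmanifold%qT (f (repr x)).

Definition is_autN (f : 'End(N)) : Prop :=
  bijective f /\ forall x y, f (bracket x y) = bracket (f x) (f y).

Definition in_component (A : {set S}) (v : V) : Prop :=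
  forall a, a \notin A -> vcoord v a = 0.

Definition component_mx (A : {set S}) (g : 'End(V)) : 'M[R]_#|A| :=
  \matrix_(i, j) vcoord (g (vbase (enum_val j))) (enum_val i).

(* [g] belongs to the product of the groups SL(V_[a]). *)
Definition prod_SL (g : 'End(V)) : Prop :=
  forall A, coherent_component E A ->
    (forall v, in_component A v -> in_component A (g v)) /\
    \det (component_mx A g) = 1.

Definition groupL : set 'End(N) :=
  [set f | is_autN f /\
    exists g : 'End(V), prod_SL g /\ forall v, f (v, 0) = (g v, 0)].

Definition groupT : set 'End(N) :=
  [set f | exists theta : 'Hom(V, W), forall x, f x = x + (0, theta x.1)].

(* For [t] given by [theta] and [l] given by [g], the map [t \o l] sends
   [(x, y)] to [(g x, P(g) y + theta (g x))]. *)
Definition groupTL : set 'End(N) :=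
  [set h | exists t l, [/\ groupT t, groupL l & h = (t \o l)%VF]].

End LieAlgebraOfGraph.

Arguments NZ R {disp S} E _.
Arguments nilmanifold R {disp S} E.
Arguments groupTL R {disp S} E _.
Arguments nmul {R disp S} E x y.
Arguments coset_map {R disp S} E f x.

Definition is_subgroupGL (K : fieldType) (vT : vectType K)
    (G : set 'End(vT)) : Prop :=
  [/\ forall f, G f -> bijective f, G \1%VF,
     forall f g, G f -> G g -> G (f \o g)%VF
   & forall f, G f -> G (f^-1)%VF].

Section Zariski.
Context {K : fieldType} {vT : vectType K}.

Definition poly_eval (p : mpoly.mpoly (\dim {:vT}) K) (x : vT) : K :=
  mpoly.meval (fun i => coord (vbasis {:vT}) i x) p.

(* For subsets of a general linear group this is the same as using regular
   functions, which are polynomials divided by powers of the determinant. *)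
Definition zariski_closure (A : set vT) : set vT :=
  [set x | forall p, (forall y, A y -> poly_eval p y = 0) -> poly_eval p x = 0].

Definition zariski_dense_in (A B : set vT) : Prop :=
  A `<=` B /\ B `<=` zariski_closure A.

End Zariski.

Section RelativePropertyT.
Local Open Scope ereal_scope.
Context {R : realType}.

(* [|s|(X)] for a finite signed measure [s] on [X]. *)
Definition total_variation_norm d (X : measurableType d) (s : set X -> \bar R)
    : \bar R :=
  ereal_sup [set v | exists (n : nat) (F : nat -> set X),
    [/\ forall i, measurable (F i), trivIset setT F
      & v = \sum_(i < n) `|s (F i)|]].

Definition property_T_relative_to_space d (X : measurableType d)
    (mu : probability X R) (G : Type) (Gamma : set G) (act : G -> X -> X)
    : Prop :=
  forall nu : (probability (X * X)%type R)^nat,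
    (forall n A, measurable A ->
       pushforward (nu n) fst A = mu A /\ pushforward (nu n) snd A = mu A) ->
    (forall phi psi : X -> R,
       measurable_fun setT phi -> bounded_fun phi ->
       measurable_fun setT psi -> bounded_fun psi ->
       \int[nu n]_z (phi z.1 * psi z.2)%:E @[n --> \oo] -->
         \int[mu]_x (phi x * psi x)%:E) ->
    (forall g, Gamma g ->
       total_variation_norm (fun A =>
         pushforward (nu n) (fun z => (act g z.1, act g z.2)) A - nu n A)
         @[n --> \oo] --> 0) ->
    nu n diagonal @[n --> \oo] --> 1.

End RelativePropertyT.

(* Main.v *)
(** Suppose that Gamma fixes a non-zero w in [N, N].  The translations T_n by
    the central elements w / (n + 1) commute with Gamma, and the image of mu
    under x |-> (x, T_n x) is a Gamma-invariant coupling which tends to the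
    diagonal without charging it.  This uses that mu is Gamma-invariant, which
    follows from the uniqueness of the N-invariant probability: averaging a
    function over the one-parameter groups of the basis of W, and then over
    those of the basis of V, makes it constant and preserves its integral.

    Conversely, suppose that couplings nu_n contradict rigidity.  Off the
    diagonal, nu_n is carried by pairs (x, u x) with u close to 1, and a limit
    of the laws of u along an ultrafilter is a finitely additive mean m on the
    open sets of the Lie algebra, which is invariant under the linear action of
    Gamma and gives mass to the complement of 0.  As in Furstenberg's lemma, take
    a smallest subspace K all of whose conical neighbourhoods have mass bounded
    below.  Its translates have almost disjoint neighbourhoods, so K has finitely
    many translates under Gamma and is invariant under the unipotent
    one-parameter groups 1 + sD generating T ><| L, by Zariski density.  Gamma
    acts on K by a bounded group: normalizing an unbounded sequence would
    give a singular limit, and push the mass towards a smaller subspace.  A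
    bounded group preserves a definite quadratic form, and by Zariski density
    again so do the groups 1 + sD with D^2 = 0, which thus act trivially on
    K.  Therefore K is fixed by T ><| L, and invariance under T puts it in
    [N, N]. *)

(* The natural object would be an invariant measure on the projective space of the Lie algebra. It
   is avoided: the limit of the laws of [u] is controlled on open sets only, so the mean is just
   monotone and modular there, and cones around subspaces play the part of neighbourhoods in
   projective space. A subspace is given as the kernel of a matrix [k]: smaller subspaces correspond
   to larger ranks, intersections to stacked equations. Zariski density is used along the lines
   [1 + s D] only: a polynomial identity valid on Gamma stays valid on them, and Gamma lies in the
   group that they generate. What is needed about the algebraic group is thus the generation of SL
   by elementary matrices, each of them extended to the Lie algebra as the exponential of a
   derivation of square zero. Coherence of the components is what makes these derivations exist. A
   pair determines its displacement [u] only among small [u], and smallness is not preserved by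
   Gamma. The mean is nevertheless invariant because the couplings concentrate near the diagonal. *)
Require Import Defs.
From HB Require Import structures.
From mathcomp Require Import all_boot all_order all_algebra.
From mathcomp Require Import all_classical all_reals all_analysis.
From mathcomp Require Import measurable_realfun ring lra.
From mathcomp Require mpoly.
Import Order.TTheory GRing.Theory Num.Theory numFieldNormedType.Exports.

Set Implicit Arguments.
Unset Strict Implicit.
Unset Printing Implicit Defensive.

Local Open Scope classical_set_scope.
Local Open Scope ring_scope.

(** * Generation of SL by elementary matrices *)

(* [det (1 + X A)] divides [1] in the ring of polynomials, hence is constant. *)
Lemma det_1D_sq0 (F : fieldType) n (A : 'M[F]_n) :
  A *m A = 0 -> \det (1%:M + A) = 1.
Proof.
move=> A2; pose B : 'M[{poly F}]_n := 'X *: map_mx polyC A.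
have B2 : (1%:M + B) *m (1%:M - B) = 1%:M.
  rewrite mulmxDl mulmxBr mulmxBr !mul1mx !mulmx1 /B -scalemxAl -scalemxAr.
  by rewrite -map_mxM A2 map_mx0 !scaler0 subr0 subrK.
have /(congr1 (fun p : {poly F} => size p)) : \det (1%:M + B) * \det (1%:M - B) = 1.
  by rewrite -det_mulmx B2 det1.
have ev c : (\det (1%:M + B)).[c] = \det (1%:M + c *: A).
  rewrite -[LHS]/(horner_eval c _) -det_map_mx; congr (\det _).
  apply/matrixP => i j; rewrite !mxE rmorphD rmorph_nat rmorphM /=.
  by rewrite /horner_eval !hornerE.
have [d0|d0] := eqVneq (\det (1%:M + B)) 0.
  by rewrite d0 mul0r size_poly0 size_poly1.
have [e0|e0] := eqVneq (\det (1%:M - B)) 0.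
  by rewrite e0 mulr0 size_poly0 size_poly1.
rewrite size_mul// size_poly1 => sz.
have := d0; have := e0; rewrite -!size_poly_gt0 => sB sA.
have s1 : (size (\det (1%:M + B)) <= 1)%N.
  move: sz sB sA; case: (size _) => // a; case: (size _) => //= b + _ _.
  by rewrite addnS => -[/eqP]; rewrite addn_eq0 => /andP[/eqP->].
have := ev 1; have := ev 0; rewrite (size1_polyC s1) !hornerE.
by rewrite scale0r addr0 det1 scale1r => -> <-.
Qed.

Section ElementaryGeneration.
Variable F : fieldType.

Definition elem_mx n (i j : 'I_n) (s : F) : 'M[F]_n := 1%:M + s *: delta_mx i j.

Inductive elem_gen n : 'M[F]_n -> Prop :=
| elem_gen1 : elem_gen 1%:M
| elem_genM i j s A : i != j -> elem_gen A -> elem_gen (elem_mx i j s *m A).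

Lemma elem_mxN n (i j : 'I_n) s : i != j ->
  elem_mx i j (- s) *m elem_mx i j s = 1%:M.
Proof.
move=> ij; rewrite /elem_mx mulmxDl !mulmxDr !mul1mx mulmx1.
rewrite -scalemxAl -scalemxAr mul_delta_mx_0 1?eq_sym// !scaler0 addr0.
by rewrite scaleNr addrK.
Qed.

Lemma det_elem_mx n (i j : 'I_n) s : i != j -> \det (elem_mx i j s) = 1.
Proof.
move=> ij; apply: det_1D_sq0.
by rewrite -scalemxAl -scalemxAr mul_delta_mx_0 1?eq_sym// !scaler0.
Qed.

Lemma elem_gen_mul n (A B : 'M[F]_n) : elem_gen A -> elem_gen B -> elem_gen (A *m B).
Proof.
by move=> + gB; elim=> [|i j s C ij _ IH]; rewrite ?mul1mx// -mulmxA; exact: elem_genM.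
Qed.

Lemma elem_gen_mx n (i j : 'I_n) s : i != j -> elem_gen (elem_mx i j s).
Proof. by move=> ij; rewrite -[elem_mx _ _ _]mulmx1; apply/elem_genM/elem_gen1. Qed.

Lemma elem_gen_red n (i j : 'I_n) s (A : 'M[F]_n) : i != j ->
  elem_gen (elem_mx i j s *m A) -> elem_gen A.
Proof.
move=> ij gA; rewrite -[A]mul1mx -(elem_mxN s ij) -mulmxA.
exact: elem_genM.
Qed.

Lemma elem_gen_lift n (B : 'M[F]_n) :
  elem_gen B -> elem_gen (block_mx (1%:M : 'M[F]_1) 0 0 B).
Proof.
elim=> [|i j s A ij _ IH]; first by rewrite -scalar_mx_block; exact: elem_gen1.
have -> : block_mx (1%:M : 'M[F]_1) 0 0 (elem_mx i j s *m A) =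
    elem_mx (rshift 1 i) (rshift 1 j) s *m block_mx (1%:M : 'M[F]_1) 0 0 A.
  have -> : elem_mx (rshift 1 i) (rshift 1 j) s =
      block_mx (1%:M : 'M[F]_1) 0 0 (elem_mx i j s).
    rewrite /elem_mx (scalar_mx_block 1 n).
    have -> : delta_mx (rshift 1 i) (rshift 1 j) =
        block_mx 0 0 0 (delta_mx i j) :> 'M[F]_(1 + n).
      apply/matrixP => k l; rewrite -[k]splitK -[l]splitK.
      case: (fintype.split k) => k'; case: (fintype.split l) => l' /=;
        rewrite ?(block_mxEul, block_mxEur, block_mxEdl, block_mxEdr) !mxE;
        by rewrite ?eq_lrshift ?eq_rlshift ?eq_rshift ?andbF.
    by rewrite scale_block_mx add_block_mx !scaler0 !addr0.
  by rewrite mulmx_block !mul1mx !mulmx0 !mul0mx !addr0 !add0r.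
by apply: elem_genM => //; rewrite eq_rshift.
Qed.

Lemma elem_gen_lower n (v : 'cV[F]_n) :
  elem_gen (block_mx (1%:M : 'M[F]_1) 0 v 1%:M).
Proof.
rewrite [v]matrix_sum_delta.
apply: (big_ind (fun v => elem_gen (block_mx (1%:M : 'M[F]_1) 0 v 1%:M))).
- by rewrite -scalar_mx_block; exact: elem_gen1.
- move=> x y gx gy; have := elem_gen_mul gx gy.
  by rewrite mulmx_block !mul1mx !mulmx1 !mulmx0 !mul0mx !addr0 !add0r.
move=> i _; rewrite big_ord_recl big_ord0 addr0.
rewrite (_ : block_mx _ _ _ _ = elem_mx (rshift 1 i) (lshift n 0) (v i 0)).
  by apply: elem_gen_mx; rewrite eq_rlshift.
rewrite /elem_mx (scalar_mx_block 1 n).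
have -> : delta_mx (rshift 1 i) (lshift n 0) =
    block_mx 0 0 (delta_mx i 0) 0 :> 'M[F]_(1 + n).
  apply/matrixP => k l; rewrite -[k]splitK -[l]splitK.
  case: (fintype.split k) => k'; case: (fintype.split l) => l' /=;
    rewrite ?(block_mxEul, block_mxEur, block_mxEdl, block_mxEdr) !mxE;
    by rewrite ?eq_lrshift ?eq_rlshift ?eq_rshift ?eq_lshift ?andbF.
by rewrite scale_block_mx add_block_mx !scaler0 !addr0 add0r.
Qed.

Lemma elem_gen_upper n (u : 'rV[F]_n) :
  elem_gen (block_mx (1%:M : 'M[F]_1) u 0 1%:M).
Proof.
rewrite [u]matrix_sum_delta.
apply: (big_ind (fun u => elem_gen (block_mx (1%:M : 'M[F]_1) u 0 1%:M))).
- by rewrite -scalar_mx_block; exact: elem_gen1.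
- move=> x y gx gy; have := elem_gen_mul gy gx.
  by rewrite mulmx_block !mul1mx !mulmx1 !mulmx0 !mul0mx !addr0 !add0r.
move=> i _; apply: (big_ind (fun u => elem_gen (block_mx (1%:M : 'M[F]_1) u 0 1%:M))).
- by rewrite -scalar_mx_block; exact: elem_gen1.
- move=> x y gx gy; have := elem_gen_mul gy gx.
  by rewrite mulmx_block !mul1mx !mulmx1 !mulmx0 !mul0mx !addr0 !add0r.
move=> j _; rewrite ord1.
rewrite (_ : block_mx _ _ _ _ = elem_mx (lshift n 0) (rshift 1 j) (u 0 j)).
  by apply: elem_gen_mx; rewrite eq_lrshift.
rewrite /elem_mx (scalar_mx_block 1 n).
have -> : delta_mx (lshift n 0) (rshift 1 j) =
    block_mx 0 (delta_mx 0 j) 0 0 :> 'M[F]_(1 + n).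
  apply/matrixP => k l; rewrite -[k]splitK -[l]splitK.
  case: (fintype.split k) => k'; case: (fintype.split l) => l' /=;
    rewrite ?(block_mxEul, block_mxEur, block_mxEdl, block_mxEdr) !mxE;
    by rewrite ?eq_lrshift ?eq_rlshift ?eq_rshift ?eq_lshift ?andbF.
by rewrite scale_block_mx add_block_mx !scaler0 !addr0 add0r.
Qed.

(** Gaussian elimination. A corner entry [1] clears its row and column and leaves a smaller block of
    determinant [1]. A non-zero entry below the corner is used to turn the corner into [1]. If the
    corner is the only non-zero entry of its column, adding the first row to the second reduces to
    the previous case. *)
Lemma SL_elem_gen n (A : 'M[F]_n) : \det A = 1 -> elem_gen A.
Proof.
elim: n A => [|n IH] A detA.
  by rewrite (flatmx0 A) -(flatmx0 1%:M); exact: elem_gen1.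
have step1 (B : 'M[F]_(1 + n)) : \det B = 1 -> B 0 0 = 1 -> elem_gen B.
  move=> detB B00; have B1 : ulsubmx B = 1%:M.
    by apply/matrixP => i j; rewrite !ord1 !mxE -[RHS]B00; congr (B _ _); apply/val_inj.
  set v := dlsubmx B; set u := ursubmx B; pose C := drsubmx B - v *m u.
  have BE : B = block_mx (1%:M : 'M[F]_1) 0 v 1%:M *m
      (block_mx (1%:M : 'M[F]_1) 0 0 C *m block_mx (1%:M : 'M[F]_1) u 0 1%:M).
    rewrite !mulmx_block !mul1mx !mulmx1 !mulmx0 !mul0mx !addr0 !add0r.
    by rewrite -[LHS]submxK B1 /C subrKC mulmx1.
  rewrite BE; apply: elem_gen_mul; first exact: elem_gen_lower.
  apply: elem_gen_mul; last exact: elem_gen_upper.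
  apply/elem_gen_lift/IH; move: detB; rewrite BE !det_mulmx.
  by rewrite det_lblock !det_ublock !det1 !(mul1r, mulr1).
have step2 (B : 'M[F]_(1 + n)) i : \det B = 1 -> i != 0 -> B i 0 != 0 -> elem_gen B.
  move=> detB i0 Bi0.
  apply: (@elem_gen_red _ 0 i ((1 - B 0 0) / B i 0)); first by rewrite eq_sym.
  apply: step1.
    by rewrite det_mulmx detB mulr1 det_elem_mx// eq_sym.
  rewrite /elem_mx mulmxDl mul1mx -scalemxAl mxE [X in _ + X]mxE mxE.
  rewrite (bigD1 i)//= mxE !eqxx mul1r.
  rewrite big1 ?addr0 => [|k ki]; last by rewrite mxE (negbTE ki) andbF mul0r.
  by rewrite divfK// subrKC.
have [i /andP[i0 Ai0]|H] := pickP [pred i : 'I_(1 + n) | (i != 0) && (A i 0 != 0)].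
  exact: step2 detA i0 Ai0.
have A0 i : i != 0 -> A i 0 = 0.
  by move=> i0; apply/eqP; have := H i; rewrite /= i0 /= => /negbFE.
have A00 : A 0 0 != 0.
  apply: contra_eq_neq detA => A00.
  rewrite (expand_det_col _ 0) big1 ?[0 == _]eq_sym ?oner_neq0// => i _.
  by have [->|/A0->] := eqVneq i 0; rewrite ?A00 mul0r.
case: n IH A detA step1 step2 H A0 A00 => [|n] IH A detA step1 step2 H A0 A00.
  apply: step1 => //; by rewrite -detA det_mx11.
apply: (@elem_gen_red _ 1 0 1) => //.
apply: (step2 _ 1) => //.
  by rewrite det_mulmx detA mulr1 det_elem_mx.
rewrite /elem_mx mulmxDl mul1mx -scalemxAl mxE [X in _ + X]mxE mxE.
rewrite (bigD1 0)//= mxE !eqxx mul1r.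
rewrite big1 ?addr0 => [|k ki]; last by rewrite mxE (negbTE ki) andbF mul0r.
by rewrite A0// add0r mul1r.
Qed.

End ElementaryGeneration.

(** * Bounded matrix groups *)

Section MatrixNorm.
Context {R : realType}.

Lemma mx_norm_leP m n (A : 'M[R]_(m, n)) (e : R) : 0 <= e ->
  reflect (forall i j, `|A i j| <= e) (`|A| <= e).
Proof.
move=> e0; apply: (iffP idP) => [Ae i j|Ae].
  apply: le_trans Ae; rewrite [leRHS]/Num.norm /= mx_normrE.
  by apply/bigmax_geP; right; exists (i, j).
by rewrite [leLHS]/Num.norm /= mx_normrE; apply/bigmax_leP; split.
Qed.

Lemma le_mx_norm m n (A : 'M[R]_(m, n)) i j : `|A i j| <= `|A|.
Proof. exact/(mx_norm_leP A (normr_ge0 A)). Qed.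

(** The norm is the largest absolute value of an entry, and an entry of the product is a sum of [n]
    terms. *)
Lemma mulmx_norm m n p (A : 'M[R]_(m, n)) (B : 'M[R]_(n, p)) :
  `|A *m B| <= n%:R * `|A| * `|B|.
Proof.
apply/mx_norm_leP => [|i j]; first by rewrite !mulr_ge0.
rewrite mxE (le_trans (ler_norm_sum _ _ _))//.
rewrite -mulrA mulr_natl -[X in _ *+ X](card_ord n) -sumr_const.
by apply: ler_sum => k _; rewrite normrM ler_pM// le_mx_norm.
Qed.

Lemma mulmx_norm_bound m n (A : 'M[R]_(m, n)) :
  exists2 C : R, 0 < C & forall p (x : 'M[R]_(n, p)), `|A *m x| <= C * `|x|.
Proof.
(* The added [1] makes the constant positive, hence usable as a divisor. *)
exists (n%:R * `|A| + 1) => [|p x]; first by rewrite ltr_wpDl// mulr_ge0.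
by rewrite (le_trans (mulmx_norm _ _))// ler_wpM2r// lerDl.
Qed.

Lemma col_mx_norm m1 m2 n (A : 'M[R]_(m1, n)) (B : 'M[R]_(m2, n)) :
  `|col_mx A B| = Num.max `|A| `|B|.
Proof.
apply/eqP; rewrite eq_le; apply/andP; split.
  apply/mx_norm_leP => [|i j]; first by rewrite le_max normr_ge0.
  by rewrite mxE; case: (fintype.split i) => k; rewrite le_max le_mx_norm ?orbT.
rewrite ge_max; apply/andP; split; apply/mx_norm_leP => // i j.
  by rewrite -(col_mxEu A B) le_mx_norm.
by rewrite -(col_mxEd A B) le_mx_norm.
Qed.

(** The image of an ultrafilter is an ultrafilter, and a segment is compact. Limits along
    ultrafilters replace the extraction of subsequences. *)
Lemma ultra_cvg_bounded (T : Type) (F : set_system T) (f : T -> R) (C : R) :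
  UltraFilter F -> F [set t | `|f t| <= C] -> exists l : R, f @ F --> l.
Proof.
move=> FU FC.
have := @segment_compact R (- C) C; rewrite compact_ultra.
have pF : ProperFilter F by exact: ultra_proper.
have fU : UltraFilter (f @ F).
  split=> [|G pG sG]; first exact: fmap_proper_filter.
  apply/seteqP; split => // A GA.
  have [//|fCA] := in_ultra_setVsetC (f @^-1` A) FU.
  have : G (A `&` ~` A) by apply: filterI => //; exact: sG.
  by rewrite setICr => /filter_not_empty.
have Ff : (f @ F) [set` `[- C, C]].
  apply: (@filterS _ F _ [set t | `|f t| <= C] _ _ FC).
  by move=> t Ct; rewrite /= in_itv /= -ler_norml; exact: Ct.
by move=> /(_ _ fU Ff) [l [_ fl]]; exists l.
Qed.

Lemma ultra_mx_cvg (T : Type) (F : set_system T) m n (f : T -> 'M[R]_(m, n))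
    (C : R) :
  UltraFilter F -> F [set t | `|f t| <= C] ->
  exists l : 'M[R]_(m, n), forall i j, (fun t => f t i j) @ F --> l i j.
Proof.
move=> FU FC; have pF : ProperFilter F by exact: ultra_proper.
have H i j : {l : R | (fun t => f t i j) @ F --> l}.
  apply/cid/(@ultra_cvg_bounded _ _ _ C) => //.
  apply: (@filterS _ F _ [set t | `|f t| <= C] _ _ FC) => t /=.
  exact/le_trans/le_mx_norm.
by exists (\matrix_(i, j) sval (H i j)) => i j; rewrite mxE; exact: (svalP (H i j)).
Qed.

Lemma near_mx_norm (T : Type) (F : set_system T) m n (f : T -> 'M[R]_(m, n))
    (l : 'M[R]_(m, n)) (e : R) :
  Filter F -> (forall i j, (fun t => f t i j) @ F --> l i j) -> 0 < e ->
  F [set t | `|f t - l| <= e].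
Proof.
move=> FF fl e0.
have : F [set t | forall ij : 'I_m * 'I_n,
                    `|f t ij.1 ij.2 - l ij.1 ij.2| <= e].
  apply: (@filter_forall _ _
    (fun ij t => `|f t ij.1 ij.2 - l ij.1 ij.2| <= e)) => -[i j] /=.
  have /cvgrPdist_le/(_ e e0) := fl i j.
  by apply: filterS => t /=; rewrite distrC.
apply: filterS => t /= fe; apply/mx_norm_leP; first exact: ltW.
by move=> i j; rewrite !mxE; exact: (fe (i, j)).
Qed.

End MatrixNorm.

(** * Polynomial functions of the entries of a matrix *)

Section MatrixPolynomials.
Context {R : realType}.

(** The inductive form gives continuity and the comparison with [poly_eval] by a direct
    induction. *)
Inductive mxpoly m n : ('M[R]_(m, n) -> R) -> Prop :=
| mxpoly_entry i j : mxpoly (fun A => A i j)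
| mxpoly_cst c : mxpoly (fun=> c)
| mxpoly_add P Q : mxpoly P -> mxpoly Q -> mxpoly (fun A => P A + Q A)
| mxpoly_mul P Q : mxpoly P -> mxpoly Q -> mxpoly (fun A => P A * Q A).

Definition mxpolymap m n p q (F : 'M[R]_(m, n) -> 'M[R]_(p, q)) :=
  forall i j, mxpoly (fun A => F A i j).

Lemma mxpoly_sum m n (I : Type) (r : seq I) (P : pred I)
    (F : I -> 'M[R]_(m, n) -> R) :
  (forall i, mxpoly (F i)) -> mxpoly (fun A => \sum_(i <- r | P i) F i A).
Proof.
move=> HF; elim: r => [|i r IH].
  by under eq_fun do rewrite big_nil; exact: mxpoly_cst.
under eq_fun do rewrite big_cons.
by case: (P i) => //; exact: mxpoly_add.
Qed.

Lemma mxpoly_prod m n (I : Type) (r : seq I) (P : pred I)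
    (F : I -> 'M[R]_(m, n) -> R) :
  (forall i, mxpoly (F i)) -> mxpoly (fun A => \prod_(i <- r | P i) F i A).
Proof.
move=> HF; elim: r => [|i r IH].
  by under eq_fun do rewrite big_nil; exact: mxpoly_cst.
under eq_fun do rewrite big_cons.
by case: (P i) => //; exact: mxpoly_mul.
Qed.

Lemma mxpolymap_id m n : mxpolymap (@id 'M[R]_(m, n)).
Proof. by move=> i j; exact: mxpoly_entry. Qed.

Lemma mxpolymap_cst m n p q (B : 'M[R]_(p, q)) :
  mxpolymap (fun _ : 'M[R]_(m, n) => B).
Proof. by move=> i j; exact: mxpoly_cst. Qed.

Lemma mxpolymap_add m n p q (F G : 'M[R]_(m, n) -> 'M[R]_(p, q)) :
  mxpolymap F -> mxpolymap G -> mxpolymap (fun A => F A + G A).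
Proof.
by move=> HF HG i j; under eq_fun do rewrite mxE; exact: mxpoly_add.
Qed.

Lemma mxpolymap_mul m n p q r (F : 'M[R]_(m, n) -> 'M[R]_(p, q))
    (G : 'M[R]_(m, n) -> 'M[R]_(q, r)) :
  mxpolymap F -> mxpolymap G -> mxpolymap (fun A => F A *m G A).
Proof.
move=> HF HG i j; under eq_fun do rewrite mxE.
by apply: mxpoly_sum => k; exact: mxpoly_mul.
Qed.

Lemma mxpolymap_tr m n p q (F : 'M[R]_(m, n) -> 'M[R]_(p, q)) :
  mxpolymap F -> mxpolymap (fun A => (F A)^T).
Proof. by move=> HF i j; under eq_fun do rewrite mxE. Qed.

Lemma mxpoly_det m n p (F : 'M[R]_(m, n) -> 'M[R]_p) :
  mxpolymap F -> mxpoly (fun A => \det (F A)).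
Proof.
move=> HF; rewrite /determinant; apply: mxpoly_sum => s.
by apply: mxpoly_mul; [exact: mxpoly_cst|exact: mxpoly_prod].
Qed.

Lemma mxpoly_trace m n p (F : 'M[R]_(m, n) -> 'M[R]_p) :
  mxpolymap F -> mxpoly (fun A => \tr (F A)).
Proof. by move=> HF; rewrite /mxtrace; apply: mxpoly_sum. Qed.

Lemma mxpoly_cvg (T : Type) (F : set_system T) m n (f : T -> 'M[R]_(m, n))
    (l : 'M[R]_(m, n)) (P : 'M[R]_(m, n) -> R) :
  Filter F -> (forall i j, (fun t => f t i j) @ F --> l i j) ->
  mxpoly P -> (fun t => P (f t)) @ F --> P l.
Proof.
move=> FF fl; elim=> [i j|c|Q Q' _ IH _ IH'|Q Q' _ IH _ IH'] //.
- exact: cvg_cst.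
- exact: cvgD.
- exact: cvgM.
Qed.

End MatrixPolynomials.

(** * Definite forms preserved by a bounded group *)

Section InvariantForm.
Context {R : realType} (r : nat) (G : set 'M[R]_r) (C : R).
Hypothesis G1 : G 1%:M.
Hypothesis GM : forall g h, G g -> G h -> G (g *m h).
Hypothesis GV : forall g, G g -> exists2 h, G h & g *m h = 1%:M.
Hypothesis GC : forall g, G g -> `|g| <= C.

(** One constant for all estimates: it is positive, at least [C], and at least [r C], which bounds
    the multiplication by an element of [G]. *)
Let K := r%:R * C + (C + 1).

Let C0 : 0 <= C. Proof. exact: le_trans (GC G1). Qed.
Let K0 : 0 < K. Proof. by rewrite /K addrA ltr_wpDl// addr_ge0// mulr_ge0. Qed.

Let bndl g p (x : 'M[R]_(r, p)) : G g -> `|g *m x| <= K * `|x|.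
Proof.
move=> Gg; rewrite (le_trans (mulmx_norm _ _))// ler_wpM2r//.
by rewrite ler_wpDr ?addr_ge0// ler_wpM2l// GC.
Qed.

Let norm_tr m n (A : 'M[R]_(m, n)) : `|A^T| = `|A|.
Proof.
apply/eqP; rewrite eq_le; apply/andP; split; apply/mx_norm_leP => // i j.
  by rewrite mxE le_mx_norm.
by have := le_mx_norm A^T j i; rewrite mxE.
Qed.

Let bndr g p (x : 'M[R]_(p, r)) : G g -> `|x *m g| <= K * `|x|.
Proof.
move=> Gg; rewrite (le_trans (mulmx_norm _ _))// mulrAC ler_wpM2r//.
by rewrite ler_wpDr ?addr_ge0// ler_wpM2l// GC.
Qed.

Let bndlT g p (x : 'M[R]_(r, p)) : G g -> `|g^T *m x| <= K * `|x|.
Proof. by move=> Gg; rewrite -norm_tr trmx_mul trmxK -(norm_tr x) bndr. Qed.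

(* The squared Frobenius norm, for which the parallelogram identity holds. *)
Let N (q : 'M[R]_r) : R := \tr (q^T *m q).

Let NE q : N q = \sum_(ij : 'I_r * 'I_r) q ij.1 ij.2 ^+ 2.
Proof.
rewrite /N /mxtrace -(pair_bigA _ (fun i j => q i j ^+ 2)) /= exchange_big /=.
by apply: eq_bigr => i _; rewrite mxE; apply: eq_bigr => j _; rewrite mxE expr2.
Qed.

Let N_ge q : `|q| ^+ 2 <= N q.
Proof.
have N0 : 0 <= N q by rewrite NE sumr_ge0// => ij _; rewrite sqr_ge0.
rewrite -[leRHS]sqr_sqrtr// ler_sqr ?nnegrE// ?sqrtr_ge0//.
apply/mx_norm_leP => [|i j]; first exact: sqrtr_ge0.
rewrite -sqrtr_sqr ler_wsqrtr// NE (bigD1 (i, j))//= lerDl sumr_ge0// => ij _.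
by rewrite sqr_ge0.
Qed.

Let Npar a b : N (2^-1 *: (a + b)) = 2^-1 * N a + 2^-1 * N b - 4^-1 * N (a - b).
Proof.
rewrite !NE !mulr_sumr -sumrN -!big_split /=; apply: eq_bigr => ij _.
by rewrite !mxE; field.
Qed.

Let Gtr q (g : 'M[R]_r) := g^T *m q *m g.

Let quad (q : 'M[R]_r) (x : 'cV[R]_r) : R := (x^T *m q *m x) 0 0.

(** A convex set of uniformly definite forms, closed under limits. Quantifying over [g] makes it
    stable under the action of [G]; taking [g = 1] recovers definiteness. *)
Let Cset (q : 'M[R]_r) := forall g x, G g -> `|x| ^+ 2 <= K ^+ 2 * quad (Gtr q g) x.

Let level (t : R) := exists2 q, Cset q & forall g, G g -> N (Gtr q g) <= t.

Let GtrM q g h : Gtr (Gtr q g) h = Gtr q (g *m h).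
Proof. by rewrite /Gtr trmx_mul !mulmxA. Qed.

Let Cset_tr q g : G g -> Cset q -> Cset (Gtr q g).
Proof. by move=> Gg Cq h x Gh; rewrite GtrM; apply: Cq; exact: GM. Qed.

Let quad_mid a b x : quad (2^-1 *: (a + b)) x = 2^-1 * quad a x + 2^-1 * quad b x.
Proof.
rewrite /quad -scalemxAr -scalemxAl mulmxDr mulmxDl mxE mxE mulrDr.
by [].
Qed.

Let Gtr_mid a b g : Gtr (2^-1 *: (a + b)) g = 2^-1 *: (Gtr a g + Gtr b g).
Proof. by rewrite /Gtr -scalemxAr -scalemxAl mulmxDr mulmxDl. Qed.

Let Gtr_sub a b g : Gtr (a - b) g = Gtr a g - Gtr b g.
Proof. by rewrite /Gtr mulmxBr mulmxBl. Qed.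

Let Cset_mid a b : Cset a -> Cset b -> Cset (2^-1 *: (a + b)).
Proof.
move=> Ca Cb g x Gg; rewrite Gtr_mid quad_mid.
have := Ca g x Gg; have := Cb g x Gg; lra.
Qed.

Let quad1 x : `|x| ^+ 2 <= quad 1%:M x.
Proof.
rewrite /quad mulmx1 mxE.
have N0 : 0 <= \sum_j x^T 0 j * x j 0.
  by rewrite sumr_ge0// => i _; rewrite mxE -expr2 sqr_ge0.
rewrite -[leRHS]sqr_sqrtr// ler_sqr ?nnegrE// ?sqrtr_ge0//.
apply/mx_norm_leP => [|i j]; first exact: sqrtr_ge0.
rewrite -sqrtr_sqr ler_wsqrtr// (bigD1 i)//= ord1 mxE -expr2 lerDl.
by rewrite sumr_ge0// => k _; rewrite mxE -expr2 sqr_ge0.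
Qed.

(** With [h] the inverse of [g], the identity [x = h (g x)] gives [|x| <= K |g x|], and a sum of
    squares dominates the square of the largest entry. *)
Let Cset1 : Cset 1%:M.
Proof.
move=> g x Gg; have [h Gh gh] := GV Gg; have hg := mulmx1C gh.
have -> : quad (Gtr 1%:M g) x = quad 1%:M (g *m x).
  by rewrite /quad /Gtr trmx_mul !mulmxA.
apply: le_trans (_ : K ^+ 2 * `|g *m x| ^+ 2 <= _).
  rewrite -exprMn ler_sqr ?nnegrE ?mulr_ge0 ?(ltW K0)//.
  by have := bndl (g *m x) Gh; rewrite mulmxA hg mul1mx.
by rewrite ler_wpM2l ?quad1// exprn_ge0 ?ltW.
Qed.

Let dist_bnd a b g : G g -> `|a - b| <= K ^+ 2 * `|Gtr (a - b) g|.
Proof.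
move=> Gg; have [h Gh gh] := GV Gg.
have -> : `|a - b| = `|h^T *m (Gtr (a - b) g *m h)|.
  rewrite /Gtr -!mulmxA gh mulmx1 mulmxA -trmx_mul gh trmx1 mul1mx//.
by rewrite (le_trans (bndlT _ Gh))// expr2 -mulrA ler_wpM2l ?(ltW K0)// bndr.
Qed.

(* The circumcenter of the orbit of the standard form is fixed: it minimises
   the supremum over [G] of the strictly convex functions [N (g^T q g)]. *)
Lemma bounded_group_invariant_form : exists q : 'M[R]_r,
  (forall g, G g -> g^T *m q *m g = q) /\
  (forall x : 'cV[R]_r, x^T *m q *m x = 0 -> x = 0).
Proof.
have lev0 t : level t -> 0 <= t.
  move=> [q _ /(_ _ G1)]; apply: le_trans.
  exact: le_trans (sqr_ge0 _) (N_ge _).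
have levN0 : has_inf [set t | level t].
  split; last by exists 0 => t /lev0.
  (* The level of the identity form: [g^T g] has [r ^ 2] entries, each at most [K ^ 2]. *)
  exists (r%:R ^+ 2 * (K ^+ 2) ^+ 2); exists 1%:M; first exact: Cset1.
  move=> g Gg; rewrite NE; apply: le_trans (_ : \sum_(ij : 'I_r * 'I_r) (K ^+ 2) ^+ 2 <= _).
    apply: ler_sum => -[i j] _ /=; rewrite -[leLHS]real_normK ?num_real//.
    rewrite ler_sqr ?nnegrE ?normr_ge0 ?exprn_ge0 ?(ltW K0)//.
    rewrite (le_trans (le_mx_norm _ _ _))//.
    rewrite /Gtr mulmx1 (le_trans (bndr _ Gg))// expr2 ler_wpM2l ?(ltW K0)// norm_tr.
    by rewrite (le_trans (GC Gg))// /K; have := mulr_ge0 (ler0n R r) C0; lra.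
  by rewrite sumr_const card_prod card_ord -[leLHS]mulr_natl natrM -expr2.
set I := inf [set t | level t].
have ex n : {q | Cset q /\ forall g, G g -> N (Gtr q g) <= I + n.+1%:R^-1}.
  have n0 : 0 < n.+1%:R^-1 :> R by rewrite invr_gt0.
  apply: cid; have [t [q Cq Hq] tI] := inf_adherent n0 levN0.
  by exists q; split => // g Gg; rewrite (le_trans (Hq _ Gg))// ltW.
(* The infimum is attained: almost minimal forms satisfy [|f n| ^ 2 <= I + 1], hence
   [|f n| <= I + 2], and the conditions imposed on them pass to a limit along an ultrafilter. *)
have [q [Cq qI]] : exists q, Cset q /\ forall g, G g -> N (Gtr q g) <= I.
  have [F [FU Foo]] := ultraFilterLemma eventually_filter.
  have pF : ProperFilter F by exact: ultra_proper.
  pose f n := sval (ex n).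
  have fC n : Cset (f n) by case: (svalP (ex n)).
  have fI n g : G g -> N (Gtr (f n) g) <= I + n.+1%:R^-1.
    exact: (svalP (ex n)).2.
  have I0 : 0 <= I by apply: lb_le_inf => [|t /lev0//]; case: levN0.
  have [|q fq] := @ultra_mx_cvg _ _ F _ _ f (I + 2) FU.
    apply: filterS filterT => n _ /=.
    have Nf : N (f n) <= I + 1.
      have := fI n _ G1; rewrite /Gtr trmx1 mul1mx mulmx1 => /le_trans; apply.
      by rewrite lerD2l invf_le1// ler1n.
    have := N_ge (f n); have := normr_ge0 (f n); nra.
  exists q; split => [g x Gg|g Gg].
    have H : (fun n => quad (Gtr (f n) g) x) @ F --> quad (Gtr q g) x.
      apply: (mxpoly_cvg (P := fun q => quad (Gtr q g) x)) fq _.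
      by do ![apply: mxpolymap_mul]; exact: mxpolymap_id || exact: mxpolymap_cst.
    have : (fun n => K ^+ 2 * quad (Gtr (f n) g) x) @ F --> K ^+ 2 * quad (Gtr q g) x.
      by apply: cvgM H; exact: cvg_cst.
    by move=> /cvgr_to_ge; apply; near=> n; exact: fC.
  have H : (fun n => N (Gtr (f n) g)) @ F --> N (Gtr q g).
    apply: (mxpoly_cvg (P := fun q => N (Gtr q g))) fq _.
    apply: mxpoly_trace; apply: mxpolymap_mul; first apply: mxpolymap_tr;
    by do ![apply: mxpolymap_mul]; exact: mxpolymap_id || exact: mxpolymap_cst.
  have H' : (fun n : nat => I + n.+1%:R^-1) @ F --> I.
    rewrite -[X in _ --> X]addr0; apply: cvgD; first exact: cvg_cst.
    apply: cvg_trans cvg_harmonic; exact: cvg_app.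
  by apply: ler_cvg_to H H' _; near=> n; exact: fI.
exists q; split=> [g Gg|x]; last first.
  move=> qx; have := Cq _ x G1.
  rewrite /Gtr trmx1 mul1mx mulmx1 /quad qx mxE mulr0.
  by rewrite real_exprn_even_le0//= ?num_real// normr_eq0 => /eqP.
apply/eqP; rewrite -subr_eq0 -normr_le0; change (`|Gtr q g - q| <= 0).
set d := Gtr q g - q.
(* By the parallelogram identity, the midpoint of [q] and its translate has a level below [I] by an
   amount controlled by [|d|], which minimality forces to be zero. *)
have lev : level (I - 4^-1 * (`|d| / K ^+ 2) ^+ 2).
  exists (2^-1 *: (Gtr q g + q)); first by apply: Cset_mid => //; exact: Cset_tr.
  move=> h Gh; rewrite Gtr_mid Npar GtrM.
  have := qI _ (GM Gg Gh); have := qI _ Gh.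
  have : (`|d| / K ^+ 2) ^+ 2 <= N (Gtr (Gtr q g) h - Gtr q h).
    apply: le_trans (N_ge _); rewrite -Gtr_sub ler_sqr ?nnegrE ?divr_ge0 ?exprn_ge0 ?(ltW K0)//.
    by rewrite ler_pdivrMr ?exprn_gt0// mulrC dist_bnd.
  rewrite GtrM; lra.
have := ge_inf levN0.2 lev.
rewrite -/I => H.
have := sqr_ge0 (`|d| / K ^+ 2).
move=> d2.
have /eqP : (`|d| / K ^+ 2) ^+ 2 = 0 by lra.
by rewrite expf_eq0 /= mulf_eq0 invr_eq0 (gt_eqF (exprn_gt0 2 K0)) orbF => /eqP ->.
Unshelve. all: by end_near. Qed.

End InvariantForm.

(** * Invariant means on a vector space *)

Section Cone.
Context {R : realType} {d : nat}.

(** A conical neighbourhood of the kernel of [k]. The strict inequality excludes the vector [0]. *)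
Definition cone p (k : 'M[R]_(p, d)) (e : R) : set 'cV[R]_d :=
  [set x | `|k *m x| < e * `|x|].

Lemma open_cone p (k : 'M[R]_(p, d)) e : 0 < e -> open (cone k e).
Proof.
move=> e0; have [C C0 kC] := mulmx_norm_bound k.
rewrite openE => x /= kx; apply/nbhs_ballP.
have D0 : 0 < (e * `|x| - `|k *m x|) / (C + e) by rewrite divr_gt0 ?subr_gt0 ?addr_gt0.
exists ((e * `|x| - `|k *m x|) / (C + e)) => //= y.
rewrite -ball_normE /= ltr_pdivlMr ?addr_gt0// /cone /= => xy.
have := kC _ (x - y); rewrite mulmxBr => H1.
have := ler_distD (k *m x) 0 (k *m y); rewrite !sub0r !normrN => H2.
have := ler_distD y 0 x; rewrite !sub0r !normrN (distrC y) => H3.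
have : e * `|x| <= e * (`|y| + `|x - y|) by rewrite ler_pM2l.
lra.
Qed.

Lemma open_mulmx p (g : 'M[R]_(p, d)) (A : set 'cV[R]_p) :
  open A -> open [set x : 'cV[R]_d | A (g *m x)].
Proof.
rewrite !openE => oA x /= /oA /nbhs_ballP [e /= e0 eA].
have [C C0 gC] := mulmx_norm_bound g.
apply/nbhs_ballP; exists (e / C) => /=; first exact: divr_gt0.
move=> y; rewrite -ball_normE /= ltr_pdivlMr// mulrC => xy; apply: eA.
by rewrite -ball_normE /= -mulmxBr (le_lt_trans (gC _ _)).
Qed.

Lemma cone_mono p (k : 'M[R]_(p, d)) e e' : e <= e' -> cone k e `<=` cone k e'.
Proof. by move=> ee' x /lt_le_trans; apply; rewrite ler_wpM2r. Qed.

(** The norm of stacked matrices is the larger of the two norms. Two thin cones therefore meet in a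
    thin cone around the intersection of the kernels, with the same [e]. *)
Lemma coneI p q (k : 'M[R]_(p, d)) (k' : 'M[R]_(q, d)) e :
  cone k e `&` cone k' e = cone (col_mx k k') e.
Proof.
apply/seteqP; split=> x; rewrite /cone /= mul_col_mx col_mx_norm gt_max.
  by move=> [-> ->].
by move/andP.
Qed.

End Cone.

Section UnipotentGeneration.
Context {R : realType} {d : nat}.

Inductive unipotent_gen (U : set 'M[R]_d) : 'M[R]_d -> Prop :=
| unipotent_gen1 : unipotent_gen U 1%:M
| unipotent_genM D g : U D -> unipotent_gen U g ->
    unipotent_gen U ((1%:M + D) *m g).

End UnipotentGeneration.

(** * Furstenberg's lemma for a mean on open sets *)

Section Furstenberg.
Context {R : realType} {d : nat}.
Variables (G U : set 'M[R]_d) (m : set 'cV[R]_d -> R).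
Hypothesis G1 : G 1%:M.
Hypothesis GM : forall g h, G g -> G h -> G (g *m h).
Hypothesis GV : forall g, G g -> exists2 h, G h & g *m h = 1%:M.
Hypothesis U2 : forall D, U D -> D *m D = 0.
(** Zariski density, restricted to the lines through the identity in the directions [U]. *)
Hypothesis GU : forall P, mxpoly P -> (forall g, G g -> P g = 0) ->
  forall D s, U D -> P (1%:M + s *: D) = 0.
Hypothesis Ggen : forall g, G g -> unipotent_gen U g.
Hypothesis m0 : m set0 = 0.
Hypothesis m_mono : forall A B, open A -> open B -> A `<=` B -> m A <= m B.
(** Modularity expresses finite additivity without complements, which open sets do not have. *)
Hypothesis m_mod : forall A B, open A -> open B ->
  m (A `|` B) + m (A `&` B) = m A + m B.
Hypothesis m_inv : forall g A, G g -> open A -> m [set x | A (g *m x)] = m A.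
Hypothesis m_neq0 : 0 < m [set x | x != 0].

Let m_ge0 A : open A -> 0 <= m A.
Proof. by move=> oA; rewrite -m0 m_mono//; exact: open0. Qed.

Let m_sub A B : open A -> open B -> m (A `|` B) <= m A + m B.
Proof.
by move=> oA oB; rewrite -m_mod// lerDl m_ge0//; exact: openI.
Qed.

(* The mass carried by arbitrarily thin cones around the kernel of [k]. *)
Let M p (k : 'M[R]_(p, d)) : R := inf [set m (cone k e) | e in [set e | 0 < e]].

Let M_inf p (k : 'M[R]_(p, d)) : has_inf [set m (cone k e) | e in [set e | 0 < e]].
Proof.
split; first by exists (m (cone k 1)); exists 1 => //=.
by exists 0 => _ [e e0 <-]; rewrite m_ge0//; exact: open_cone.
Qed.

Let M_le p (k : 'M[R]_(p, d)) e : 0 < e -> M k <= m (cone k e).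
Proof. by move=> e0; apply: (ge_inf (M_inf k).2); exists e. Qed.

Let M_ge p (k : 'M[R]_(p, d)) c : (forall e, 0 < e -> c <= m (cone k e)) -> c <= M k.
Proof.
by move=> H; apply: lb_le_inf; [case: (M_inf k)|move=> _ [e e0 <-]; exact: H].
Qed.

Let M_adh p (k : 'M[R]_(p, d)) eta : 0 < eta ->
  exists2 e, 0 < e & forall e', 0 < e' -> e' <= e -> m (cone k e') < M k + eta.
Proof.
move=> eta0; have [_ [e /= e0 <-] H] := inf_adherent eta0 (M_inf k).
exists e => // e' e'0 ee'; apply: le_lt_trans H; apply: m_mono.
- exact: open_cone.
- exact: open_cone.
- exact: cone_mono.
Qed.

(** Fewer equations cut out a larger kernel: if [k' = a k], a thin cone around the kernel of [k]
    lies in a given cone around that of [k']. *)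
Let M_sub p q (k : 'M[R]_(p, d)) (k' : 'M[R]_(q, d)) : (k' <= k)%MS -> M k <= M k'.
Proof.
move=> /submxP[a ->]; have [C C0 aC] := mulmx_norm_bound a.
apply: M_ge => e e0; apply: le_trans (M_le k (divr_gt0 e0 C0)) _.
apply: m_mono; [exact/open_cone/divr_gt0|exact: open_cone|].
move=> x; rewrite /cone /= -mulmxA mulrAC ltr_pdivlMr// mulrC.
exact/le_lt_trans/aC.
Qed.

Let M_invl g p (k : 'M[R]_(p, d)) : G g -> M k <= M (k *m g).
Proof.
move=> Gg; have [h Gh gh] := GV Gg; have hg := mulmx1C gh.
have [C C0 hC] := mulmx_norm_bound g.
apply: M_ge => e e0; apply: le_trans (M_le k (divr_gt0 e0 C0)) _.
rewrite -(m_inv Gg); last exact/open_cone/divr_gt0.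
apply: m_mono; [exact/open_mulmx/open_cone/divr_gt0|exact: open_cone|].
move=> x; rewrite /cone /= -mulmxA mulrAC ltr_pdivlMr// mulrC => H.
by rewrite -(ltr_pM2l C0) (lt_le_trans H)// mulrCA ler_pM2l// hC.
Qed.

Let M_inv g p (k : 'M[R]_(p, d)) : G g -> M (k *m g) = M k.
Proof.
move=> Gg; apply/le_anti/andP; split; last exact: M_invl.
have [h Gh gh] := GV Gg.
by have := M_invl (k *m g) Gh; rewrite -mulmxA gh mulmx1.
Qed.

Let M1 : M 1%:M <= 0.
Proof.
apply: le_trans (M_le _ ltr01) _; rewrite (_ : cone _ _ = set0) ?m0//.
by apply/seteqP; split => x //; rewrite /cone /= mul1mx mul1r ltxx.
Qed.

Let M0_gt0 : 0 < M (0 : 'M[R]_d).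
Proof.
apply: lt_le_trans m_neq0 _; apply: M_ge => e e0.
rewrite (_ : cone _ _ = [set x | x != 0])//; apply/seteqP; split => x;
by rewrite /cone /= mul0mx normr0 pmulr_rgt0// normr_gt0.
Qed.

(** A smallest kernel is a largest rank, and ranks are at most [d]. The zero matrix, whose cones
    consist of all non-zero vectors, starts the search; [<<k'>>] turns any system of equations into
    a square one with the same row space. *)
Let ex_max : exists k : 'M[R]_d, 0 < M k /\
  forall p (k' : 'M[R]_(p, d)), (\rank k < \rank k')%N -> M k' <= 0.
Proof.
pose P r := `[< exists k : 'M[R]_d, 0 < M k /\ \rank k = r >].
have exP : exists r, P r by exists 0%N; apply/asboolP; exists 0; rewrite mxrank0.
have Pd r : P r -> (r <= d)%N by move=> /asboolP[k [_ <-]]; exact: rank_leq_col.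
case: (ex_maxnP exP Pd) => r /asboolP[k [Mk kr]] rmax.
exists k; split => // p k'; rewrite kr => rk'; rewrite leNgt; apply/negP => Mk'.
have : (\rank k' <= r)%N.
  apply: rmax; apply/asboolP; exists <<k'>>%MS; rewrite mxrank_gen; split=> //.
  by apply: lt_le_trans Mk' _; apply: M_sub; rewrite genmxE.
by rewrite leqNgt rk'.
Qed.

Let Ucone (s : seq 'M[R]_d) e := [set x | exists2 k, k \in s & cone k e x].

Let Ucone_cons (k : 'M[R]_d) (s : seq 'M[R]_d) e : Ucone (k :: s) e = cone k e `|` Ucone s e.
Proof.
apply/seteqP; split=> x /=.
  by move=> [k']; rewrite inE => /predU1P[->|k's] H; [left|right; exists k'].
by move=> [H|[k' k's H]]; [exists k|exists k'] => //; rewrite inE ?eqxx// k's orbT.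
Qed.

Let open_Ucone s e : 0 < e -> open (Ucone s e).
Proof.
move=> e0; elim: s => [|k s IH].
  suff -> : Ucone [::] e = set0 by exact: open0.
  by apply/seteqP; split => x // [].
by rewrite Ucone_cons; apply: openU => //; exact: open_cone.
Qed.

Let Ucone_cap (k : 'M[R]_d) (s : seq 'M[R]_d) eta : 0 < eta ->
  (forall k', k' \in s -> M (col_mx k k') <= 0) ->
  exists2 e, 0 < e &
    forall e', 0 < e' -> e' <= e -> m (cone k e' `&` Ucone s e') <= eta.
Proof.
elim: s eta => [|k1 s IH] eta eta0 Hs.
  exists 1 => // e e0 _; rewrite (_ : _ `&` _ = set0) ?m0 ?ltW//.
  by apply/seteqP; split => x // [_ []].
have eta2 : 0 < eta / 2 by rewrite divr_gt0.
have [|e e0 He] := IH _ eta2.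
  by move=> k' k's; apply: Hs; rewrite inE k's orbT.
have [e1 e10 He1] := M_adh (col_mx k k1) eta2.
exists (Num.min e e1) => [|e' e'0]; first by rewrite lt_min e0.
rewrite le_min => /andP[e'e e'e1]; rewrite Ucone_cons setIUr.
have oI1 : open (cone k e' `&` cone k1 e') by apply: openI; exact: open_cone.
have oI2 : open (cone k e' `&` Ucone s e').
  by apply: openI; [exact: open_cone|exact: open_Ucone].
apply: le_trans (m_sub oI1 oI2) _.
have := He _ e'0 e'e; have := He1 _ e'0 e'e1; rewrite -coneI.
have := Hs k1 (mem_head _ _); lra.
Qed.

(** Modularity and induction on the list: a new cone adds at least [c], up to its overlap with the
    union of the others, which is made smaller than [eta / 2]. *)
Let Ucone_ge c (s : seq 'M[R]_d) eta : 0 < eta -> (forall k, k \in s -> c <= M k) ->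
  pairwise (fun k k' : 'M[R]_d => `[< M (col_mx k k') <= 0 >]) s ->
  exists2 e, 0 < e &
    forall e', 0 < e' -> e' <= e -> (size s)%:R * c - eta <= m (Ucone s e').
Proof.
elim: s eta => [|k s IH] eta eta0 Hc.
  exists 1 => // e e0 _; have := m_ge0 (@open_Ucone [::] _ e0).
  by apply: le_trans; rewrite mul0r sub0r oppr_le0 ltW.
rewrite pairwise_cons => /andP[/allP ks ps].
have eta2 : 0 < eta / 2 by rewrite divr_gt0.
have [|//|e e0 He] := IH _ eta2.
  by move=> k' k's; apply: Hc; rewrite inE k's orbT.
have [|e1 e10 He1] := @Ucone_cap k s _ eta2.
  by move=> k' /ks /asboolP.
exists (Num.min e e1) => [|e' e'0]; first by rewrite lt_min e0.
rewrite le_min => /andP[e'e e'e1]; rewrite Ucone_cons.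
have := m_mod (@open_cone _ _ _ k _ e'0) (@open_Ucone s _ e'0).
have := He _ e'0 e'e; have := He1 _ e'0 e'e1; have := M_le k e'0.
have := Hc k (mem_head _ _); rewrite /= -[(size s).+1%:R]natr1; lra.
Qed.

(* A product of sums of squares turns a disjunction of matrix equations into a
   single polynomial equation. *)
Let GU_seq (I : eqType) (s : seq I) p q (F : I -> 'M[R]_d -> 'M[R]_(p, q)) :
  (forall i, mxpolymap (F i)) ->
  (forall g, G g -> exists2 i, i \in s & F i g = 0) ->
  forall D c, U D -> exists2 i, i \in s & F i (1%:M + c *: D) = 0.
Proof.
pose sq i g := \tr ((F i g)^T *m F i g).
have sq0 i g : sq i g = 0 -> F i g = 0.
  rewrite /sq /mxtrace => /eqP; rewrite psumr_eq0 => [/allP H|j _].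
    apply/matrixP => a b; have := H b (mem_index_enum _); rewrite /= mxE.
    rewrite psumr_eq0 => [/allP/(_ a (mem_index_enum _))|j _]; last first.
      by rewrite mxE -expr2 sqr_ge0.
    by rewrite mxE mulf_eq0 orbb mxE => /eqP.
  by rewrite mxE sumr_ge0// => k _; rewrite mxE -expr2 sqr_ge0.
move=> HF HG D c UD.
have PP : mxpoly (fun g => \prod_(i <- s) sq i g).
  apply: mxpoly_prod => i; apply: mxpoly_trace; apply: mxpolymap_mul => //.
  exact: mxpolymap_tr.
have PG g : G g -> \prod_(i <- s) sq i g = 0.
  move=> /HG[i si Fi0]; apply/eqP; rewrite prodf_seq_eq0; apply/hasP.
  by exists i => //=; rewrite /sq Fi0 trmx0 mul0mx mxtrace0.
have /eqP := GU PP PG c UD.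
by rewrite prodf_seq_eq0 => /hasP[i si /eqP/sq0]; exists i.
Qed.

Let rank_col_mx_gt (k k' : 'M[R]_d) : \rank k = \rank k' -> ~~ (k == k')%MS ->
  (\rank k < \rank (col_mx k k'))%N.
Proof.
move=> rk; apply: contraNT; rewrite -leqNgt -addsmxE => rkk'.
have [_ kk'] := mxrank_leqif_eq (addsmxSl k k').
have /eqmxP kkk' : (k == k + k')%MS.
  by rewrite -kk' eqn_leq rkk' mxrankS// addsmxSl.
have k'k : (k' <= k)%MS by rewrite kkk' addsmxSr.
by have [_] := mxrank_leqif_eq k'k; rewrite rk eqxx andbC => <-.
Qed.

Section Minimal.
Variable k : 'M[R]_d.
Hypothesis Mk : 0 < M k.
Hypothesis kmax : forall p (k' : 'M[R]_(p, d)), (\rank k < \rank k')%N -> M k' <= 0.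

Let rank_translate g : G g -> \rank (k *m g) = \rank k.
Proof.
by move=> /GV[h _ gh]; rewrite mxrankMfree// row_free_unit; have [] := mulmx1_unit gh.
Qed.

(* The cones around two different translates of the kernel of [k] have a
   negligible intersection, and each of them has mass at least [M k]. *)
Let translates : exists s : seq 'M[R]_d, (forall k', k' \in s -> \rank k' = \rank k) /\
  forall g, G g -> exists2 k', k' \in s & (k *m g <= k')%MS.
Proof.
(* A list of pairwise distinct translates has length at most [m setT / M k], and one of maximal
   length contains every translate up to equality of row spaces. *)
pose ok (s : seq 'M[R]_d) := pairwise (fun k1 k2 => ~~ (k1 == k2)%MS) s /\
  forall k', k' \in s -> exists2 g, G g & k' = k *m g.
pose P n := `[< exists2 s, ok s & size s = n >].
have exP : exists n, P n by exists 0%N; apply/asboolP; exists [::].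
have size_le s : ok s -> (size s)%:R * M k <= m setT.
  move=> [ps sG]; apply/ler_addgt0Pr => eta eta0.
  have [| |e e0 /(_ e e0 (lexx _))] := @Ucone_ge (M k) s eta eta0.
  - by move=> k' /sG[g Gg ->]; rewrite M_inv.
  - elim: s ps sG => // k1 s IH; rewrite !pairwise_cons => /andP[/allP ks ps] sG.
    rewrite IH// ?andbT//; last by move=> k' k's; apply: sG; rewrite inE k's orbT.
    apply/allP => k2 k2s; apply/asboolP; apply: kmax.
    have [g Gg k1E] := sG k1 (mem_head _ _).
    have [|g' Gg' k2E] := sG k2; first by rewrite inE k2s orbT.
    rewrite -(rank_translate Gg) -k1E; apply: rank_col_mx_gt; last exact: ks.
    by rewrite k1E k2E !rank_translate.
  move=> H; have : m (Ucone s e) <= m setT.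
    by apply: m_mono => //; [exact: open_Ucone|exact: openT].
  lra.
have Pbound n : P n -> (n <= Num.truncn (m setT / M k))%N.
  move=> /asboolP[s /size_le + sn]; rewrite sn => H.
  have mT0 : 0 <= m setT / M k.
    by apply: divr_ge0; [apply: m_ge0; exact: openT|exact: ltW].
  by rewrite (truncn_ge_nat _ mT0) ler_pdivlMr.
case: (ex_maxnP exP Pbound) => n /asboolP[s [ps sG] sn] nmax.
exists s; split => [k' /sG[g Gg ->]|g Gg]; first exact: rank_translate.
have [[k' k's kk']|H] := pselect (exists2 k', k' \in s & (k *m g == k')%MS).
  by exists k' => //; case/andP: kk'.
have : P n.+1.
  apply/asboolP; exists (k *m g :: s); last by rewrite /= sn.
  split => [|k']; last by rewrite inE => /predU1P[->|/sG//]; exists g.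
  rewrite pairwise_cons ps andbT; apply/allP => k' k's; apply/negP => kk'.
  by apply: H; exists k'.
by move=> /nmax; rewrite ltnn.
Qed.

(* By the pigeonhole principle, [k (1 + i D)] and [k (1 + j D)] lie in the same
   translate for some [i <> j]. *)
Let kU D : U D -> (k *m D <= k)%MS.
Proof.
move=> UD; have [s [srk sG]] := translates.
have HI (c : R) : exists2 k', k' \in s & (k *m (1%:M + c *: D) <= k')%MS.
  (* Inclusion of [k g] in the row space of [k'] is the polynomial equation [k g cokermx k' = 0]. *)
  have [|g /sG[k' k's kg]|k' k's kk'] :=
    @GU_seq _ s _ _ (fun k' g => k *m g *m cokermx k') _ _ D c UD.
  - move=> k'; apply: mxpolymap_mul; last exact: mxpolymap_cst.
    by apply: mxpolymap_mul; [exact: mxpolymap_cst|exact: mxpolymap_id].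
  - by exists k' => //; apply/eqP; rewrite -submxE.
  - by exists k' => //; rewrite submxE kk'.
have {}HI (i : 'I_(size s).+1) : {j : 'I_(size s) |
    (k *m (1%:M + (i%:R : R) *: D) <= nth 0 s j)%MS}.
  apply: cid; have [k' k's kk'] := HI i%:R.
  have js : (index k' s < size s)%N by rewrite index_mem.
  by exists (Ordinal js); rewrite nth_index.
pose f i := sval (HI i).
have /injectivePn[i1 [i2 i12 fi]] : ~~ injectiveb f.
  apply/negP => /injectiveP/leq_card; rewrite !card_ord ltnn; exact/negP.
have H1 := svalP (HI i1); have := svalP (HI i2); rewrite -/(f i1) -/(f i2) -fi in H1 *.
set k' := nth 0 s _ in H1 * => H2.
have kD : (k *m D <= k')%MS.
  have c0 : (i1%:R - i2%:R : R) != 0.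
    by rewrite subr_eq0 eqr_nat; apply: contra i12 => /eqP/val_inj->.
  have <- : (i1%:R - i2%:R)^-1 *: (k *m (1%:M + i1%:R *: D) - k *m (1%:M + i2%:R *: D)) = k *m D.
    rewrite -mulmxBr opprD addrACA subrr add0r -scalerBl -scalemxAr scalerA.
    by rewrite mulVf// scale1r.
  by rewrite scalemx_sub// addmx_sub// eqmx_opp.
have kk' : (k <= k')%MS.
  move: H1; rewrite mulmxDr mulmx1 -scalemxAr => H1.
  by rewrite -[k](addrK (i1%:R *: (k *m D))) addmx_sub// eqmx_opp scalemx_sub.
have k's : k' \in s by apply: mem_nth.
have [_ /esym] := mxrank_leqif_sup kk'.
by rewrite srk// eqxx => k'k; exact: submx_trans k'k.
Qed.

Let kgen g : unipotent_gen U g -> (k *m g <= k)%MS.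
Proof.
elim=> [|D h UD _ IH]; first by rewrite mulmx1.
rewrite mulmxA (submx_trans _ IH)// submxMr// mulmxDr mulmx1 addmx_sub//.
exact: kU.
Qed.

Let kG g : G g -> (k *m g <= k)%MS.
Proof. by move=> /Ggen/kgen. Qed.

(** [K] holds the kernel of [k] in row form. The columns of [b] are a basis of this kernel and [p]
    is a left inverse of [b], so that [rho g] below is the matrix of [g] restricted to the
    kernel. *)
Let K := kermx k^T.
Let r := \rank K.
Let b : 'M[R]_(d, r) := (row_base K)^T.
Let p : 'M[R]_(r, d) := (pinvmx (row_base K))^T.

Let pb : p *m b = 1%:M.
Proof. by rewrite -trmx_mul mulmxVp ?trmx1// row_base_free. Qed.

Let kb : k *m b = 0.
Proof.
apply/eqP; rewrite -trmx_eq0 trmx_mul trmxK; apply/eqP/sub_kermxP.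
by rewrite eq_row_base.
Qed.

Let bpK q (X : 'M[R]_(d, q)) : k *m X = 0 -> b *m (p *m X) = X.
Proof.
move=> kX; apply: (can_inj trmxK); rewrite trmx_mul trmx_mul !trmxK.
rewrite mulmxKpV// eq_row_base; apply/sub_kermxP.
by rewrite -trmx_mul kX trmx0.
Qed.

(** [1 - b p] vanishes on the kernel of [k], so it factors through [k]. Hence [x] differs from its
    component [b p x] in the kernel by a multiple of [k x]. *)
Let compl : exists e, 1%:M - b *m p = e *m k.
Proof.
apply/submxP; rewrite submxE mulmxBl mul1mx -mulmxA bpK ?subrr//.
exact: mulmx_coker.
Qed.

(** With a zero kernel, [1] would be a multiple of [k] and [M k <= M 1], whereas the cone of radius
    [1] around the kernel of [1] is empty. *)
Let r_gt0 : (0 < r)%N.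
Proof.
rewrite lt0n; apply/negP => /eqP r0.
have := Mk; apply/negP; rewrite -leNgt; apply: le_trans M1.
apply: M_sub; have [e] := compl.
suff -> : b *m p = 0 by rewrite subr0 => ->; exact: submxMl.
apply/matrixP => i j; rewrite !mxE big1// => l _.
by have : (l < 0)%N by apply: leq_trans (ltn_ord l) _; rewrite r0.
Qed.

Let rho g := p *m g *m b.

Let b_rho g : (k *m g <= k)%MS -> g *m b = b *m rho g.
Proof.
by move=> /submxP[a kg]; rewrite /rho -mulmxA bpK// mulmxA kg -mulmxA kb mulmx0.
Qed.

Let rhoM g h : (k *m h <= k)%MS -> rho (g *m h) = rho g *m rho h.
Proof. by move=> /b_rho hb; rewrite {1}/rho -mulmxA -mulmxA hb mulmxA mulmxA. Qed.

Let rho1 : rho 1%:M = 1%:M.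
Proof. by rewrite /rho mulmx1. Qed.

Let rhoD g h : rho (g + h) = rho g + rho h.
Proof. by rewrite /rho mulmxDr mulmxDl. Qed.

(** On maps preserving the kernel [rho] is multiplicative, so [rho D] squares to zero along with
    [D]. *)
Let det_rho g : unipotent_gen U g -> \det (rho g) = 1.
Proof.
elim=> [|D h UD hU IH]; first by rewrite rho1 det1.
rewrite rhoM ?kgen// det_mulmx IH mulr1 rhoD rho1 det_1D_sq0//.
by rewrite -rhoM ?kU// U2// /rho mulmx0 mul0mx.
Qed.

(** A non-zero equation [j] on the kernel is independent of [k]: multiplying by [b] on the right
    kills [k] and turns [j p] into [j]. *)
Let rank_gt q (j : 'M[R]_(q, r)) : j != 0 -> M (col_mx k (j *m p)) <= 0.
Proof.
move=> j0; apply: kmax; rewrite ltnNge -addsmxE; apply: contra j0 => rk.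
have [_ kkE] := mxrank_leqif_eq (addsmxSl k (j *m p)).
have /eqmxP kk : (k == k + j *m p)%MS.
  by rewrite -kkE eqn_leq rk mxrankS// addsmxSl.
have /submxP[a jp] : (j *m p <= k)%MS by rewrite kk addsmxSr.
by rewrite -[j]mulmx1 -pb mulmxA jp -mulmxA kb mulmx0.
Qed.

(* A limit of [rho g / |rho g|], singular because [det (rho g) = 1]. *)
Let limit_map : ~ (exists C, forall g, G g -> `|rho g| <= C) ->
  exists h : 'M[R]_r, [/\ h != 0, \det h = 0 &
    forall e, 0 < e -> exists g l, [/\ G g, 0 < l & `|rho g - l *: h| <= l * e]].
Proof.
move=> nb.
have {}nb (n : nat) : {g | G g /\ n.+1%:R < `|rho g|}.
  apply: cid; apply: contra_notP nb => H; exists n.+1%:R => g Gg.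
  by rewrite leNgt; apply/negP => gn; apply: H; exists g.
pose f n := sval (nb n).
have Gf n : G (f n) by exact: (svalP (nb n)).1.
have fn n : n.+1%:R < `|rho (f n)| by exact: (svalP (nb n)).2.
have f0 n : 0 < `|rho (f n)| by rewrite (le_lt_trans _ (fn n)).
pose a n := `|rho (f n)|^-1 *: rho (f n).
have a1 n : `|a n| = 1 by rewrite normrZ normfV normr_id mulVf// gt_eqF.
have [F [FU Foo]] := ultraFilterLemma eventually_filter.
have pF : ProperFilter F by exact: ultra_proper.
have [|h ah] := @ultra_mx_cvg _ _ F _ _ a 1 FU.
  by apply: filterS filterT => n _ /=; rewrite a1.
exists h; split.
- have h2 : (0 : R) < 2^-1 by [].
  have /filter_ex[n /= an] := near_mx_norm pF ah h2.
  apply: contraTneq an => ->; rewrite subr0 a1 -ltNge.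
  by rewrite invf_lt1 ?ltr1n.
- have H : (fun n => \det (a n)) @ F --> \det h.
    by apply: mxpoly_cvg ah _; apply: mxpoly_det; exact: mxpolymap_id.
  have H' : (fun n => \det (a n)) @ F --> (0 : R).
    apply/cvgrPdist_le => e e0.
    have : (\forall n \near F, harmonic n <= e).
      apply: Foo; have /cvgrPdist_le/(_ e e0) := @cvg_harmonic R.
      apply: filterS => n /=; rewrite sub0r normrN.
      exact/le_trans/ler_norm.
    apply: filterS => n /=; rewrite sub0r normrN => /(le_trans _); apply.
    (* The determinant equals [|rho (f n)|] to the power [- r], which is at most [1 / (n + 1)]
       because [r] is positive. *)
    rewrite detZ det_rho ?mulr1; last exact: Ggen.
    rewrite ger0_norm ?exprn_ge0// ?invr_ge0//.
    have r1 : `|rho (f n)|^-1 <= n.+1%:R^-1.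
      by rewrite lef_pV2 ?posrE// ltW.
    rewrite (le_trans _ r1)// -[leRHS]expr1 ler_wiXn2l ?invr_ge0//.
    by rewrite (le_trans r1)// invf_le1 ?ler1n.
  exact: cvg_unique H H'.
- move=> e e0; have /filter_ex[n /= an] := near_mx_norm pF ah e0.
  exists (f n), `|rho (f n)|; split=> //.
  have -> : rho (f n) - `|rho (f n)| *: h = `|rho (f n)| *: (a n - h).
    by rewrite scalerBr /a scalerA divff ?scale1r// gt_eqF.
  by rewrite normrZ normr_id ler_wpM2l.
Qed.

(* If [h x] is small then [x] is near [ker k :&: ker h]; otherwise [g x] is near
   [ker k :&: im h].  Both subspaces are smaller than [ker k]. *)
Let rho_bounded : exists C, forall g, G g -> `|rho g| <= C.
Proof.
apply: contrapT => /limit_map[h [h0 deth Hh]].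
(* The rows of [j] are equations satisfied by the image of the singular map [h]. *)
have [j j0 jh] : exists2 j : 'M[R]_r, j != 0 & j *m h = 0.
  exists (kermx h); last exact: mulmx_ker.
  by rewrite kermx_eq0 row_free_unit unitmxE deth unitr0.
(* Two cones of mass below a third of [M k] each will cover, up to a translation by [g], a cone
   around the kernel of [k], whose mass is at least [M k]. *)
have Mk3 : 0 < M k / 3 by rewrite divr_gt0.
have [e1 e10 He1] := M_adh (col_mx k (h *m p)) Mk3.
have [e2 e20 He2] := M_adh (col_mx k (j *m p)) Mk3.
have [e [e0 ee1 ee2]] : exists e, [/\ 0 < e, e <= e1 & e <= e2].
  by exists (Num.min e1 e2); rewrite lt_min e10 !ge_min !lexx orbT.
have {}He1 : m (cone (col_mx k (h *m p)) e) < M k / 3.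
  apply: lt_le_trans (He1 e e0 ee1) _.
  by rewrite gerDr rank_gt.
have {}He2 : m (cone (col_mx k (j *m p)) e) < M k / 3.
  apply: lt_le_trans (He2 e e0 ee2) _.
  by rewrite gerDr rank_gt.
have [Cp Cp0 HCp] := mulmx_norm_bound p.
have [Cj Cj0 HCj] := mulmx_norm_bound j.
have rR : 0 < r%:R :> R by rewrite ltr0n.
(* The first bound keeps [|p g x|] above [l e |x| / 2] when [h p x] is not small. The second one
   makes [j p g x] small in comparison with [e |g x|], its leading term [l j h p x] being zero. *)
have [eta [eta0 eta1 eta2]] : exists eta,
    [/\ 0 < eta, eta <= e / 4 & eta <= e ^+ 2 / (8 * Cj * Cp)].
  exists (Num.min (e / 4) (e ^+ 2 / (8 * Cj * Cp))).
  by rewrite lt_min !ge_min !lexx orbT !divr_gt0 ?exprn_gt0 ?mulr_gt0.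
have [|g [l [Gg l0 gl]]] := Hh (eta / (r%:R * Cp)).
  by rewrite divr_gt0// mulr_gt0.
have [E HE] := compl; have /submxP[a ka] := kG Gg.
have [Cg Cg0 HCg] := mulmx_norm_bound (p *m g *m E).
have [Ca Ca0 HCa] := mulmx_norm_bound a.
(* Chosen after [g]: on the cone of radius [e'], the contribution of [k x] to [p g x] and the vector
   [k g x = a k x] are both negligible. *)
have [e' [e'0 e'e e'1 e'2]] : exists e', [/\ 0 < e', e' <= e,
    e' <= eta * l / Cg & e' <= l * e ^+ 2 / (4 * Ca * Cp)].
  exists (Num.min e (Num.min (eta * l / Cg) (l * e ^+ 2 / (4 * Ca * Cp)))).
  rewrite !lt_min e0 !ge_min !lexx !orbT.
  by rewrite !divr_gt0 ?mulr_gt0 ?exprn_gt0.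
have sub : cone k e' `<=` cone (col_mx k (h *m p)) e `|`
    [set x | cone (col_mx k (j *m p)) e (g *m x)].
  move=> x kx; rewrite -coneI.
  have [hx|hx] := ltP `|h *m p *m x| (e * `|x|).
    by left; split => //; exact: cone_mono kx.
  right => /=; rewrite -coneI.
  have X0 : 0 < `|x|.
    rewrite -(pmulr_rgt0 _ e'0); exact: le_lt_trans kx.
  have xE : x = b *m (p *m x) + E *m (k *m x).
    by rewrite !mulmxA -mulmxDl -HE subrKC mul1mx.
  have pgx : p *m (g *m x) = rho g *m (p *m x) + p *m g *m E *m (k *m x).
    by rewrite {1}xE !mulmxDr !mulmxA.
  set t := rho g - l *: h in gl.
  have rhoE : rho g = t + l *: h by rewrite subrK.
  have tpx : `|t *m (p *m x)| <= l * eta * `|x|.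
    rewrite (le_trans (mulmx_norm _ _))//.
    apply: le_trans (_ : r%:R * (l * (eta / (r%:R * Cp))) * (Cp * `|x|) <= _).
      by rewrite ler_pM ?mulr_ge0// ?HCp// ler_wpM2l.
    rewrite le_eqVlt; apply/orP; left; apply/eqP.
    by field; rewrite !gt_eqF.
  have small : `|p *m g *m E *m (k *m x)| <= l * eta * `|x|.
    rewrite (le_trans (HCg _ _))//.
    have : Cg * `|k *m x| <= Cg * (e' * `|x|) by rewrite ler_pM2l// ltW.
    move/le_trans; apply; rewrite mulrA ler_pM2r//.
    by rewrite mulrC -ler_pdivlMr// (mulrC l).
  have tx := HCp _ (g *m x).
  have big : l * (e - 2 * eta) * `|x| <= `|p *m (g *m x)|.
    have hp : l * (e * `|x|) <= `|l *: h *m (p *m x)|.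
      by rewrite -scalemxAl normrZ gtr0_norm// ler_pM2l// mulmxA.
    have uE : l *: h *m (p *m x) =
        p *m (g *m x) - (t *m (p *m x) + p *m g *m E *m (k *m x)).
      by rewrite pgx rhoE mulmxDl opprD addrACA subrr addr0 addrAC subrr add0r.
    have := ler_normB (p *m (g *m x)) (t *m (p *m x) + p *m g *m E *m (k *m x)).
    rewrite -uE; have := ler_normD (t *m (p *m x)) (p *m g *m E *m (k *m x)).
    lra.
  pose L := l * e ^+ 2 / (4 * Cp) * `|x|.
  have L0 : 0 < L by rewrite mulr_gt0// divr_gt0 ?mulr_gt0 ?exprn_gt0.
  have gxL : L < e * `|g *m x|.
    suff : Cp * L < Cp * (e * `|g *m x|) by rewrite ltr_pM2l.
    have -> : Cp * L = e * (l * (e / 4) * `|x|) by rewrite /L; field; rewrite gt_eqF.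
    rewrite (mulrCA Cp) ltr_pM2l//; apply: lt_le_trans tx; apply: lt_le_trans big.
    by rewrite ltr_pM2r// ltr_pM2l//; lra.
  split; apply: le_lt_trans gxL.
    rewrite mulmxA ka -mulmxA (le_trans (HCa _ _))//.
    have : Ca * `|k *m x| <= Ca * (e' * `|x|) by rewrite ler_pM2l// ltW.
    move/le_trans; apply; rewrite mulrA ler_pM2r//.
    have -> : l * e ^+ 2 / (4 * Cp) = Ca * (l * e ^+ 2 / (4 * Ca * Cp)).
      by field; rewrite !gt_eqF.
    by rewrite ler_pM2l.
  rewrite -mulmxA pgx rhoE mulmxDl -addrA mulmxDr mulmxDr.
  rewrite -scalemxAl -scalemxAr (mulmxA j h) jh mul0mx scaler0 add0r -mulmxDr.
  rewrite (le_trans (HCj _ _))//.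
  have -> : L = Cj * (2 * (e ^+ 2 / (8 * Cj * Cp) * l * `|x|)).
    by rewrite /L; field; rewrite !gt_eqF.
  rewrite ler_pM2l//.
  have : l * eta * `|x| <= e ^+ 2 / (8 * Cj * Cp) * l * `|x|.
    by rewrite ler_pM2r// mulrC ler_pM2r.
  have := ler_normD (t *m (p *m x)) (p *m g *m E *m (k *m x)); lra.
have o1 := @open_cone _ _ _ (col_mx k (h *m p)) _ e0.
have o2 := @open_cone _ _ _ (col_mx k (j *m p)) _ e0.
have := m_sub o1 (open_mulmx (g := g) o2).
have := m_mono (@open_cone _ _ _ k _ e'0) (openU o1 (open_mulmx (g := g) o2)) sub.
have := M_le k e'0; rewrite m_inv//; lra.
Qed.

Lemma invariant_mean_fixed_vector0 : exists2 x : 'cV[R]_d, x != 0 &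
  forall D, U D -> D *m x = 0.
Proof.
have [C HC] := rho_bounded.
have [|_ _ [g Gg <-] [h Gh <-]|_ [g Gg <-]|_ [g Gg <-]|q [qG qpos]] :=
  @bounded_group_invariant_form R r [set rho g | g in G] C.
- by exists 1%:M; rewrite ?rho1.
- by exists (g *m h); [exact: GM|rewrite rhoM// kG].
- have [h Gh gh] := GV Gg; exists (rho h); first by exists h.
  by rewrite -rhoM ?kG// gh rho1.
- exact: HC.
have rhoU D : U D -> rho D = 0.
  move=> UD.
  have inv c : (rho (1%:M + c *: D))^T *m q *m rho (1%:M + c *: D) = q.
    apply/eqP; rewrite -subr_eq0; apply/eqP/matrixP => i j; rewrite [RHS]mxE.
    apply: (GU (P := fun g => ((rho g)^T *m q *m rho g - q) i j)) => //.
      have rhoP : mxpolymap (fun g => rho g).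
        apply: mxpolymap_mul; last exact: mxpolymap_cst.
        by apply: mxpolymap_mul; [exact: mxpolymap_cst|exact: mxpolymap_id].
      apply: mxpolymap_add; last exact: mxpolymap_cst.
      apply: mxpolymap_mul => //; apply: mxpolymap_mul; last exact: mxpolymap_cst.
      exact: mxpolymap_tr.
    by move=> g Gg; rewrite qG ?subrr ?mxE//; exists g.
  have rhoc c : rho (1%:M + c *: D) = 1%:M + c *: rho D.
    by rewrite rhoD rho1 /rho -scalemxAr -scalemxAl.
  (* Invariance along [1 + c D] is an identity of degree two in [c]; adding its instances at [1] and
     [- 1] isolates the coefficient of [c ^ 2]. Definiteness of [q] then kills every column of
     [rho D]. *)
  have AqA : (rho D)^T *m q *m rho D = 0.
    have invc c : q + c *: (q *m rho D) +
        c *: ((rho D)^T *m q + c *: ((rho D)^T *m q *m rho D)) = q.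
      have trE : (1%:M + c *: rho D)^T = 1%:M + c *: (rho D)^T.
        by apply/matrixP => a a'; rewrite !mxE eq_sym.
      rewrite -[RHS](inv c) !rhoc trE.
      rewrite [in RHS]mulmxDl [in RHS]mulmxDl mul1mx.
      by rewrite !mulmxDr !mulmx1 -!scalemxAl -!scalemxAr scalerDr.
    have := invc 1; have := invc (- 1).
    move: ((rho D)^T *m q) (q *m rho D) ((rho D)^T *m q *m rho D) => Z X Y H1 H2.
    have : 2 *: Y = 0.
      apply/matrixP => i j; move/matrixP/(_ i j): H1; move/matrixP/(_ i j): H2.
      by rewrite !mxE; lra.
    by move/eqP; rewrite scaler_eq0 pnatr_eq0 => /eqP.
  apply/matrixP => i j; rewrite [RHS]mxE.
  have /qpos/matrixP/(_ i 0) : (col j (rho D))^T *m q *m (col j (rho D)) = 0.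
    pose v : 'cV[R]_r := delta_mx j 0.
    transitivity (v^T *m ((rho D)^T *m q *m rho D) *m v).
      by rewrite !colE trmx_mul !mulmxA.
    by rewrite AqA mulmx0 mul0mx.
  by rewrite !mxE.
pose i0 := Ordinal r_gt0.
exists (col i0 b).
  apply: contraTneq (oner_neq0 R) => b0; rewrite negbK.
  have : (p *m col i0 b) i0 0 = 0 by rewrite b0 mulmx0 mxE.
  by rewrite colE mulmxA pb mul1mx mxE !eqxx => /eqP.
move=> D UD.
by rewrite colE mulmxA b_rho ?kU// rhoU// mulmx0 mul0mx.
Qed.

End Minimal.

Lemma invariant_mean_fixed_vector : exists2 x : 'cV[R]_d, x != 0 &
  forall D, U D -> D *m x = 0.
Proof. by have [k [Mk kmax]] := ex_max; exact: invariant_mean_fixed_vector0 Mk kmax. Qed.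

End Furstenberg.

(** * Unipotent generation of the automorphism group *)

Lemma ex_linfun (F : fieldType) (aT rT : vectType F) (f : aT -> rT) :
  linear f -> {h : 'Hom(aT, rT) | forall x, h x = f x}.
Proof.
move=> fl.
pose f' : {linear aT -> rT} := HB.pack f (GRing.isLinear.Build F aT rT _ f fl).
by exists (linfun f') => x; rewrite lfunE.
Qed.

Lemma bijective_lfun (K : fieldType) (vT : vectType K) (f : 'End(vT)) :
  bijective f -> exists2 g : 'End(vT), cancel f g & cancel g f.
Proof.
move=> [h fh hf]; have f0 : lker f == 0%VS by apply/lker0P; exact: can_inj fh.
have fg : cancel f (f^-1)%VF := lker0_lfunK f0.
by exists (f^-1)%VF => // y; rewrite -[y]hf fg.
Qed.

Section GraphLieAlgebra.
Context {R : realType} {disp : Order.disp_t} {S : finOrderType disp}.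
Variable E : rel S.
Hypothesis E_sym : symmetric E.
Hypothesis E_irr : irreflexive E.

Local Notation V := (vspaceV R S).
Local Notation W := (vspaceW R S E).
Local Notation N := (lieN R S E).
Local Notation br := (@bracketV R disp S E).

Lemma vcoord_base a b : vcoord (vbase a : V) b = (b == a)%:R.
Proof. by rewrite /vcoord /vbase mxE eqxx /= (inj_eq enum_rank_inj). Qed.

Lemma vcoord_lin (c : R) (u v : V) a : vcoord (c *: u + v) a = c * vcoord u a + vcoord v a.
Proof. by rewrite /vcoord !mxE. Qed.

Lemma vcoordP (u v : V) : (forall a, vcoord u a = vcoord v a) -> u = v.
Proof.
by move=> H; apply/rowP => i; have := H (enum_val i); rewrite /vcoord enum_valK.
Qed.

Lemma vcoord_sum (I : Type) (r : seq I) (P : pred I) (F : I -> V) a :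
  vcoord (\sum_(i <- r | P i) F i) a = \sum_(i <- r | P i) vcoord (F i) a.
Proof. by rewrite /vcoord summxE. Qed.

Lemma vcoordZ (c : R) (u : V) a : vcoord (c *: u) a = c * vcoord u a.
Proof. by rewrite /vcoord mxE. Qed.

Lemma vcoordD (u v : V) a : vcoord (u + v) a = vcoord u a + vcoord v a.
Proof. by rewrite /vcoord mxE. Qed.

Lemma vdecomp (v : V) : v = \sum_a vcoord v a *: vbase a.
Proof.
apply: vcoordP => a; rewrite vcoord_sum (bigD1 a)//= vcoordZ vcoord_base eqxx mulr1.
by rewrite big1 ?addr0// => b ba; rewrite vcoordZ vcoord_base eq_sym (negbTE ba) mulr0.
Qed.

Lemma wdecomp (w : W) : w = \sum_p w 0 (enum_rank p) *: (wbase p : W).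
Proof.
apply/rowP => i; rewrite summxE (bigD1 (enum_val i))//= !mxE enum_valK !eqxx mulr1.
rewrite big1 ?addr0// => p pi; rewrite !mxE eqxx /=.
by rewrite -(inj_eq enum_val_inj) enum_rankK eq_sym (negbTE pi) mulr0.
Qed.

Lemma bracketVZr c (u v : V) : br u (c *: v) = c *: br u v.
Proof.
rewrite /bracketV scaler_sumr; apply: eq_bigr => p _.
by rewrite !vcoordZ scalerA; congr (_ *: _); ring.
Qed.

Lemma bracketVZl c (u v : V) : br (c *: u) v = c *: br u v.
Proof. by rewrite bracketVC bracketVZr -scalerN -bracketVC. Qed.

Lemma bracketV_lin c (u u' v : V) : br (c *: u + u') v = c *: br u v + br u' v.
Proof. by rewrite bracketVDl bracketVZl. Qed.

Lemma bracketV_linr c (u v v' : V) : br u (c *: v + v') = c *: br u v + br u v'.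
Proof. by rewrite bracketVDr bracketVZr. Qed.

Lemma bracketV0l (v : V) : br 0 v = 0.
Proof. by rewrite -(scale0r 0) bracketVZl scale0r. Qed.

Lemma bracketV0r (v : V) : br v 0 = 0.
Proof. by rewrite -(scale0r 0) bracketVZr scale0r. Qed.

Lemma bracket_edge (p : edge S E) : br (vbase (val p).1) (vbase (val p).2) = (wbase p : W).
Proof.
rewrite /bracketV (bigD1 p)//= !vcoord_base !eqxx.
have /andP[p12 _] := valP p.
rewrite [_ == (val p).2]lt_eqF// [_ == (val p).1]gt_eqF// mulr0 subr0 mulr1 scale1r.
rewrite big1 ?addr0// => q qp; rewrite !vcoord_base.
have /andP[q12 _] := valP q.
have [q1|_] := eqVneq (val q).1 (val p).1.
  have [q2|_] := eqVneq (val q).2 (val p).2.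
    by case/eqP: qp; apply: val_inj; rewrite [LHS]surjective_pairing q1 q2 -surjective_pairing.
  by rewrite q1 (lt_eqF p12) !mulr0 subr0 scale0r.
rewrite mul0r sub0r.
have [q1|_] := eqVneq (val q).1 (val p).2; last by rewrite mulr0 oppr0 scale0r.
have [q2|_] := eqVneq (val q).2 (val p).1; last by rewrite mul0r oppr0 scale0r.
by move: q12; rewrite q1 q2 => /lt_trans/(_ p12); rewrite ltxx.
Qed.

Lemma bracket_nonedge a b : ~~ E a b -> br (vbase a) (vbase b) = 0.
Proof.
move=> ab; rewrite /bracketV big1// => q _; rewrite !vcoord_base.
have /andP[_ Eq] := valP q.
have [q1|_] := eqVneq (val q).1 a.
  have [q2|_] := eqVneq (val q).2 b; first by case/negP: ab; rewrite -q1 -q2.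
  have [q2|_] := eqVneq (val q).2 a; last by rewrite mulr0 mul0r subr0 scale0r.
  by move: Eq; rewrite q1 q2 E_irr.
rewrite mul0r sub0r.
have [q1|_] := eqVneq (val q).1 b; last by rewrite mulr0 oppr0 scale0r.
have [q2|_] := eqVneq (val q).2 a; last by rewrite mul0r oppr0 scale0r.
by case/negP: ab; rewrite E_sym -q1 -q2.
Qed.

Lemma bilinear_ext (Z : lmodType R) (f g : V -> V -> Z) :
  (forall u, linear (f u)) -> (forall u, linear (g u)) ->
  (forall v, linear (f ^~ v)) -> (forall v, linear (g ^~ v)) ->
  (forall a b, f (vbase a) (vbase b) = g (vbase a) (vbase b)) ->
  forall u v, f u v = g u v.
Proof.
have ext (h k : V -> Z) : linear h -> linear k ->
    (forall a, h (vbase a) = k (vbase a)) -> forall v, h v = k v.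
  move=> hl kl hk v.
  pose h' : {linear V -> Z} := HB.pack h (GRing.isLinear.Build R V Z _ h hl).
  pose k' : {linear V -> Z} := HB.pack k (GRing.isLinear.Build R V Z _ k kl).
  rewrite [v]vdecomp -[LHS]/(h' _) -[RHS]/(k' _) !linear_sum.
  by apply: eq_bigr => a _; rewrite !linearZ /= hk.
by move=> fl gl fl' gl' fg u v; apply: (ext (f u)) => // b; apply: (ext (f ^~ _) (g ^~ _)).
Qed.

Lemma pairD (v v' : V) (w w' : W) : (v, w) + (v', w') = (v + v', w + w') :> N.
Proof. by []. Qed.

Lemma pairZ (c : R) (v : V) (w : W) : c *: (v, w) = (c *: v, c *: w) :> N.
Proof. by []. Qed.

(** The brackets of basis vectors span [W], so the values on [V] determine a morphism. *)
Lemma autN_ext (f g : 'End(N)) :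
  (forall x y, f (bracket x y) = bracket (f x) (f y)) ->
  (forall x y, g (bracket x y) = bracket (g x) (g y)) ->
  (forall v, f (v, 0) = g (v, 0)) -> f = g.
Proof.
move=> fb gb fg; apply/lfunP => -[v w].
have fgw : f (0, w) = g (0, w).
  have -> : (0, w) = \sum_p w 0 (enum_rank p) *: (0, wbase p) :> N.
    rewrite [in LHS](wdecomp w); elim/big_rec2: _ => // p x y _ <-.
    by rewrite pairZ pairD scaler0 addr0.
  rewrite !linear_sum; apply: eq_bigr => p _; rewrite !linearZ /=; congr (_ *: _).
  have -> : (0, wbase p) = bracket (vbase (val p).1, 0) (vbase (val p).2, 0) :> N.
    by rewrite /bracket /= bracket_edge.
  by rewrite fb gb !fg.
have -> : (v, w) = (v, 0) + (0, w) :> N by rewrite pairD addr0 add0r.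
by rewrite !linearD /= fg fgw.
Qed.

Section Components.

Lemma coherentP (A : {set S}) :
  reflect (forall a b c, a \in A -> b \in A -> E a c -> (c == b) || E b c)
          (coherent E A).
Proof.
apply: (iffP forall_inP) => [H a b c aA bA Eac|H a aA].
  by have /forall_inP/(_ b bA)/forallP/(_ c)/implyP/(_ Eac) := H a aA.
apply/forall_inP => b bA; apply/forallP => c; apply/implyP; exact: H.
Qed.

(** A neighbour [c] of [a] is passed on to [x], then to [b]. In the exceptional case [c = x], the
    vertex [a] is a neighbour of [x] and is passed on to [b]; if it differs from [b], then [b] is a
    neighbour of [a], hence of [x]. *)
Lemma coherentU (A B : {set S}) x : coherent E A -> coherent E B ->
  x \in A -> x \in B -> coherent E (A :|: B).
Proof.
have key (C D : {set S}) a b c : coherent E C -> coherent E D -> x \in C -> x \in D ->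
    a \in C -> b \in D -> E a c -> (c == b) || E b c.
  move=> /coherentP CC /coherentP CD xC xD aC bD Eac.
  have /orP[/eqP cx|Exc] := CC a x c aC xC Eac; last exact: CD Exc.
  rewrite cx in Eac *; have [//|xb /=] := eqVneq x b.
  have Exa : E x a by rewrite E_sym.
  have /orP[/eqP<-|Eba] := CD x b a xD bD Exa; first by rewrite E_sym.
  have Eab : E a b by rewrite E_sym.
  by have := CC a x b aC xC Eab; rewrite eq_sym (negbTE xb) /= E_sym.
move=> cA cB xA xB; apply/coherentP => a b c; rewrite !inE.
move=> /orP[aA|aB] /orP[bA|bB].
- exact: (coherentP _ cA).
- exact: (key A B).
- exact: (key B A).
- exact: (coherentP _ cB).
Qed.

Lemma component_eq (A B : {set S}) x :
  coherent_component E A -> coherent_component E B -> x \in A -> x \in B -> A = B.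
Proof.
move=> /maxsetP[cA mA] /maxsetP[cB mB] xA xB.
have cU := coherentU cA cB xA xB.
by rewrite -(mA _ cU (finset.subsetUl _ _)) -[RHS](mB _ cU (finset.subsetUr _ _)).
Qed.

Lemma ex_component x : exists2 A, coherent_component E A & x \in A.
Proof.
have c1 : coherent E [set x].
  by apply/coherentP => a b c; rewrite !inE => /eqP-> /eqP-> ->; rewrite orbT.
have [A cA xA] := maxset_exists c1.
by exists A => //; rewrite -finset.sub1set.
Qed.

End Components.

(** * Elementary derivations inside a component *)

Section Elementary.
Variables (a b : S).

Let dV (v : V) : V := vcoord v b *: vbase a.

Let dV_lin : linear dV.
Proof. by move=> c u v; rewrite /dV vcoord_lin scalerDl scalerA. Qed.

Definition elemV : 'End(V) := sval (ex_linfun dV_lin).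

Lemma elemVE v : elemV v = vcoord v b *: vbase a.
Proof. by rewrite /elemV; case: ex_linfun. Qed.

Lemma elemV_base x : elemV (vbase x) = (x == b)%:R *: vbase a.
Proof. by rewrite elemVE vcoord_base eq_sym. Qed.

(** The value that the Leibniz rule imposes on [[u, v]] for a derivation extending [elemV]. *)
Let cb (u v : V) : W := br (elemV u) v + br u (elemV v).

Let dW (w : W) : W :=
  \sum_(p : edge S E) w 0 (enum_rank p) *: cb (vbase (val p).1) (vbase (val p).2).

Let dN (x : N) : N := (elemV x.1, dW x.2).

Let dN_lin : linear dN.
Proof.
move=> c x y; rewrite /dN pairZ pairD linearP /=; congr (_, _).
rewrite /dW scaler_sumr -big_split /=; apply: eq_bigr => p _.
by rewrite !mxE scalerDl scalerA.
Qed.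

Definition elemD : 'End(N) := sval (ex_linfun dN_lin).

Lemma elemDE x : elemD x = (elemV x.1, dW x.2).
Proof. by rewrite /elemD; case: ex_linfun. Qed.

Hypothesis ab : a != b.
Hypothesis coh : forall c, E a c -> (c == b) || E b c.

Lemma elemV2 v : elemV (elemV v) = 0.
Proof. by rewrite !elemVE vcoordZ vcoord_base eq_sym (negbTE ab) mulr0 scale0r. Qed.

Let cb_linl v : linear (cb ^~ v).
Proof.
move=> c u u'; rewrite /cb linearP bracketV_lin bracketV_lin scalerDr addrACA.
by [].
Qed.

Let cb_linr u : linear (cb u).
Proof.
move=> c v v'; rewrite /cb linearP bracketV_linr bracketV_linr scalerDr addrACA.
by [].
Qed.

Let dW_lin : linear dW.
Proof.
move=> c w w'; rewrite /dW scaler_sumr -big_split /=; apply: eq_bigr => p _.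
by rewrite !mxE scalerDl scalerA.
Qed.

Let dWN w : dW (- w) = - dW w.
Proof.
by rewrite /dW -sumrN; apply: eq_bigr => p _; rewrite mxE scaleNr.
Qed.

Let dW_base (p : edge S E) : dW (wbase p) = cb (vbase (val p).1) (vbase (val p).2).
Proof.
rewrite /dW (bigD1 p)//= big1 ?addr0 => [|q qp].
  by rewrite mxE !eqxx scale1r.
by rewrite mxE eqxx /= (inj_eq enum_rank_inj) (negbTE qp) scale0r.
Qed.

Let dW0 : dW 0 = 0.
Proof. by rewrite /dW big1// => p _; rewrite mxE scale0r. Qed.

(** On an edge this is the definition of [dW]. On a non-edge [cb] has to vanish, which is where
    coherence enters: a neighbour of [a] other than [b] is a neighbour of [b]. *)
Let dW_br u v : dW (br u v) = cb u v.
Proof.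
apply: (bilinear_ext (f := fun u v => dW (br u v)) (g := cb)) => //.
- by move=> {}u c v1 v2; rewrite bracketV_linr dW_lin.
- by move=> {}v c u1 u2; rewrite bracketV_lin dW_lin.
move=> x y; have [Exy|nExy] := boolP (E x y); last first.
  rewrite bracket_nonedge// dW0 /cb !elemV_base bracketVZl bracketVZr.
  have [xb|xb] := eqVneq x b; have [yb|yb] := eqVneq y b;
    rewrite ?scale0r ?add0r ?addr0 ?scale1r//.
  - by rewrite xb yb (bracketVC _ (vbase a)) subrr.
  - rewrite bracket_nonedge//; apply: contra nExy => /coh.
    by rewrite (negbTE yb) /= xb.
  - rewrite bracket_nonedge//; apply: contra nExy; rewrite E_sym => /coh.
    by rewrite (negbTE xb) /= yb E_sym.
have [xy|yx|xy] := ltgtP x y.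
- have pE : (x < y)%O && E x y by rewrite xy.
  pose p : edge S E := exist _ (x, y) pE.
  by rewrite -[vbase x]/(vbase (val p).1) -[vbase y]/(vbase (val p).2) bracket_edge dW_base.
- have pE : (y < x)%O && E y x by rewrite yx E_sym.
  pose p : edge S E := exist _ (y, x) pE.
  rewrite bracketVC dWN -[vbase y]/(vbase (val p).1) -[vbase x]/(vbase (val p).2).
  by rewrite bracket_edge dW_base /cb opprD addrC -!bracketVC.
- by move: Exy; rewrite xy E_irr.
Qed.

Lemma elemD_br x y : elemD (bracket x y) = bracket (elemD x) y + bracket x (elemD y).
Proof.
rewrite !elemDE /bracket /= pairD addr0 linear0; congr (_, _); exact: dW_br.
Qed.

(** Since [D ^ 2 = 0] on [V], the Leibniz rule gives [D ^ 2 [u, v] = 2 [D u, D v]], and [D u] and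
    [D v] are both multiples of [u_a]. *)
Lemma elemD2 : (elemD \o elemD)%VF = 0.
Proof.
apply/lfunP => -[v w]; rewrite lfunE /= !elemDE /= elemV2 [RHS]lfunE /=; congr (_, _).
have dWp (p : edge S E) : dW (dW (wbase p)) = 0.
  rewrite dW_base {1}/cb.
  have dWD x y : dW (x + y) = dW x + dW y.
    by have := dW_lin 1 x y; rewrite !scale1r.
  rewrite dWD !dW_br /cb !elemV2.
  rewrite bracketV0l bracketV0r add0r addr0 !elemVE bracketVZl !bracketVZr.
  by rewrite bracketVv !scaler0 addr0.
rewrite (wdecomp w); elim/big_rec: _ => [|p y _ IH]; first by rewrite !dW0.
by rewrite !dW_lin dWp IH scaler0 addr0.
Qed.

Lemma elemD_V v : elemD (v, 0) = (elemV v, 0).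
Proof. by rewrite elemDE /= dW0. Qed.

(** This is the exponential of the derivation [s D]. The second order term [[D x, D y]] vanishes
    because the [V] parts of [D x] and [D y] are multiples of [u_a]. *)
Lemma elem_br s x y : (\1 + s *: elemD)%VF (bracket x y) =
  bracket ((\1 + s *: elemD)%VF x) ((\1 + s *: elemD)%VF y).
Proof.
have fE z : (\1 + s *: elemD)%VF z = z + s *: elemD z.
  by rewrite !lfunE /= !lfunE.
rewrite !fE elemD_br !elemDE /bracket; apply: (f_equal2 pair).
  by rewrite /= addr0 scaler0 addr0.
rewrite /= bracketVDl !bracketVDr !bracketVZl !bracketVZr -addrA; congr (_ + _).
have -> : br (elemV x.1) (elemV y.1) = 0.
  by rewrite !elemVE bracketVZl bracketVZr bracketVv !scaler0.
by rewrite !scaler0 addr0 addrC scalerDr.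
Qed.

End Elementary.

Definition same_component a b := exists2 A, coherent_component E A & (a \in A) && (b \in A).

Lemma same_component_coh a b c : same_component a b -> E a c -> (c == b) || E b c.
Proof.
move=> [A /maxsetP[/coherentP cA _] /andP[aA bA]]; exact: cA.
Qed.

Inductive elem_genV : 'End(V) -> Prop :=
| elem_genV1 : elem_genV \1%VF
| elem_genVM a b s h : a != b -> same_component a b -> elem_genV h ->
    elem_genV ((\1 + s *: elemV a b)%VF \o h)%VF.

Lemma elemVfE a b s v : (\1 + s *: elemV a b)%VF v = v + s *: (vcoord v b *: vbase a) :> V.
Proof. by rewrite !lfunE /= !lfunE /= elemVE. Qed.

Lemma elem_genV_red a b s h : a != b -> same_component a b ->
  elem_genV ((\1 + s *: elemV a b)%VF \o h)%VF -> elem_genV h.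
Proof.
move=> ab sab gh.
have -> : h = ((\1 + (- s) *: elemV a b)%VF \o ((\1 + s *: elemV a b)%VF \o h))%VF.
  apply/lfunP => v; rewrite !comp_lfunE !elemVfE vcoordD !vcoordZ vcoord_base.
  by rewrite eq_sym (negbTE ab) !mulr0 addr0 scaleNr addrK.
exact: elem_genVM.
Qed.

Lemma component_mx_elem (A : {set S}) a b s (g : 'End(V)) (aA : a \in A) (bA : b \in A) :
  component_mx A ((\1 + s *: elemV a b)%VF \o g)%VF =
  elem_mx (enum_rank_in aA a) (enum_rank_in aA b) s *m component_mx A g.
Proof.
rewrite /elem_mx mulmxDl mul1mx -scalemxAl; apply/matrixP => i j; rewrite !mxE.
rewrite comp_lfunE elemVfE vcoordD !vcoordZ vcoord_base; congr (_ + s * _).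
rewrite (bigD1 (enum_rank_in aA b))//= !mxE eqxx andbT enum_rankK_in//.
rewrite big1 ?addr0 => [|k kb]; last by rewrite mxE (negbTE kb) andbF mul0r.
rewrite mulrC; congr (_%:R * _); congr nat_of_bool.
by rewrite -(inj_eq enum_val_inj) enum_rankK_in.
Qed.

Lemma component_mx_elem0 (A : {set S}) a b s (g : 'End(V)) : a \notin A ->
  component_mx A ((\1 + s *: elemV a b)%VF \o g)%VF = component_mx A g.
Proof.
move=> aA; apply/matrixP => i j; rewrite !mxE comp_lfunE elemVfE vcoordD !vcoordZ vcoord_base.
have /negbTE-> : enum_val i != a.
  by apply: contraNneq aA => <-; exact: enum_valP.
by rewrite !mulr0 addr0.
Qed.

Lemma prod_SL_elem a b s g : a != b -> same_component a b -> prod_SL E g ->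
  prod_SL E ((\1 + s *: elemV a b)%VF \o g)%VF.
Proof.
move=> ab [A cA /andP[aA bA]] gSL B cB; have [gB detB] := gSL B cB; split.
  move=> v /gB vB c cnB; rewrite comp_lfunE elemVfE vcoordD (vB c cnB) !vcoordZ add0r.
  have [aB|aB] := boolP (a \in B).
    rewrite vcoord_base; have /negbTE-> : c != a by apply: contraNneq cnB => ->.
    by rewrite !mulr0.
  rewrite vB ?mul0r ?mulr0//; apply: contra aB => bB.
  by rewrite -(component_eq cA cB bA bB).
have [aB|aB] := boolP (a \in B); last by rewrite component_mx_elem0.
have BA := component_eq cA cB aA aB; rewrite -BA in detB *.
rewrite (component_mx_elem _ _ aA bA) det_mulmx detB mulr1 det_elem_mx//.
apply: contra ab => /eqP/(congr1 enum_val); rewrite !enum_rankK_in// => ->.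
by [].
Qed.

(** The reduction of the block of [A] to the identity is performed on [g] itself; components being
    disjoint, the other blocks do not change. The last clause records that the operations are
    invertible. *)
Lemma clear_component A g : coherent_component E A -> prod_SL E g ->
  exists g', [/\ prod_SL E g', component_mx A g' = 1%:M,
    forall B, coherent_component E B -> B != A -> component_mx B g' = component_mx B g
    & elem_genV g' -> elem_genV g].
Proof.
move=> cA gSL; have := SL_elem_gen (gSL A cA).2.
move X: (component_mx A g) => M gM; elim: gM g gSL X => [|i j s Y ij _ IH] g gSL X.
  by exists g.
have ab : enum_val i != enum_val j by rewrite (inj_eq enum_val_inj).
have aA := enum_valP i; have bA := enum_valP j.
have sab : same_component (enum_val i) (enum_val j) by exists A => //; rewrite aA.
have [||g' [g'SL g'A g'B g'gen]] :=
  IH ((\1 + (- s) *: elemV (enum_val i) (enum_val j))%VF \o g)%VF.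
- exact: prod_SL_elem.
- rewrite (component_mx_elem _ _ aA bA) X mulmxA.
  have -> : enum_rank_in aA (enum_val i) = i by apply: enum_val_inj; rewrite enum_rankK_in.
  have -> : enum_rank_in aA (enum_val j) = j by apply: enum_val_inj; rewrite enum_rankK_in.
  by rewrite elem_mxN// mul1mx.
exists g'; split => // [B cB BA|/g'gen]; last exact: elem_genV_red.
rewrite g'B// component_mx_elem0//; apply: contra BA => aB.
by apply/eqP; exact: component_eq cB cA aB aA.
Qed.

(** Induction on the number of components whose block is not the identity. When there are none, [g]
    is the identity because it preserves each component. *)
Lemma prod_SL_gen g : prod_SL E g -> elem_genV g.
Proof.
pose bad (g : 'End(V)) :=
  [set A : {set S} | coherent_component E A & component_mx A g != 1%:M]%SET.
have [n] := ubnP #|bad g|; elim: n g => // n IH g bg gSL.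
have [b0|[A]] := set_0Vmem (bad g).
  have {bg} g1 A : coherent_component E A -> component_mx A g = 1%:M.
    move=> cA; apply/eqP; move: b0 => /setP/(_ A).
    by rewrite !inE cA /= => /negbFE.
  suff -> : g = \1%VF by exact: elem_genV1.
  apply/lfunP => v; rewrite [v]vdecomp !linear_sum; apply: eq_bigr => a _.
  rewrite !linearZ /=; congr (_ *: _); rewrite id_lfunE.
  have [A cA aA] := ex_component a; have [gA _] := gSL A cA.
  apply: vcoordP => c; have [cinA|cA'] := boolP (c \in A); last first.
    rewrite (gA (vbase a))// => [|d dA]; rewrite vcoord_base.
      by have /negbTE-> : c != a by apply: contraNneq cA' => ->.
    by have /negbTE-> : d != a by apply: contraNneq dA => ->.
  have := congr1 (fun M : 'M[R]_(#|A|) => M (enum_rank_in aA c) (enum_rank_in aA a)) (g1 A cA).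
  rewrite !mxE !enum_rankK_in// => ->; rewrite vcoord_base; congr (nat_of_bool _)%:R.
  by rewrite -(inj_eq enum_val_inj) !enum_rankK_in.
rewrite inE => /andP[cA Abad].
have [g' [g'SL g'A g'B g'gen]] := clear_component cA gSL.
apply/g'gen/IH => //; apply: leq_trans (bg : (_ <= n)%N).
apply: proper_card; apply/properP; split.
  apply/fintype.subsetP => B; rewrite !inE => /andP[cB Bbad]; rewrite cB /=.
  rewrite -g'B//; apply: contraNneq Bbad => ->; exact/eqP.
by exists A; rewrite !inE cA//= g'A eqxx.
Qed.

End GraphLieAlgebra.

(** * Matrices of endomorphisms of the Lie algebra *)

Section Transport.
Context {R : realType} {disp : Order.disp_t} {S : finOrderType disp}.
Variable E : rel S.

Local Notation V := (vspaceV R S).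
Local Notation W := (vspaceW R S E).
Local Notation N := (lieN R S E).
Local Notation d := (#|{: S}| + #|{: edge S E}|)%N.

Definition colN (x : N) : 'cV[R]_d := col_mx x.1^T x.2^T.
Definition rowN (y : 'cV[R]_d) : N := ((usubmx y)^T, (dsubmx y)^T).

Lemma colNK : cancel colN rowN.
Proof. by move=> [v w]; rewrite /rowN /colN col_mxKu col_mxKd !trmxK. Qed.

Lemma rowNK : cancel rowN colN.
Proof. by move=> y; rewrite /rowN /colN /= !trmxK vsubmxK. Qed.

Lemma colN_lin : linear colN.
Proof.
move=> c x y; rewrite /colN scale_col_mx add_col_mx; congr col_mx;
by apply/matrixP => i j; rewrite !mxE.
Qed.

HB.instance Definition _ := GRing.isLinear.Build R N 'cV[R]_d _ colN colN_lin.

Definition mxN (f : 'End(N)) : 'M[R]_d :=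
  \matrix_(i, j) colN (f (rowN (delta_mx j 0))) i 0.

Lemma rowN_lin : linear rowN.
Proof. by move=> c x y; apply: (can_inj colNK); rewrite linearP /= !rowNK. Qed.

HB.instance Definition _ := GRing.isLinear.Build R 'cV[R]_d N _ rowN rowN_lin.

Lemma mxNE (f : 'End(N)) (x : N) : colN (f x) = mxN f *m colN x.
Proof.
rewrite -{1}(colNK x); move: (colN x) => y.
rewrite [y in LHS]matrix_sum_delta !linear_sum; apply/colP => i.
rewrite mxE summxE; apply: eq_bigr => j _.
rewrite big_ord_recl big_ord0 addr0 !linearZ.
  rewrite /= mxE mulrC; congr (_ * _).
by rewrite [RHS]mxE.
Qed.

Lemma mxN_ext (A B : 'M[R]_d) : (forall x, A *m colN x = B *m colN x) -> A = B.
Proof.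
move=> AB; apply/matrixP => i j.
have := AB (rowN (delta_mx j 0)); rewrite rowNK -!colE => /colP/(_ i).
by rewrite !mxE.
Qed.

Lemma mxN_comp (f g : 'End(N)) : mxN (f \o g)%VF = mxN f *m mxN g.
Proof. by apply: mxN_ext => x; rewrite -mulmxA -!mxNE comp_lfunE. Qed.

Lemma mxN_id : mxN \1%VF = 1%:M.
Proof. by apply: mxN_ext => x; rewrite -mxNE mul1mx id_lfunE. Qed.

Lemma mxN_add (f g : 'End(N)) : mxN (f + g)%VF = mxN f + mxN g.
Proof. by apply: mxN_ext => x; rewrite mulmxDl -!mxNE lfunE /= linearD. Qed.

Lemma mxN_scale c (f : 'End(N)) : mxN (c *: f)%VF = c *: mxN f.
Proof. by apply: mxN_ext => x; rewrite -scalemxAl -!mxNE lfunE /= linearZ. Qed.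

Lemma mxN_0 : mxN 0%VF = 0.
Proof. by apply: mxN_ext => x; rewrite mul0mx -mxNE lfunE /= linear0. Qed.

Lemma open_colN (A : set 'cV[R]_d) : open A -> open (colN @^-1` A).
Proof.
rewrite !openE => oA x /= /oA /nbhs_ballP [e /= e0 eA].
apply/nbhs_ballP; exists e => //= y [[_ xy1] [_ xy2]]; apply: eA; split => // i j.
by rewrite !mxE; case: (fintype.split i) => k; rewrite !mxE; [exact: xy1|exact: xy2].
Qed.

End Transport.

(** * Invariant means on the Lie algebra *)

Section PolynomialFunctions.
Import -(notations) mpoly.

Lemma poly_eval_linear (K : fieldType) (vT : vectType K) (phi : vT -> K) :
  scalar phi -> exists p, forall x, poly_eval p x = phi x.
Proof.
move=> phil; pose phi' : {scalar vT} := HB.pack phi (GRing.isLinear.Build K vT K _ phi phil).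
have [b bE] : exists b, forall x : vT,
    x = \sum_(k < \dim (fullv : {vspace vT})) coord (vbasis {:vT}) k x *: b k.
  by exists (fun k => (vbasis {:vT})`_k) => x; rewrite -coord_vbasis ?memvf.
rewrite /poly_eval; move: (coord _) bE; move: (\dim _) b => n b c bE.
exists (\sum_(k < n) mpolyC n (phi (b k)) * mpolyX K (mnm1 k)) => x.
rewrite rmorph_sum /= [in RHS](bE x) -[RHS]/(phi' _) linear_sum.
apply: eq_bigr => k _; rewrite rmorphM /= mevalC mevalXU.
by rewrite -[phi (_ *: _)]/(phi' _) linearZ /= mulrC.
Qed.

Lemma poly_evalC (K : fieldType) (vT : vectType K) (c : K) :
  exists p, forall x : vT, poly_eval p x = c.
Proof. by exists (mpolyC _ c) => f; rewrite /poly_eval mevalC. Qed.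

Lemma poly_evalD (K : fieldType) (vT : vectType K) (p q : mpoly _ K) :
  exists r, forall x : vT, poly_eval r x = poly_eval p x + poly_eval q x.
Proof. by exists (p + q) => f; rewrite /poly_eval rmorphD. Qed.

Lemma poly_evalM (K : fieldType) (vT : vectType K) (p q : mpoly _ K) :
  exists r, forall x : vT, poly_eval r x = poly_eval p x * poly_eval q x.
Proof. by exists (p * q) => f; rewrite /poly_eval rmorphM. Qed.

End PolynomialFunctions.

Section FixedVector.
Context {R : realType} {disp : Order.disp_t} {S : finOrderType disp}.
Variable E : rel S.
Hypothesis E_sym : symmetric E.
Hypothesis E_irr : irreflexive E.

Local Notation V := (vspaceV R S).
Local Notation W := (vspaceW R S E).
Local Notation N := (lieN R S E).
Local Notation d := (#|{: S}| + #|{: edge S E}|)%N.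

(** Zariski closure is defined by polynomials in the coordinates for [vbasis]; this makes it
    available for polynomials in matrix entries. *)
Lemma mxpoly_poly_eval (P : 'M[R]_d -> R) : mxpoly P ->
  exists p, forall f : 'End(N), poly_eval p f = P (mxN f).
Proof.
elim=> [i j|c|Q Q' _ [q Hq] _ [q' Hq']|Q Q' _ [q Hq] _ [q' Hq']].
- by apply: poly_eval_linear => c f g; rewrite mxN_add mxN_scale !mxE.
- exact: poly_evalC.
- by have [r Hr] := poly_evalD q q'; exists r => f; rewrite Hr Hq Hq'.
- by have [r Hr] := poly_evalM q q'; exists r => f; rewrite Hr Hq Hq'.
Qed.

(** As [D] squares to zero, [1 + s D] is the one-parameter group generated by [D]. *)
Definition unipotent_line : set 'End(N) :=
  [set D | (D \o D)%VF = 0 /\ forall s, groupTL R E (\1 + s *: D)%VF].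

Lemma end_lfunE (s : R) (D : 'End(N)) x : (\1 + s *: D)%VF x = x + s *: D x.
Proof. by rewrite !lfunE /= !lfunE. Qed.

Lemma prod_SL_id : prod_SL E (\1%VF : 'End(V)).
Proof.
move=> A cA; split=> [v|]; first by rewrite id_lfunE.
rewrite (_ : component_mx _ _ = 1%:M) ?det1//; apply/matrixP => i j.
by rewrite !mxE id_lfunE vcoord_base (inj_eq enum_val_inj).
Qed.

Lemma groupL_id : groupL (E := E) (\1%VF : 'End(N)).
Proof.
split; first by split=> [|x y]; rewrite ?id_lfunE//; exists id => x; rewrite !id_lfunE.
by exists \1%VF; split=> [|v]; [exact: prod_SL_id|rewrite !id_lfunE].
Qed.

Lemma ex_theta (theta : 'Hom(V, W)) :
  exists2 D : 'End(N), unipotent_line D & forall x, D x = (0, theta x.1).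
Proof.
have lin : linear (fun x : N => (0, theta x.1) : N).
  by move=> c x y; rewrite pairZ pairD scaler0 addr0 linearP.
have [D DE] := ex_linfun lin; exists D => //; split=> [|s].
  by apply/lfunP => x; rewrite comp_lfunE !DE /= linear0 lfunE.
exists (\1 + s *: D)%VF, \1%VF; split; [|exact: groupL_id|].
  by exists (s *: theta) => x; rewrite end_lfunE DE pairZ scaler0 lfunE.
by rewrite comp_lfun1r.
Qed.

Lemma elem_groupL a b (s : R) : a != b -> same_component E a b ->
  groupL (E := E) (\1 + s *: elemD E a b : 'End(N))%VF.
Proof.
move=> ab sab; have coh := same_component_coh sab.
have D2 x : elemD E a b (elemD E a b x) = 0 :> N.
  by rewrite -comp_lfunE elemD2// lfunE.
split; first split.
- exists (\1 + (- s) *: elemD E a b)%VF => x; rewrite !end_lfunE linearD linearZ /= D2;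
  by rewrite scaler0 addr0 -addrA -scalerDl ?addrN ?addNr scale0r addr0.
- by move=> x y; exact: elem_br.
exists (\1 + s *: elemV a b)%VF; split.
  rewrite -[_ + _]comp_lfun1r; apply: prod_SL_elem => //; exact: prod_SL_id.
by move=> v; rewrite end_lfunE elemD_V elemVfE elemVE pairZ pairD scaler0 addr0.
Qed.

Lemma elem_unipotent_line a b (c : R) : a != b -> same_component E a b ->
  unipotent_line (c *: elemD E a b).
Proof.
move=> ab sab; have coh := same_component_coh sab; split=> [|s].
  by rewrite -comp_lfunZl -comp_lfunZr elemD2// !scaler0.
exists \1%VF, (\1 + (s * c) *: elemD E a b)%VF; split.
- by exists 0 => x; rewrite id_lfunE lfunE /= -[RHS]/(x + 0) addr0.
- exact: elem_groupL.
- by rewrite comp_lfun1l scalerA.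
Qed.

Local Notation U := (@mxN R disp S E @` unipotent_line).

Lemma unipotent_gen_mul (A B : 'M[R]_d) :
  unipotent_gen U A -> unipotent_gen U B -> unipotent_gen U (A *m B).
Proof.
by move=> + gB; elim=> [|D g UD _ IH]; rewrite ?mul1mx// -mulmxA; exact: unipotent_genM.
Qed.

Lemma elem_genV_lift g : elem_genV E g -> exists l : 'End(N),
  [/\ forall x y, l (bracket x y) = bracket (l x) (l y),
      forall v, l (v, 0) = (g v, 0) & unipotent_gen U (mxN l)].
Proof.
elim=> [|a b s h ab sab _ [l [lb lV lU]]].
  exists \1%VF; split=> [x y|v|]; rewrite ?id_lfunE//.
  by rewrite mxN_id; exact: unipotent_gen1.
exists ((\1 + s *: elemD E a b) \o l)%VF; split=> [x y|v|].
- rewrite !comp_lfunE lb elem_br// => c; exact: same_component_coh sab.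
- by rewrite !comp_lfunE lV end_lfunE elemD_V elemVfE elemVE pairZ pairD scaler0 addr0.
rewrite mxN_comp mxN_add mxN_id mxN_scale -mxN_scale; apply: unipotent_genM => //.
by exists (s *: elemD E a b) => //; exact: elem_unipotent_line.
Qed.

(** The factor in [T] is a single [1 + D]. The factor in [L] agrees on [V] with a product of
    elementary automorphisms, hence everywhere. *)
Lemma groupTL_gen f : groupTL R E f -> unipotent_gen U (mxN f).
Proof.
move=> [t [l [[theta tE] [[_ lb] [g [gSL lV]]] ->]]].
rewrite mxN_comp; apply: unipotent_gen_mul.
  have [D UD DE] := ex_theta theta.
  have -> : t = (\1 + D)%VF.
    by apply/lfunP => x; rewrite tE lfunE /= id_lfunE DE.
  rewrite mxN_add mxN_id -[_ + _]mulmx1; apply: unipotent_genM; first by exists D.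
  exact: unipotent_gen1.
have [l' [lb' lV' lU']] := elem_genV_lift (prod_SL_gen E_sym gSL).
suff -> : l = l' by [].
by apply: autN_ext => // v; rewrite lV lV'.
Qed.

Variables (Gamma : set 'End(N)) (m : set N -> R).
Hypothesis E_neq0 : exists a b, E a b.
Hypothesis Gamma_subgroup : is_subgroupGL Gamma.
Hypothesis Gamma_dense : zariski_dense_in Gamma (groupTL R E).
Hypothesis m0 : m set0 = 0.
Hypothesis m_mono : forall A B, open A -> open B -> A `<=` B -> m A <= m B.
Hypothesis m_mod : forall A B, open A -> open B ->
  m (A `|` B) + m (A `&` B) = m A + m B.
Hypothesis m_inv : forall (f : 'End(N)) A, Gamma f -> open A -> m (f @^-1` A) = m A.
Hypothesis m_neq0 : 0 < m [set x | x != 0].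

Lemma Gamma_fixed_vector :
  exists2 w : W, w != 0 & forall f, Gamma f -> f (0, w) = (0, w).
Proof.
have [Gbij G1 GM GV] := Gamma_subgroup; have [GTL GZ] := Gamma_dense.
have [|||||||||||x x0 xD] := @invariant_mean_fixed_vector R d (@mxN R disp S E @` Gamma) U
  (fun A : set 'cV[R]_d => m (@colN R disp S E @^-1` A)).
- by exists \1%VF; rewrite ?mxN_id.
- move=> _ _ [f Gf <-] [g Gg <-]; exists (f \o g)%VF; rewrite ?mxN_comp//; exact: GM.
- move=> _ [f Gf <-]; have := GV f Gf; pose fi : 'End(N) := (f^-1)%VF => Gfi.
  exists (mxN fi); first by exists fi.
  rewrite -mxN_comp -mxN_id; congr mxN.
  have [g fK gK] := Gbij f Gf.
  have f0 : lker f == 0%VS by apply/lker0P; exact: can_inj fK.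
  apply/lfunP => y; rewrite comp_lfunE id_lfunE -{1}(gK y) lker0_lfunK// gK.
- by move=> _ [D [D2 _] <-]; rewrite -mxN_comp D2 mxN_0.
- move=> P Ppoly PG _ s [D [_ DTL] <-].
  have [p pE] := mxpoly_poly_eval Ppoly.
  rewrite -mxN_scale -mxN_id -mxN_add -pE; apply: (GZ _ (DTL s)) => f Gf.
  by rewrite pE; apply: PG; exists f.
- by move=> _ [f /GTL Gf <-]; exact: groupTL_gen.
- by rewrite preimage_set0.
- by move=> A B oA oB AB; apply: m_mono; [exact: open_colN|exact: open_colN|move=> z /AB].
- by move=> A B oA oB; rewrite preimage_setU preimage_setI m_mod//; exact: open_colN.
- move=> _ A [f Gf <-] oA; rewrite -[RHS](m_inv Gf); last exact: open_colN.
  by congr m; apply/funext => y; rewrite /preimage /= mxNE.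
- rewrite (_ : _ @^-1` _ = [set x | x != 0])//; apply/funext => y /=.
  congr (is_true (~~ _)); rewrite -(inj_eq (can_inj (colNK (E := E)))).
  by rewrite linear0.
have xrow D : unipotent_line D -> D (rowN x) = 0.
  move=> UD; apply: (can_inj (colNK (E := E))); rewrite mxNE rowNK linear0.
  by apply: xD; exists D.
have rx0 : rowN x != 0 by rewrite -(inj_eq (can_inj (colNK (E := E)))) rowNK linear0.
have [a [b Eab]] := E_neq0.
have [p _] : exists p : edge S E, true.
  have [ab|ba|ab] := ltgtP a b; last by move: Eab; rewrite ab E_irr.
    by exists (exist _ (a, b) (introT andP (conj ab Eab))).
  by rewrite E_sym in Eab; exists (exist _ (b, a) (introT andP (conj ba Eab))).
(* For the direction in [T] given by [v |-> v_c u_p], with [p] a fixed edge, [D x = 0] says that the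
   coordinate [c] of [x] is zero. *)
have xV : (rowN x).1 = 0.
  apply: vcoordP => c.
  have lin : linear (fun v : V => vcoord v c *: wbase p : W).
    by move=> s u v; rewrite vcoord_lin scalerDl scalerA.
  have [theta thE] := ex_linfun lin.
  have [D UD DE] := ex_theta theta.
  have := xrow D UD; rewrite DE thE => -[/rowP/(_ (enum_rank p))].
  by rewrite !mxE !eqxx mulr1 => ->; rewrite /vcoord mxE.
exists (rowN x).2.
  by apply: contra rx0 => /eqP x2; rewrite (surjective_pairing (rowN x)) xV x2.
have -> : (0, (rowN x).2) = rowN x by rewrite -xV -surjective_pairing.
move=> f /GTL/groupTL_gen fU; apply: (can_inj (colNK (E := E))).
rewrite mxNE rowNK; elim: fU => [|A B UA _ IH]; first by rewrite mul1mx.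
by rewrite -mulmxA IH mulmxDl mul1mx xD// addr0.
Qed.

End FixedVector.

(** * The nilmanifold *)

Lemma eq_continuous (T U : topologicalType) (f g : T -> U) :
  f =1 g -> continuous f -> continuous g.
Proof. by move=> /funext ->. Qed.

Lemma continuous_mx (R : realType) (T : topologicalType) m n (f : T -> 'M[R]_(m, n)) :
  (forall i j, continuous (fun t => f t i j)) -> continuous f.
Proof.
move=> fc t; apply/cvgrPdist_le => e e0.
have /(@filter_forall _ _ (fun ij t' => `|f t ij.1 ij.2 - f t' ij.1 ij.2| <= e)) H :
    forall ij : 'I_m * 'I_n, \forall t' \near t, `|f t ij.1 ij.2 - f t' ij.1 ij.2| <= e.
  by move=> [i j]; have /cvgrPdist_le/(_ e e0) := fc i j t.
apply: filterS H => t' H; apply/mx_norm_leP; first exact: ltW.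
by move=> i j; rewrite !mxE; exact: (H (i, j)).
Qed.

Section TopologyOfN.
Context {R : realType} {disp : Order.disp_t} {S : finOrderType disp}.
Variable E : rel S.

Local Notation V := (vspaceV R S).
Local Notation W := (vspaceW R S E).
Local Notation N := (lieN R S E).
Local Notation br := (@bracketV R disp S E).

Lemma bracketV_coord (u v : V) j (p := val (enum_val j)) :
  br u v 0 j = vcoord u p.1 * vcoord v p.2 - vcoord u p.2 * vcoord v p.1.
Proof.
rewrite /bracketV summxE (bigD1 (enum_val j))//= !mxE enum_valK !eqxx mulr1.
rewrite big1 ?addr0// => q qj; rewrite !mxE eqxx /=.
by rewrite -(inj_eq enum_val_inj) enum_rankK eq_sym (negbTE qj) mulr0.
Qed.

Lemma continuous_N (T : topologicalType) (f : T -> N) :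
  (forall i, continuous (fun t => (f t).1 0 i)) ->
  (forall j, continuous (fun t => (f t).2 0 j)) -> continuous f.
Proof.
move=> f1 f2 t.
have c1 : continuous (fun t => (f t).1) by apply: continuous_mx => i j; rewrite ord1.
have c2 : continuous (fun t => (f t).2) by apply: continuous_mx => i j; rewrite ord1.
have -> : f = (fun t => ((f t).1, (f t).2)).
  by apply/funext => x; rewrite -surjective_pairing.
exact: cvg_pair (c1 t) (c2 t).
Qed.

Lemma continuous_coord1 (T : topologicalType) (f : T -> N) i :
  continuous f -> continuous (fun t => (f t).1 0 i).
Proof.
move=> fc t; apply: (@continuous_comp _ _ _ (fun t => (f t).1) (fun v : V => v 0 i));
  last exact: coord_continuous.
by apply: (@continuous_comp _ _ _ f fst); [exact: fc|exact: cvg_fst].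
Qed.

Lemma continuous_coord2 (T : topologicalType) (f : T -> N) i :
  continuous f -> continuous (fun t => (f t).2 0 i).
Proof.
move=> fc t; apply: (@continuous_comp _ _ _ (fun t => (f t).2) (fun w : W => w 0 i));
  last exact: coord_continuous.
by apply: (@continuous_comp _ _ _ f snd); [exact: fc|exact: cvg_snd].
Qed.

Lemma continuous_nmul (T : topologicalType) (f g : T -> N) :
  continuous f -> continuous g -> continuous (fun t => nmul E (f t) (g t)).
Proof.
move=> fc gc; apply: continuous_N => i t.
  rewrite (_ : (fun t => _) = (fun t => (f t).1 0 i + (g t).1 0 i)); last first.
    by apply/funext => s; rewrite !mxE.
  by apply: cvgD; apply: continuous_coord1.
rewrite (_ : (fun t => _) = (fun t => (f t).2 0 i + (g t).2 0 i +
    2^-1 * br (f t).1 (g t).1 0 i)); last first.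
  by apply/funext => s; rewrite !mxE.
apply: cvgD; first by apply: cvgD; apply: continuous_coord2.
apply: cvgM; first exact: cvg_cst.
under eq_fun do rewrite bracketV_coord.
rewrite /= bracketV_coord.
apply: cvgB; apply: cvgM; exact: continuous_coord1.
Qed.

Lemma continuous_ninv (T : topologicalType) (f : T -> N) :
  continuous f -> continuous (fun t => ninv (f t)).
Proof.
move=> fc; apply: continuous_N => i t.
  under eq_fun do rewrite mxE.
  by apply: cvgN; exact: continuous_coord1.
under eq_fun do rewrite mxE.
by apply: cvgN; exact: continuous_coord2.
Qed.

Lemma continuous_End (T : topologicalType) (h : 'End(N)) (f : T -> N) :
  continuous f -> continuous (fun t => h (f t)).
Proof.
move=> fc.
have colc k : continuous (fun t => colN (f t) k 0).
  rewrite -[k]splitK; case: (fintype.split k) => l /=.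
    apply: (@eq_continuous _ _ (fun t => (f t).1 0 l)); last exact: continuous_coord1.
    by move=> t; rewrite col_mxEu mxE.
  apply: (@eq_continuous _ _ (fun t => (f t).2 0 l)); last exact: continuous_coord2.
  by move=> t; rewrite col_mxEd mxE.
have hc k : continuous (fun t => colN (h (f t)) k 0).
  apply: (@eq_continuous _ _ (fun t => \sum_j mxN h k j * colN (f t) j 0)).
    by move=> t; rewrite mxNE mxE.
  move=> t; apply: cvg_big => [|l _]; first exact: add_continuous.
  by apply: cvgM; [exact: cvg_cst|exact: colc].
apply: continuous_N => i.
  by apply: eq_continuous (hc (lshift _ i)) => t; rewrite col_mxEu mxE.
by apply: eq_continuous (hc (rshift _ i)) => t; rewrite col_mxEd mxE.
Qed.

(** A countable basis of the topology, by balls with rational centres and radii [1 / (n + 1)]. It is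
    what turns open conditions on pairs of cosets into measurable ones. *)
Definition Nbasis (q : 'rV[rat]_#|{: S}| * 'rV[rat]_#|{: edge S E}| * nat) : set N :=
  ball (map_mx ratr q.1.1 : V, map_mx ratr q.1.2 : W) (q.2.+1%:R^-1).

Lemma open_Nbasis q : open (Nbasis q).
Proof. exact: (@ball_open R (V * W)%type). Qed.

Lemma rat_mx_dense n (v : 'rV[R]_n) (e : R) : 0 < e ->
  exists q : 'rV[rat]_n, ball (map_mx ratr q : 'rV[R]_n) e v.
Proof.
move=> e0.
have H i : {q : rat | `|ratr q - v 0 i| < e}.
  apply: cid; have [|q] := @rat_in_itvoo R (v 0 i - e) (v 0 i + e).
    by rewrite ltrBlDr -addrA ltrDl addr_gt0.
  rewrite in_itv /= => /andP[q1 q2]; exists q; rewrite ltr_norml; lra.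
exists (\row_i sval (H i)); split => // i j.
by rewrite ord1 !mxE /ball /=; exact: (svalP (H j)).
Qed.

Lemma NbasisP (x : N) (O : set N) : open O -> O x ->
  exists q, Nbasis q x /\ Nbasis q `<=` O.
Proof.
rewrite openE => /(_ x) H /H /nbhs_ballP [e /= e0 eO].
have [n ne] : exists n : nat, n.+1%:R^-1 < e / 2.
  have e2 : 0 < e / 2 by rewrite divr_gt0.
  have /cvgrPdist_lt/(_ _ e2) := @cvg_harmonic R.
  move=> /filter_ex[n]; rewrite sub0r normrN /= => Hn; exists n.
  by rewrite (le_lt_trans _ Hn)// ler_norm.
have n0 : 0 < n.+1%:R^-1 :> R by rewrite invr_gt0.
have [q1 x1] := rat_mx_dense x.1 n0; have [q2 x2] := rat_mx_dense x.2 n0.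
have bx : Nbasis (q1, q2, n) x by split.
exists (q1, q2, n); split => // y qy; apply: eO.
have := ball_triangle (ball_sym bx) qy; apply: le_ball => /=.
by rewrite (splitr e) lerD// ltW.
Qed.

End TopologyOfN.

(* Going through an arbitrary [X] makes the measurable structure on the product
   literally that of [property_T_relative_to_space]. *)
Definition square d (X : measurableType d) : measurableType _ := (X * X)%type.

Section Nilmanifold.
Context {R : realType} {disp : Order.disp_t} {S : finOrderType disp}.
Variable E : rel S.

Local Notation V := (vspaceV R S).
Local Notation W := (vspaceW R S E).
Local Notation N := (lieN R S E).
Local Notation X := (nilmanifold R E).
Local Notation br := (@bracketV R disp S E).
Local Notation mulN := (@nmul R disp S E).

Definition piN (x : N) : X := (\pi_(nilmanifold R E) x)%qT.

Lemma nmulVr (x : N) : mulN x (ninv x) = nunit E.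
Proof. by rewrite -[x in nmul _ x _]ninvK nmulV. Qed.

Lemma nmul1l (x : N) : mulN (nunit E) x = x.
Proof. by rewrite -(nmulVr x) -nmulA nmulV nmul1. Qed.

Lemma nmulKr (x y : N) : mulN (mulN x y) (ninv y) = x.
Proof. by rewrite -nmulA nmulVr nmul1. Qed.

Lemma nmulVKr (x y : N) : mulN (mulN x (ninv y)) y = x.
Proof. by rewrite -nmulA nmulV nmul1. Qed.

Lemma nmulKl (x y : N) : mulN (ninv x) (mulN x y) = y.
Proof. by rewrite nmulA nmulV nmul1l. Qed.

Lemma nmulVKl (x y : N) : mulN x (mulN (ninv x) y) = y.
Proof. by rewrite nmulA nmulVr nmul1l. Qed.

(** The half in the product multiplies an integral bracket, so these conditions define a subgroup,
    and it contains the generators. *)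
Lemma NZ_half_integral (x : N) : NZ R E x ->
  (forall i, x.1 0 i \is a Num.int) /\ (forall j, 2 * x.2 0 j \is a Num.int).
Proof.
move=> Hx; apply: (Hx [set y : N | (forall i, y.1 0 i \is a Num.int) /\
  (forall j, 2 * y.2 0 j \is a Num.int)]); split; last first.
  move=> y [y1 y2]; split => // j; apply: rpredM; [exact: rpred_nat|exact: y2].
split.
- by split => i; rewrite mxE ?mulr0 rpred0.
- move=> a b [a1 a2] [b1 b2]; split => i.
    by rewrite mxE rpredD.
  rewrite !mxE mulrDr mulrDr mulVKf// bracketV_coord.
  apply: rpredD; first by apply: rpredD; [exact: a2|exact: b2].
  apply: rpredB; apply: rpredM; by [exact: a1|exact: b1].
- by move=> a [a1 a2]; split => i; rewrite mxE ?mulrN rpredN.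
Qed.

Lemma piN_eq (x y : N) : piN x = piN y <-> NZ R E (mulN (ninv x) y).
Proof.
have H := @eqmodP N (@same_coset_equivRel R disp S E) x y.
by split=> [/H/asboolP|xy]; last by apply/H/asboolP.
Qed.

Lemma piN_surj (z : X) : exists x, z = piN x.
Proof. by exists (repr z); rewrite /piN reprK. Qed.

Lemma piN_continuous : continuous piN.
Proof. exact: pi_continuous. Qed.

Lemma open_nilmanifold (A : set X) : open (piN @^-1` A) -> open A.
Proof. by []. Qed.

Lemma piN_open (Q : set N) : open Q -> open (piN @` Q).
Proof.
move=> oQ; apply: open_nilmanifold.
rewrite (_ : _ @^-1` _ = \bigcup_(l in NZ R E) ((fun y => mulN y l) @^-1` Q)).
  apply: bigcup_open => l _; apply: open_comp oQ => y _.
  by apply: continuous_nmul => ?; [exact: cvg_id|exact: cvg_cst].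
apply/seteqP; split=> y /=.
  move=> [x Qx /esym/piN_eq yx]; exists (mulN (ninv y) x) => //.
  by rewrite /= nmulVKl.
move=> [l Hl Ql]; exists (mulN y l) => //; apply/esym/piN_eq.
by rewrite nmulKl.
Qed.

Lemma coset_mapE (f : N -> N) :
  (forall x y, piN x = piN y -> piN (f x) = piN (f y)) ->
  forall x, coset_map E f (piN x) = piN (f x).
Proof. by move=> H x; apply: H; rewrite /piN reprK. Qed.

Lemma coset_map_continuous (f : N -> N) :
  continuous f -> (forall x y, piN x = piN y -> piN (f x) = piN (f y)) ->
  continuous (coset_map E f).
Proof.
move=> fc H; apply/continuousP => A oA; apply: open_nilmanifold.
rewrite (_ : _ @^-1` _ = f @^-1` (piN @^-1` A)).
  have oA' : open (piN @^-1` A) by apply: open_comp oA => x _; exact: piN_continuous.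
  by apply: open_comp oA' => x _; exact: fc.
by apply/seteqP; split => x /=; rewrite coset_mapE.
Qed.

Lemma measurable_open (A : set X) : open A -> measurable A.
Proof. exact: sub_sigma_algebra. Qed.

Lemma measurable_fun_continuous (f : X -> X) :
  continuous f -> measurable_fun setT f.
Proof.
move=> fc; apply: measurability => // _ [A oA <-].
rewrite setTI; apply: measurable_open; exact: open_comp oA.
Qed.

(** Two elements of this ball differ by less than [1 / 4] in each coordinate, whereas a non-zero
    coordinate of an element of [NZ] is at least [1 / 2]. *)
Definition small : set N := ball (0 : N) 8^-1.

Lemma open_small : open small.
Proof. exact: (@ball_open R (V * W)%type). Qed.

Lemma small0 : small 0.
Proof. exact: ballxx. Qed.

Lemma smallP (u : N) : small u ->
  (forall i, `|u.1 0 i| < 8^-1) /\ (forall j, `|u.2 0 j| < 8^-1).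
Proof.
move=> [[_ u1] [_ u2]]; split=> i.
  by have := u1 0 i; rewrite /ball /= mxE sub0r normrN.
by have := u2 0 i; rewrite /ball /= mxE sub0r normrN.
Qed.

(** The element [s^-1 u^-1 u' s] lies in [NZ]. Its [V] part [u'.1 - u.1] is integral and small,
    hence zero. Then [u^-1 u'] is central, the conjugation by [s] disappears, and the half-integral
    [W] part is treated in the same way. *)
Lemma small_uniq (s u u' : N) : small u -> small u' ->
  piN (mulN u s) = piN (mulN u' s) -> u = u'.
Proof.
move=> /smallP[u1 u2] /smallP[v1 v2] /piN_eq/NZ_half_integral[c1 c2].
have uv1 : u.1 = u'.1.
  apply/rowP => i; apply/eqP; rewrite eq_sym -subr_eq0; apply/negPn/negP => nz.
  have uvE : (mulN (ninv (mulN u s)) (mulN u' s)).1 0 i = u'.1 0 i - u.1 0 i.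
    by rewrite !mxE; ring.
  have := c1 i; rewrite uvE => /norm_intr_ge1/(_ nz).
  have := ler_normB (u'.1 0 i) (u.1 0 i); have := u1 i; have := v1 i; lra.
have uv2 : u.2 = u'.2.
  apply/rowP => i; apply/eqP; rewrite eq_sym -subr_eq0; apply/negPn/negP => nz.
  have uvE : (mulN (ninv (mulN u s)) (mulN u' s)).2 0 i = u'.2 0 i - u.2 0 i.
    rewrite /nmul /= uv1 bracketVNl bracketVv oppr0 scaler0 addr0 !mxE; ring.
  have := c2 i; rewrite uvE => /norm_intr_ge1.
  rewrite mulf_neq0// => /(_ isT); rewrite normrM ger0_norm//.
  have := ler_normB (u'.2 0 i) (u.2 0 i); have := u2 i; have := v2 i; lra.
by rewrite (surjective_pairing u) uv1 uv2 -surjective_pairing.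
Qed.

Lemma piN_mul (u x y : N) : piN x = piN y -> piN (mulN u x) = piN (mulN u y).
Proof.
move=> /piN_eq xy; apply/piN_eq.
by rewrite ninvM -nmulA (nmulA (ninv u)) nmulV nmul1l.
Qed.

(* The pairs [(x, u x)] with [u] in [A]; for [A] contained in [small], the
   element [u] is determined by the pair. *)
Definition near (A : set N) : set (square X) :=
  [set z | exists u s, [/\ A u, z.1 = piN s & z.2 = piN (mulN u s)]].

Lemma nearP (A : set N) (s : N) (y : X) :
  near A (piN s, y) -> exists2 u, A u & y = piN (mulN u s).
Proof. by move=> [u [s' [Au /= ss' ->]]]; exists u => //; exact: piN_mul. Qed.

Lemma nearI (A B : set N) : A `<=` small -> B `<=` small ->
  near (A `&` B) = near A `&` near B.
Proof.
move=> As Bs; apply/seteqP; split => [[x y]|[x y] []].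
  by move=> [u [s [[Au Bu] /= -> ->]]]; split; exists u, s.
have [s ->] := piN_surj x.
move=> /nearP[u Au ->] /nearP[v Bv /small_uniq uv].
by exists u, s; split => //; split => //; rewrite uv//; [exact: As|exact: Bs].
Qed.

Lemma nearU (A B : set N) : near (A `|` B) = near A `|` near B.
Proof.
apply/seteqP; split => z.
  by move=> [u [s [[Au|Bu] zs zu]]]; [left|right]; exists u, s.
by move=> [|] [u [s [Au zs zu]]]; exists u, s; split => //; [left|right].
Qed.

Lemma near_mono (A B : set N) : A `<=` B -> near A `<=` near B.
Proof. by move=> AB z [u [s [/AB Bu zs zu]]]; exists u, s. Qed.

Lemma near0 : near set0 = set0.
Proof. by apply/seteqP; split => z // [u [s []]]. Qed.

Lemma near_diagonal : near [set 0] = diagonal.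
Proof.
have m0 s : mulN 0 s = s by exact: nmul1l.
apply/seteqP; split => [[x y] [u [s [/= -> -> ->]]]|[x y] /= xy].
  by rewrite m0.
have [s sE] := piN_surj x; exists 0, s; split => //=.
by rewrite m0 -sE; exact/esym.
Qed.

(** An open condition on [r s^-1] holds on whole rational balls around [s] and [r]. The set is thus
    a countable union of open rectangles, as measurability for the product structure requires. *)
Lemma measurable_near (A : set N) : open A -> measurable (near A).
Proof.
move=> oA.
pose idx := ('rV[rat]_#|{: S}| * 'rV[rat]_#|{: edge S E}| * nat)%type.
pose I := {ij : idx * idx | `[< forall s r, Nbasis ij.1 s -> Nbasis ij.2 r ->
  A (mulN r (ninv s)) >]}.
rewrite (_ : near A = \bigcup_(ij : I)
    ((piN @` Nbasis (sval ij).1) `*` (piN @` Nbasis (sval ij).2))).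
  apply: countable_bigcupT_measurable => [|ij].
    exact: countableP.
  by apply: measurableX; apply: measurable_open; apply: piN_open; exact: open_Nbasis.
apply/seteqP; split => [[x y] [u [s [Au /= -> ->]]]|[x y] [[[i j] /= /asboolP H] _ /= []]].
  have c1 : continuous (fun z : N * N => mulN z.2 (ninv z.1)).
    apply: continuous_nmul; first by move=> z; exact: cvg_snd.
    by apply: continuous_ninv => z; exact: cvg_fst.
  have /= : nbhs (s, mulN u s) ((fun z : N * N => mulN z.2 (ninv z.1)) @^-1` A).
    by apply: c1; apply: open_nbhs_nbhs; split => //=; rewrite nmulKr.
  move=> [[P Q] [/= /nbhs_interior nP /nbhs_interior nQ] PQA].
  have [i [si iP]] := NbasisP (@open_interior _ P) (nbhs_singleton nP).
  have [j [rj jQ]] := NbasisP (@open_interior _ Q) (nbhs_singleton nQ).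
  have H : `[< forall s' r', Nbasis i s' -> Nbasis j r' -> A (mulN r' (ninv s')) >].
    apply/asboolP => s' r'; move=> /iP/interior_subset Ps' /jQ/interior_subset Qr'.
    exact: (PQA (s', r')).
  by exists (exist _ (i, j) H) => //=; split; [exists s|exists (mulN u s)].
move=> [s si <-] [r rj <-]; exists (mulN r (ninv s)), s; split => //.
  exact: H.
by rewrite /= nmulVKr.
Qed.

Lemma open_punctured (A : set N) : open A -> open (A `\` [set 0]).
Proof.
move=> oA; rewrite setDE; apply: openI => //; apply: closed_openC.
apply: accessible_closed_set1; apply: hausdorff_accessible.
exact: (@norm_hausdorff R (V * W)%type).
Qed.

Lemma near_punctured : near (small `\` [set 0]) = near small `\` diagonal.
Proof.
have s0 : [set 0] `<=` small by move=> _ ->; exact: small0.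
have sm : (small `\` [set 0]) `<=` small by move=> u [].
rewrite -near_diagonal; apply/seteqP; split => z.
  move=> zn; split; first exact: near_mono zn.
  move=> zd; have : near ([set 0] `&` (small `\` [set 0])) z by rewrite nearI.
  rewrite (_ : _ `&` _ = set0) ?near0//.
  by apply/seteqP; split => y // [-> [_]]; apply.
move=> [zs nz]; have : near ([set 0] `|` (small `\` [set 0])) z.
  apply: near_mono zs => y sy.
  by have [->|y0] := pselect (y = 0); [left|right].
by rewrite nearU => -[].
Qed.

Lemma measurable_diagonal : measurable (@diagonal X : set (square X)).
Proof.
have -> : @diagonal X = near small `\` near (small `\` [set 0]).
  rewrite near_punctured setDD setIidr// -near_diagonal.
  by apply: near_mono => _ ->; exact: small0.
have os := open_small; have ops := open_punctured os.
by apply: measurableD; exact: measurable_near.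
Qed.

End Nilmanifold.

(** * From almost invariant couplings to invariant means *)

Section RealProbability.
Context d (T : measurableType d) (R : realType) (P : probability T R).
Implicit Types A B : set T.

Definition pr A : R := fine (P A).

Lemma prE A : measurable A -> P A = (pr A)%:E.
Proof. by move=> mA; rewrite /pr fineK// fin_num_measure. Qed.

Lemma pr_ge0 A : 0 <= pr A.
Proof. by rewrite /pr fine_ge0. Qed.

Lemma pr_le1 A : measurable A -> pr A <= 1.
Proof. by move=> mA; rewrite -lee_fin -prE// probability_le1. Qed.

Lemma pr0 : pr set0 = 0.
Proof. by rewrite /pr measure0. Qed.

Lemma pr_mono A B : measurable A -> measurable B -> A `<=` B -> pr A <= pr B.
Proof. by move=> mA mB AB; rewrite -lee_fin -!prE// le_measure// inE. Qed.

Lemma prD A B : measurable A -> measurable B -> pr (A `\` B) = pr A - pr (A `&` B).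
Proof.
move=> mA mB; apply: EFin_inj; rewrite EFinB -!prE//; last 2 first.
- exact: measurableI.
- exact: measurableD.
by rewrite measureD// -ge0_fin_numE ?fin_num_measure.
Qed.

Lemma pr_disjU A B : measurable A -> measurable B -> A `&` B = set0 ->
  pr (A `|` B) = pr A + pr B.
Proof.
move=> mA mB AB; apply: EFin_inj; rewrite EFinD -!prE ?measureU//.
exact: measurableU.
Qed.

Lemma pr_mod A B : measurable A -> measurable B ->
  pr (A `|` B) + pr (A `&` B) = pr A + pr B.
Proof.
move=> mA mB; have mAB := measurableD mA mB.
have -> : A `|` B = B `|` (A `\` B).
  by apply/seteqP; split => x /=; have := pselect (B x); tauto.
rewrite pr_disjU ?prD//; first by ring.
by apply/seteqP; split => x //= -[? []].
Qed.

Lemma pr_capge A B : measurable A -> measurable B -> pr A - (1 - pr B) <= pr (A `&` B).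
Proof.
move=> mA mB; have := pr_mod mA mB; have := pr_le1 (measurableU _ _ mA mB); lra.
Qed.

Lemma pr_sum_le (F : (set T)^nat) n A : (forall k, measurable (F k)) ->
  trivIset setT F -> measurable A -> (forall k, F k `<=` A) ->
  \sum_(k < n) pr (F k) <= pr A.
Proof.
move=> mF tF mA FA.
have mU m : measurable (\big[setU/set0]_(k < m) F k) by apply: bigsetU_measurable.
have <- : pr (\big[setU/set0]_(k < n) F k) = \sum_(k < n) pr (F k).
  elim: n => [|n IH]; first by rewrite !big_ord0 pr0.
  rewrite !big_ord_recr /= pr_disjU//; [by rewrite IH|exact: mU|].
  rewrite -bigcup_mkord; apply/seteqP; split => x // -[[k /= kn Fk] Fn].
  have kn' := tF k n I I (ex_intro _ x (conj Fk Fn)).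
  by rewrite kn' ltnn in kn.
apply: pr_mono => //.
by rewrite -bigcup_mkord; apply: bigcup_sub.
Qed.

End RealProbability.

Section Rigidity.
Context {R : realType} {disp : Order.disp_t} {S : finOrderType disp}.
Variable E : rel S.

Local Notation V := (vspaceV R S).
Local Notation W := (vspaceW R S E).
Local Notation N := (lieN R S E).
Local Notation X := (nilmanifold R E).
Local Notation mulN := (@nmul R disp S E).
Local Notation pi := (@piN R disp S E).
Local Notation near := (@near R disp S E).
Local Notation small := (@small R disp S E).

Lemma groupTL_bracket (f : 'End(N)) : groupTL R E f ->
  forall x y, f (bracket x y) = bracket (f x) (f y).
Proof.
move=> [t [l [[theta tE] [[_ lb] _] ->]]] x y; rewrite !comp_lfunE lb !tE.
have -> : (0, theta (bracket (l x) (l y)).1) = 0 :> N by rewrite /= linear0.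
by rewrite addr0 /bracket /= !addr0.
Qed.

Lemma nmulE (x y : N) : mulN x y = x + y + 2^-1 *: bracket x y.
Proof.
case: x => v w; case: y => v' w'.
by rewrite /bracket pairZ !pairD scaler0 addr0.
Qed.

Lemma ninvE (x : N) : ninv x = - x.
Proof. by []. Qed.

Section Automorphism.
Variables f g : 'End(N).
Hypothesis fTL : groupTL R E f.
Hypothesis fK : cancel f g.
Hypothesis gK : cancel g f.
Hypothesis fNZ : f @` NZ R E = NZ R E.

Lemma aut_nmul (x y : N) : f (mulN x y) = mulN (f x) (f y).
Proof. by rewrite !nmulE !linearD linearZ /= groupTL_bracket. Qed.

Lemma aut_ninv (x : N) : f (ninv x) = ninv (f x).
Proof. by rewrite !ninvE linearN. Qed.

Lemma aut_piN (x y : N) : pi x = pi y <-> pi (f x) = pi (f y).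
Proof.
rewrite !piN_eq -aut_ninv -aut_nmul; split=> [H|].
  by rewrite -fNZ; exists (mulN (ninv x) y).
rewrite -{1}fNZ => -[z Hz /(can_inj fK) <-]; exact: Hz.
Qed.

Lemma aut_coset_map (x : N) : coset_map E f (pi x) = pi (f x).
Proof. by apply: coset_mapE => {}x y /aut_piN. Qed.

Lemma aut_coset_map_continuous : continuous (coset_map E f).
Proof.
have fc : continuous (fun x : N => f x).
  by apply: (@continuous_End R disp S E N f idfun) => x; exact: cvg_id.
by apply: (coset_map_continuous fc) => x y /aut_piN.
Qed.

(** From [f (u s) = f u f s]: the diagonal action on pairs of cosets becomes the linear action on
    displacements. *)
Lemma near_aut (A : set N) :
  (fun z : square X => (coset_map E f z.1, coset_map E f z.2)) @^-1` near A =
  near (f @^-1` A).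
Proof.
apply/seteqP; split => [[x y]|[x y] [u [s [Au /= -> ->]]]] /=; last first.
  by rewrite !aut_coset_map; exists (f u), (f s); rewrite aut_nmul.
have [s ->] := piN_surj x; have [r ->] := piN_surj y.
rewrite !aut_coset_map => /nearP[u Au].
rewrite -[in RHS](gK u) -aut_nmul -aut_piN => rE.
by exists (g u), s; rewrite /= gK rE.
Qed.

End Automorphism.

Section Concentration.
Variables (mu : probability X R) (nu : (probability (square X) R)^nat).
Hypothesis nu_mu : forall phi psi : X -> R,
  measurable_fun setT phi -> bounded_fun phi ->
  measurable_fun setT psi -> bounded_fun psi ->
  (\int[nu n]_z (phi z.1 * psi z.2)%:E @[n --> \oo] -->
     \int[mu]_x (phi x * psi x)%:E)%E.

Lemma square_cvg (D : set X) : measurable D ->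
  (fun n => pr (nu n) (D `*` D)) @ \oo --> pr mu D.
Proof.
move=> mD; have mDD : measurable (D `*` D) by exact: measurableX.
have bD : bounded_fun (\1_D : X -> R).
  exists 1; split => // M M1 x _ /=; rewrite indicE.
  by case: (_ \in _); rewrite ?normr1 ?normr0 ?(ltW M1)// ltW// (lt_trans ltr01).
have mi : measurable_fun setT (\1_D : X -> R) by exact: measurable_indic.
have := nu_mu mi bD mi bD.
have -> : (fun n => \int[nu n]_z ((\1_D z.1 * \1_D z.2 : R)%:E))%E =
    (fun n => (pr (nu n) (D `*` D))%:E).
  apply/funext => n; rewrite -prE// -[in RHS](setIT (D `*` D)) -integral_indic//.
  apply: eq_integral => -[x y] _ /=; rewrite !indicE in_setX /= -natrM.
  by rewrite mulnb.
have -> : (\int[mu]_x (\1_D x * \1_D x : R)%:E)%E = (pr mu D)%:E.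
  rewrite -prE// -[in RHS](setIT D) -integral_indic//.
  by apply: eq_integral => x _; rewrite !indicE -natrM mulnb andbb.
by move=> /fine_cvgP[_].
Qed.

(* The space is a countable disjoint union of sets whose squares are contained in
   [near B]; [square_cvg] computes the limit masses of these squares. *)
Lemma near_concentrated (B : set N) (e : R) : open B -> B 0 -> 0 < e ->
  \forall n \near \oo, 1 - e <= pr (nu n) (near B).
Proof.
move=> oB B0 e0.
pose idx := ('rV[rat]_#|{: S}| * 'rV[rat]_#|{: edge S E}| * nat)%type.
pose good (i : idx) := `[< forall s r, Nbasis (E := E) i s -> Nbasis (E := E) i r ->
  B (mulN r (ninv s)) >].
pose G k : set X := if unpickle k is Some i then
  if good i then pi @` Nbasis i else set0 else set0.
have mG k : measurable (G k).
  rewrite /G; case: unpickle => [i|]; last exact: measurable0.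
  case: (good i); last exact: measurable0.
  by apply: measurable_open; apply: piN_open; exact: open_Nbasis.
have Gnear k : G k `*` G k `<=` near B.
  rewrite /G; case: unpickle => [i|]; last by move=> [x y] [].
  case: (asboolP (forall s r, Nbasis i s -> Nbasis i r -> B (mulN r (ninv s)))) => gi; last first.
    by rewrite /good asboolF// => -[x y] [].
  rewrite /good asboolT// => -[x y] [] /= [s si <-] [r ri <-].
  by exists (mulN r (ninv s)), s; rewrite nmulVKr; split => //; exact: gi.
have GT : \bigcup_k G k = setT.
  apply/seteqP; split => // x _; have [s ->] := piN_surj x.
  have c1 : continuous (fun z : N * N => mulN z.2 (ninv z.1)).
    apply: continuous_nmul; first by move=> z; exact: cvg_snd.
    by apply: continuous_ninv => z; exact: cvg_fst.
  have /= : nbhs (s, s) ((fun z : N * N => mulN z.2 (ninv z.1)) @^-1` B).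
    by apply: c1; apply: open_nbhs_nbhs; split => //=; rewrite nmulVr.
  move=> [[P Q] [/= nP nQ] PQB].
  have nPQ : nbhs s (P `&` Q) by exact: filterI.
  have [i [si iPQ]] := NbasisP (@open_interior _ (P `&` Q)) (nbhs_singleton (nbhs_interior nPQ)).
  have gi : good i.
    apply/asboolP => s' r' /iPQ/interior_subset[Ps' _] /iPQ/interior_subset[_ Qr'].
    exact: (PQB (s', r')).
  exists (pickle i); first exact: I.
  by rewrite /G pickleK gi; exists s.
pose D := seqDU G.
have mD k : measurable (D k) by exact: seqDU_measurable.
have tD : trivIset setT D by exact: trivIset_seqDU.
have DT : \bigcup_k D k = setT by rewrite -seqDU_bigcup_eq.
have DD k : D k `*` D k `<=` near B.
  by apply: subset_trans (Gnear k) => -[x y] [[Gx _] [Gy _]].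
have : (fun n => \sum_(k < n) pr mu (D k)) @ \oo --> (1 : R).
  have HD : ((fun n => \sum_(0 <= k < n) mu (D k)) @ \oo --> 1)%E.
    rewrite -(probability_setT mu) -DT; apply: measure_semi_sigma_additive => //.
    by rewrite DT; exact: measurableT.
  have sE : (fun n => \sum_(0 <= k < n) mu (D k))%E =
      (fun n => (\sum_(k < n) pr mu (D k))%:E).
    apply/funext => n; rewrite big_mkord -sumEFin; apply: eq_bigr => k _.
    exact: prE.
  move: HD; rewrite sE.
  by move=> /fine_cvgP[_].
(* Finitely many pieces carry all of [mu] but [e / 2]; another [e / 2] pays for the convergence of
   the masses of their squares. *)
move=> /cvgrPdist_lt/(_ (e / 2)) []; first by rewrite divr_gt0.
move=> K _ /(_ K (leqnn K)) /= HK.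
have : (fun n => \sum_(k < K) pr (nu n) (D k `*` D k)) @ \oo --> \sum_(k < K) pr mu (D k).
  apply: cvg_big => [|k _]; first exact: add_continuous.
  exact: square_cvg.
move=> /cvgrPdist_lt/(_ (e / 2)) []; first by rewrite divr_gt0.
move=> n0 _ Hn0; exists n0 => // n /Hn0 /=.
have : \sum_(k < K) pr (nu n) (D k `*` D k) <= pr (nu n) (near B).
  apply: (@pr_sum_le _ _ _ (nu n) (fun k => D k `*` D k)) => //.
  - by move=> k; exact: measurableX.
  - by move=> i j _ _ [[x y] [[Dx _] [Dx' _]]]; apply: (tD i j) => //; exists x.
  - exact: measurable_near.
by move: HK; rewrite !ltr_norml; lra.
Qed.

End Concentration.

End Rigidity.

Lemma total_variation_norm_ge (R : realType) d (X : measurableType d)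
    (s : set X -> \bar R) (A : set X) :
  measurable A -> (`|s A| <= total_variation_norm s)%E.
Proof.
move=> mA; apply: ereal_sup_ubound; exists 1%N, (fun i => if i == 0%N then A else set0).
split; last by rewrite big_ord_recl big_ord0 adde0.
  by move=> i; case: eqP => _.
move=> i j _ _ [x []]; case: eqP => [->|] //; case: eqP => [->|] //.
Qed.

Lemma total_variation_norm_eq0 (R : realType) d (X : measurableType d)
    (s : set X -> \bar R) :
  (forall A, measurable A -> s A = 0%E) -> total_variation_norm s = 0%E.
Proof.
move=> s0; apply/eqP; rewrite eq_le; apply/andP; split.
  apply: ub_ereal_sup => _ [n [F [mF _ ->]]].
  by rewrite big1 // => i _; rewrite s0 // abse0.
have := @total_variation_norm_ge R d X s set0 measurable0.
by rewrite s0 // abse0.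
Qed.

Lemma total_variation_cvg0 (R : realType) d (X : measurableType d)
    (nu : (probability X R)^nat) (f : X -> X) (A : set X) (e : R) :
  measurable A -> measurable (f @^-1` A) ->
  total_variation_norm (fun A => pushforward (nu n) f A - nu n A)%E @[n --> \oo] --> 0%E ->
  0 < e ->
  \forall n \near \oo, `|pr (nu n) (f @^-1` A) - pr (nu n) A| <= e.
Proof.
move=> mA mfA /fine_cvgP[fin /cvgrPdist_le tv] e0.
apply: filterS2 fin (tv e e0) => n finn /=; rewrite sub0r normrN => /(le_trans (ler_norm _)).
apply: le_trans; rewrite -lee_fin (fineK finn).
have := @total_variation_norm_ge _ _ _
  (fun A => pushforward (nu n) f A - nu n A)%E A mA.
by rewrite /pushforward !prE.
Qed.

Lemma ler_dist3 (R : realFieldType) (e a b c d : R) : `|a - b| <= e / 3 ->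
  `|c - b| <= e / 3 -> `|d - a| <= e / 3 -> `|d - c| <= e.
Proof. by rewrite !ler_norml; lra. Qed.

(** * The limit of the laws of the displacements *)

Section Mean.
Context {R : realType} {disp : Order.disp_t} {S : finOrderType disp}.
Variable E : rel S.

Local Notation V := (vspaceV R S).
Local Notation W := (vspaceW R S E).
Local Notation N := (lieN R S E).
Local Notation X := (nilmanifold R E).
Local Notation mulN := (@nmul R disp S E).
Local Notation pi := (@piN R disp S E).
Local Notation near := (@near R disp S E).
Local Notation small := (@small R disp S E).

Variables (mu : probability X R) (nu : (probability (square X) R)^nat).
Variable Gamma : set 'End(N).
Hypothesis Gamma_subgroup : is_subgroupGL Gamma.
Hypothesis Gamma_TL : Gamma `<=` groupTL R E.
Hypothesis Gamma_NZ : forall f, Gamma f -> f @` NZ R E = NZ R E.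
Hypothesis nu_mu : forall phi psi : X -> R,
  measurable_fun setT phi -> bounded_fun phi ->
  measurable_fun setT psi -> bounded_fun psi ->
  (\int[nu n]_z (phi z.1 * psi z.2)%:E @[n --> \oo] -->
     \int[mu]_x (phi x * psi x)%:E)%E.
Hypothesis nu_inv : forall f : 'End(N), Gamma f ->
  (total_variation_norm (fun A =>
     pushforward (nu n) (fun z => (coset_map E f z.1, coset_map E f z.2)) A - nu n A)
     @[n --> \oo] --> 0)%E.

(** Intersecting with [small] makes the displacement unique; removing [0] leaves the pairs off the
    diagonal. *)
Let punct (A : set N) := (A `&` small) `\` [set 0].

Let open_punct A : open A -> open (punct A).
Proof. by move=> oA; apply: open_punctured; apply: openI => //; exact: open_small. Qed.

Let punct_small A : punct A `<=` small.
Proof. by move=> u [[_ ?] _]. Qed.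

Let mn (n : nat) (A : set N) : R := pr (nu n) (near (punct A)).

(** By concentration, a set of displacements may be cut down to any neighbourhood of [0] in [small]
    at no cost in the limit. *)
Let mn_cap (A B : set N) (e : R) : open A -> open B -> B 0 -> B `<=` small -> 0 < e ->
  \forall n \near \oo, `|mn n A - pr (nu n) (near (punct A `&` B))| <= e.
Proof.
move=> oA oB B0 Bs e0; have := near_concentrated nu_mu oB B0 e0.
apply: filterS => n nB.
have mA : measurable (near (punct A)) by apply: measurable_near; exact: open_punct.
have mB : measurable (near B) by exact: measurable_near.
rewrite (nearI (@punct_small A) Bs).
have := pr_capge (nu n) mA mB.
have := @pr_mono _ _ _ (nu n) _ _ (measurableI _ _ mA mB) mA (@subIsetl _ _ _).
by rewrite -/(mn n A) ler_norml; lra.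
Qed.

(** The set [small] is not stable under [f]. On [B2], where [u] and [f u] are both small, preimages
    correspond exactly ([key]); cutting down to [B2] and to its image [B3], and the almost
    invariance of [nu n], cost [e / 3] each. *)
Let mn_inv (f : 'End(N)) (A : set N) (e : R) : Gamma f -> open A -> 0 < e ->
  \forall n \near \oo, `|mn n (f @^-1` A) - mn n A| <= e.
Proof.
move=> Gf oA e0; have [Gbij _ _ _] := Gamma_subgroup.
have fTL := Gamma_TL Gf; have fNZ := Gamma_NZ Gf.
have [g fK gK] := bijective_lfun (Gbij f Gf).
have fc : continuous (fun x : N => f x).
  by apply: (@continuous_End R disp S E N f idfun) => x; exact: cvg_id.
have gc : continuous (fun x : N => g x).
  by apply: (@continuous_End R disp S E N g idfun) => x; exact: cvg_id.
have oP (h : 'End(N)) (B : set N) : continuous (fun x : N => h x) -> open B -> open (h @^-1` B).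
  by move=> hc oB; apply: open_comp oB => x _; exact: hc.
have os := @open_small R disp S E.
pose B2 : set N := small `&` f @^-1` small.
have oB2 : open B2 by apply: openI => //; exact: oP.
have B20 : B2 0 by split; rewrite /= ?linear0; exact: small0.
pose B3 : set N := g @^-1` B2.
have oB3 : open B3 by exact: oP.
have B30 : B3 0 by rewrite /B3 /= linear0.
have B3s : B3 `<=` small by move=> u [_]; rewrite /= gK.
have B2s : B2 `<=` small by move=> u [].
have f0E u : f u = 0 <-> u = 0.
  by split=> [fu|->]; [rewrite -[u]fK fu linear0|rewrite linear0].
have key : f @^-1` (punct A `&` B3) = punct (f @^-1` A) `&` B2.
  apply/seteqP; split => u; rewrite /punct /B3 /B2 /preimage /setI /setD /= fK f0E.
    by move=> [[[Afu sfu] fu0] [su _]]; exact: (conj (conj (conj Afu su) fu0) (conj su sfu)).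
  by move=> [[[Afu su] u0] [_ sfu]]; exact: (conj (conj (conj Afu sfu) u0) (conj su sfu)).
have oA' : open (f @^-1` A) by exact: oP.
have e3 : 0 < e / 3 by rewrite divr_gt0.
have m1 : measurable (near (punct A `&` B3)).
  by apply: measurable_near; apply: openI oB3; exact: open_punct.
have m2 : measurable (near (punct (f @^-1` A) `&` B2)).
  by apply: measurable_near; apply: openI oB2; exact: open_punct.
have nE := near_aut fTL fK gK fNZ (punct A `&` B3).
rewrite key in nE.
have m3 : measurable ((fun z : square X => (coset_map E f z.1, coset_map E f z.2)) @^-1`
    near (punct A `&` B3)) by rewrite nE.
have H1 := total_variation_cvg0 m1 m3 (nu_inv Gf) e3.
rewrite nE in H1.
have H2 := mn_cap oA oB3 B30 B3s e3.
have H3 := mn_cap oA' oB2 B20 B2s e3.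
apply: filterS (filterI H1 (filterI H2 H3)) => n [h1 [h2 h3]].
exact: ler_dist3 h1 h2 h3.
Qed.

Hypothesis nu_diag : ~ ((nu n diagonal @[n --> \oo] --> 1)%E).

Let off_diagonal : exists2 e : R, 0 < e &
  forall n0 : nat, exists2 n, (n0 <= n)%N & pr (nu n) diagonal <= 1 - e.
Proof.
apply: contra_notP nu_diag => H.
have mD := @measurable_diagonal R disp S E.
have -> : (fun n => nu n diagonal) = (fun n => (pr (nu n) diagonal)%:E).
  by apply/funext => n; rewrite prE.
apply: cvg_EFin; first by near=> n.
apply/cvgrPdist_le => e e0; apply: contrapT => H'; apply: H; exists e => // n0.
apply: contrapT => H''; apply: H'; exists n0 => // n /= n0n.
have := pr_le1 (nu n) mD; have : 1 - e < pr (nu n) diagonal.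
  by rewrite ltNge; apply/negP => pe; apply: H''; exists n.
by rewrite ler_norml; lra.
Unshelve. all: by end_near. Qed.

Lemma rigidity_mean : exists m : set N -> R,
  [/\ m set0 = 0,
      forall A B, open A -> open B -> A `<=` B -> m A <= m B,
      forall A B, open A -> open B -> m (A `|` B) + m (A `&` B) = m A + m B,
      forall (f : 'End(N)) A, Gamma f -> open A -> m (f @^-1` A) = m A
    & 0 < m [set x | x != 0]].
Proof.
have [e e0 He] := off_diagonal.
pose D := [set n | pr (nu n) diagonal <= 1 - e].
(* The ultrafilter will contain all tails and [D]. All limits then exist at once, and the mass off
   the diagonal is not lost. *)
have pD : ProperFilter (within D \oo).
  have FW : Filter (within D \oo) by exact: within_filter.
  apply: Build_ProperFilter_ex => P [n0 _ H].
  by have [n n0n Dn] := He n0; exists n; exact: H.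
have [F [FU FD]] := ultraFilterLemma pD.
have pF : ProperFilter F by exact: ultra_proper.
have Foo (P : set nat) : (\forall n \near \oo, P n) -> F P.
  by move=> HP; apply: FD; apply: filterS HP => n Pn _.
have FDD : F D by apply: FD; exact: withinT.
have mA A : open A -> measurable (near (punct A)).
  by move=> oA; apply: measurable_near; exact: open_punct.
pose m A : R := lim ((fun n => mn n A) @ F).
have mcvg A : open A -> (fun n => mn n A) @ F --> m A.
  move=> oA; have [|l Hl] := @ultra_cvg_bounded R _ F (fun n => mn n A) 1 FU.
    apply: filterS filterT => n _ /=; rewrite ger0_norm ?pr_ge0// pr_le1//.
    exact: mA.
  by apply/cvg_ex; exists l.
have munique A (l : R) : open A -> (fun n => mn n A) @ F --> l -> m A = l.
  by move=> oA /(cvg_lim (@Rhausdorff R)).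
exists m; split.
- apply: munique; first exact: open0.
  rewrite (_ : (fun n => _) = fun=> 0); first exact: cvg_cst.
  by apply/funext => n; rewrite /mn /punct set0I set0D near0 pr0.
- move=> A B oA oB AB; apply: ler_cvg_to (mcvg _ oA) (mcvg _ oB) _.
  apply: filterS filterT => n _; apply: pr_mono; [exact: mA|exact: mA|].
  by apply: near_mono => u [[/AB Bu su] u0].
- move=> A B oA oB.
  have oU := openU oA oB; have oI := openI oA oB.
  have H1 : (fun n => mn n (A `|` B) + mn n (A `&` B)) @ F --> m (A `|` B) + m (A `&` B).
    by apply: cvgD; exact: mcvg.
  have H2 : (fun n => mn n A + mn n B) @ F --> m A + m B by apply: cvgD; exact: mcvg.
  suff fE : (fun n => mn n (A `|` B) + mn n (A `&` B)) = (fun n => mn n A + mn n B).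
    by rewrite fE in H1; exact: cvg_unique H1 H2.
  apply/funext => n /=; rewrite /mn -(pr_mod (nu n) (mA A oA) (mA B oB)).
  rewrite -nearU -(nearI (@punct_small A) (@punct_small B)).
  congr (pr _ (near _) + pr _ (near _)); apply/seteqP; split => u; rewrite /punct /=; tauto.
- move=> f A Gf oA; apply/eqP; rewrite -subr_eq0 -normr_le0; apply/ler_addgt0Pr => d d0.
  have fc : continuous (fun x : N => f x).
    by apply: (@continuous_End R disp S E N f idfun) => x; exact: cvg_id.
  have oA' : open (f @^-1` A) by apply: open_comp oA => x _; exact: fc.
  have H : (fun n => `|mn n (f @^-1` A) - mn n A|) @ F --> `|m (f @^-1` A) - m A|.
    by apply: cvg_norm; apply: cvgB; exact: mcvg.
  rewrite add0r; move: H => /cvgr_to_le; apply.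
  by apply: Foo; exact: mn_inv.
have o0 : open [set x : N | x != 0].
  have -> : [set x : N | x != 0] = setT `\` [set 0].
    by apply/seteqP; split => x /=; [move=> /eqP ?; split|move=> [_ /eqP]].
  by apply: open_punctured; exact: openT.
have e2 : 0 < e / 2 by rewrite divr_gt0.
(* Eventually [near small] has mass at least [1 - e / 2], against at most [1 - e] for the diagonal
   on [D]. *)
apply: (lt_le_trans e2); have /cvgr_to_ge := mcvg _ o0; apply.
have Hs := Foo _ (near_concentrated nu_mu (@open_small R disp S E) (@small0 R disp S E) e2).
apply: filterS2 FDD Hs => n Dn sn.
have mD := @measurable_diagonal R disp S E.
have ms := measurable_near (@open_small R disp S E).
rewrite /mn; have -> : punct [set x | x != 0] = small `\` [set 0].
  apply/seteqP; split => x; first by move=> [[_ sx] x0]; exact: (conj sx x0).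
  by move=> [sx x0]; split; [split; [exact/eqP|exact: sx]|exact: x0].
rewrite near_punctured prD//.
have : pr (nu n) (near small `&` diagonal) <= pr (nu n) diagonal.
  by apply: pr_mono => //; exact: measurableI.
by move: Dn sn; rewrite /D /=; lra.
Qed.

End Mean.

(** * Uniqueness of the invariant probability *)

Section Periodic.
Context {R : realType}.
Local Notation leb := (@lebesgue_measure R).

Lemma measurable_addr (s : R) :
  measurable_fun setT ((fun t => t + s) : measurableTypeR R -> measurableTypeR R).
Proof. by apply: measurable_funD => //; exact: measurable_cst. Qed.

Lemma lebesgue_measure_addr (s : R) (A : set (measurableTypeR R)) :
  measurable A ->
  pushforward leb ((fun t => t + s) : measurableTypeR R -> measurableTypeR R) A = leb A.
Proof.
have ms := measurable_addr s.
pose m := pushforward leb ((fun t => t + s) : measurableTypeR R -> measurableTypeR R).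
move=> mA; apply/esym.
apply: (@lebesgue_measure_unique R
  (@pushforward _ _ (measurableTypeR R) (measurableTypeR R) R leb (fun t => t + s))) =>
  //= _ [[a b]] _ <-.
rewrite /pushforward /=.
rewrite (_ : _ @^-1` _ = `]a - s, b - s]%classic); last first.
  by apply/seteqP; split => t /=; rewrite !in_itv /= ltrBlDr lerBrDr.
rewrite !lebesgue_measure_itv /= !lte_fin ltrD2r -EFinB -EFinB.
by congr (if _ then _ else _); congr EFin; ring.
Qed.

Lemma integral_addr (g : R -> \bar R) (s a b : R) :
  measurable_fun setT g -> (forall t, 0 <= g t)%E ->
  (\int[leb]_(t in `[a, b[) g (t + s)%R = \int[leb]_(t in `[(a + s)%R, (b + s)%R[) g t)%E.
Proof.
move=> mg g0; have ms := measurable_addr s.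
pose shift : measurableTypeR R -> measurableTypeR R := fun t => (t + s)%R.
transitivity (\int[pushforward leb shift]_(t in `[(a + s)%R, (b + s)%R[) g t)%E.
  rewrite ge0_integral_pushforward //=.
    congr (integral _ _ _).
    by apply/seteqP; split => t /=; rewrite !in_itv /= lerD2r ltrD2r.
  exact: measurable_funS mg.
apply: eq_measure_integral => A mA _; exact: lebesgue_measure_addr.
Qed.

(** The interval from [s] to [1 + s] is cut at [1], and the part above [1] is moved back by one
    period. *)
Lemma integral_periodic (g : R -> \bar R) (s : R) :
  measurable_fun setT g -> (forall t, 0 <= g t)%E ->
  (forall t, g (t + 1) = g t) -> (0 <= s <= 1)%R ->
  (\int[leb]_(t in `[0%R, 1%R[) g (t + s)%R = \int[leb]_(t in `[0%R, 1%R[) g t)%E.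
Proof.
move=> mg g0 gp /andP[s0 s1].
have cut (a b c : R) : a <= b -> b <= c -> (\int[leb]_(t in `[a, c[) g t =
    \int[leb]_(t in `[a, b[) g t + \int[leb]_(t in `[b, c[) g t)%E.
  move=> ab bc; rewrite -ge0_integral_setU //=.
  - congr (integral _ _ _); apply/seteqP; split => t /=; rewrite !in_itv /=; lra.
  - exact: measurable_funS mg.
  - apply/disj_setPS => t [] /=; rewrite !in_itv /=; lra.
rewrite integral_addr // add0r (cut s 1) //; last lra.
rewrite (cut 0 s 1) // addeC; congr (_ + _)%E.
have {1}-> : (1 = 0 + 1 :> R)%R by rewrite add0r.
rewrite (addrC 1 s) -integral_addr//.
by apply: eq_integral => t _; rewrite gp.
Qed.

End Periodic.

Section Averaging.
Context {R : realType} d (X : measurableType d).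
Variable phi : R -> X -> X.
Hypothesis mphi : measurable_fun setT (fun z : measurableTypeR R * X => phi z.1 z.2).
Variable f : X -> \bar R.
Hypothesis mf : measurable_fun setT f.
Hypothesis f0 : forall x, (0 <= f x)%E.
Local Notation leb := (@lebesgue_measure R).

Definition flow_average (x : X) : \bar R :=
  (\int[leb]_(t in `[0%R, 1%R[) f (phi t x))%E.

Let I01 : set (measurableTypeR R) := `[0%R, 1%R[%classic.
(** The time interval is moved into the integrand, so that Tonelli's theorem applies on the whole
    product. *)
Let F (z : measurableTypeR R * X) : \bar R :=
  if z.1 \in I01 then f (phi z.1 z.2) else 0%E.

Let F0 z : (0 <= F z)%E.
Proof. by rewrite /F; case: ifP. Qed.

Let mF : measurable_fun setT F.
Proof.
have -> : F = ((fun z => f (phi z.1 z.2)) \_ (I01 `*` setT)).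
  apply/funext => z; rewrite /patch /F; congr (if _ then _ else _).
  by apply/idP/idP; rewrite !inE; [move=> ?; split|case].
apply/(measurable_restrictT _ _).1 => //.
  by apply: measurableX => //; exact: measurable_itv.
apply: measurable_funS (measurableT) _ _ => //.
exact: measurableT_comp mf mphi.
Qed.

Let averageE x : flow_average x = (\int[leb]_t F (t, x))%E.
Proof. by rewrite /flow_average integral_mkcond. Qed.

Lemma flow_average_ge0 x : (0 <= flow_average x)%E.
Proof. exact: integral_ge0. Qed.

Lemma measurable_flow_average : measurable_fun setT flow_average.
Proof.
have -> : flow_average = fun x => (\int[leb]_t F (t, x))%E.
  by apply/funext => x; rewrite averageE.
exact: measurable_fun_fubini_tonelli_G.
Qed.

Lemma integral_flow_average (mu : probability X R) :
  (forall t A, measurable A -> mu (phi t @^-1` A) = mu A) ->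
  (\int[mu]_x flow_average x = \int[mu]_x f x)%E.
Proof.
move=> mu_phi.
have mp t : measurable_fun setT (phi t).
  exact: measurableT_comp mphi (measurable_pair1 _).
under eq_integral do rewrite averageE.
rewrite -(@fubini_tonelli _ _ (measurableTypeR R) X R leb mu F mF F0).
have intf t : (\int[mu]_x f (phi t x) = \int[mu]_x f x)%E.
  transitivity (\int[pushforward mu (phi t)]_x f x)%E.
    by rewrite (ge0_integral_pushforward (mp t)) //= preimage_setT.
  by apply: eq_measure_integral => A mA _; exact: mu_phi.
transitivity (\int[leb]_(t in I01) (\int[mu]_x f x))%E.
  rewrite [in RHS]integral_mkcond; apply: eq_integral => t _.
  rewrite /patch /F /=; case: ifP => _; first exact: intf.
  exact: integral0.
rewrite integral_cst //=; last exact: measurable_itv.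
rewrite lebesgue_measure_itv /=.
  by rewrite lte_fin ltr01 sube0 mule1.
Qed.

(** Periodicity settles [0 <= s <= 1]. A non-negative [s] is [n] times [s / n] with [n] above [s],
    and a negative one is undone by its opposite. *)
Lemma flow_average_invariant : (forall s t x, phi s (phi t x) = phi (s + t) x) ->
  (forall t x, f (phi (t + 1) x) = f (phi t x)) ->
  forall s x, flow_average (phi s x) = flow_average x.
Proof.
move=> phiD phi1.
have small s x : 0 <= s <= 1 -> flow_average (phi s x) = flow_average x.
  move=> s01; rewrite /flow_average.
  transitivity (\int[leb]_(t in `[0%R, 1%R[) (f (phi (t + s)%R x)))%E.
    by apply: eq_integral => t _; rewrite phiD.
  apply: (integral_periodic (g := fun t => f (phi t x))) => //.
  exact: measurableT_comp mf (measurableT_comp mphi (measurable_pair2 _)).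
have pos s x : 0 <= s -> flow_average (phi s x) = flow_average x.
  move=> s0; pose n := (Num.trunc s).+1.
  have n0 : 0 < n%:R :> R by rewrite ltr0n.
  have sn : 0 <= s / n%:R <= 1.
    by rewrite divr_ge0 ?ler0n//= ler_pdivrMr// mul1r ltW// truncnS_gt.
  have -> : s = (s / n%:R) *+ n by rewrite -mulr_natr divfK// gt_eqF.
  have phi0 y : flow_average (phi 0 y) = flow_average y by apply: small; rewrite lexx ler01.
  elim: n {n0 sn} (s / n%:R) (sn) => [|n IH] r r01; first by rewrite mulr0n phi0.
  by rewrite mulrS -phiD small// IH.
move=> s x; have [s0|s0] := leP 0 s; first exact: pos.
have phi0 y : flow_average (phi 0 y) = flow_average y by exact: pos.
rewrite -(pos (- s)) ?oppr_ge0 ?ltW// phiD addNr; exact: phi0.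
Qed.

End Averaging.

(** * Averaging along one-parameter subgroups *)

Section Averages.
Context {R : realType} {disp : Order.disp_t} {S : finOrderType disp}.
Variable E : rel S.

Local Notation V := (vspaceV R S).
Local Notation W := (vspaceW R S E).
Local Notation N := (lieN R S E).
Local Notation X := (nilmanifold R E).
Local Notation br := (@bracketV R disp S E).
Local Notation mulN := (@nmul R disp S E).
Local Notation pi := (@piN R disp S E).

Definition act (n : N) : X -> X := coset_map E (mulN n).

Lemma act_piN (n s : N) : act n (pi s) = pi (mulN n s).
Proof. by apply: coset_mapE => x y; exact: piN_mul. Qed.

Lemma actM (n m : N) (x : X) : act (mulN n m) x = act n (act m x).
Proof. by have [s ->] := piN_surj x; rewrite !act_piN nmulA. Qed.

Lemma act1 (x : X) : act (nunit E) x = x.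
Proof. by have [s ->] := piN_surj x; rewrite act_piN nmul1l. Qed.

Lemma act_continuous (n : N) : continuous (act n).
Proof.
apply: coset_map_continuous => [|x y]; last exact: piN_mul.
by apply: continuous_nmul => x; [exact: cvg_cst|exact: cvg_id].
Qed.

Lemma nmul_swap (x y : N) : mulN x y = mulN (0, br x.1 y.1) (mulN y x).
Proof.
rewrite /nmul /= bracketV0l scaler0 add0r addr0; congr pair; first exact: addrC.
rewrite (bracketVC E x.1 y.1); apply/rowP => i; rewrite !mxE.
by lra.
Qed.

Lemma nmul_center (w : W) (x : N) : mulN (0, w) x = mulN x (0, w).
Proof. by rewrite nmul_swap /= bracketV0l -/(nunit E) nmul1l. Qed.

(** A central element can be moved to the right of a representative, where [NZ] absorbs it. *)
Lemma act_center_integral (n : N) (x : X) : n.1 = 0 -> NZ R E n -> act n x = x.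
Proof.
case: n => _ w /= -> Hw; have [s ->] := piN_surj x.
rewrite act_piN nmul_center; apply/esym/piN_eq; by rewrite nmulKl.
Qed.

(** Joint measurability, for Tonelli's theorem: the preimage of an open set is a countable union of
    rational intervals times images of rational balls. *)
Lemma measurable_act_curve (c : R -> N) : continuous c ->
  measurable_fun setT (fun z : measurableTypeR R * X => act (c z.1) z.2).
Proof.
move=> cc; apply: (measurability (@open X)) => // _ [A oA <-]; rewrite setTI.
pose idx := (rat * rat * ('rV[rat]_#|{: S}| * 'rV[rat]_#|{: edge S E}| * nat))%type.
pose I := {i : idx | `[< forall (t : R) (s : N), ratr i.1.1 < t < ratr i.1.2 ->
  Nbasis i.2 s -> A (pi (mulN (c t) s)) >]}.
rewrite (_ : _ @^-1` A = \bigcup_(i : I)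
    (`](ratr (sval i).1.1 : R), ratr (sval i).1.2[%classic `*` (pi @` Nbasis (sval i).2))).
  apply: countable_bigcupT_measurable => [|i]; first exact: countableP.
  apply: measurableX; first exact: measurable_itv.
  by apply: measurable_open; apply: piN_open; exact: open_Nbasis.
apply/seteqP; split => [[t x]|[t x] [[[[a b] i] /= /asboolP H] _ /= [tab [s si <-]]]]; last first.
  by rewrite act_piN; apply: H => //; move: tab; rewrite in_itv.
have [s ->] := piN_surj x; rewrite /= act_piN => Ats.
have oA' : open (pi @^-1` A) by apply: open_comp oA => y _; exact: piN_continuous.
have c2 : continuous (fun z : R * N => mulN (c z.1) z.2).
  apply: continuous_nmul; last by move=> z; exact: cvg_snd.
  by move=> z; apply: (@continuous_comp _ _ _ fst c); [exact: cvg_fst|exact: cc].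
have /= : nbhs (t, s) ((fun z : R * N => mulN (c z.1) z.2) @^-1` (pi @^-1` A)).
  by apply: c2; apply: open_nbhs_nbhs; split.
move=> [[P Q] [/= /nbhs_ballP[e /= e0 eP] /nbhs_interior nQ] PQA].
have [i [si iQ]] := NbasisP (@open_interior _ Q) (nbhs_singleton nQ).
have [a] := @rat_in_itvoo _ (t - e) t ltac:(lra); rewrite in_itv /= => /andP[ta at'].
have [b] := @rat_in_itvoo _ t (t + e) ltac:(lra); rewrite in_itv /= => /andP[tb bt].
have H : `[< forall (t' : R) (s' : N), ratr a < t' < ratr b -> Nbasis i s' ->
    A (pi (mulN (c t') s')) >].
  apply/asboolP => t' s' t'ab /iQ/interior_subset Qs'.
  apply: (PQA (t', s')); split => //=; apply: eP.
  by rewrite /ball /= ltr_norml; move: t'ab; lra.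
exists (exist _ ((a, b), i) H) => //=; split; last by exists s.
by rewrite in_itv /= at' tb.
Qed.

Definition invariant_probability (mu : probability X R) :=
  forall n A, measurable A -> mu (act n @^-1` A) = mu A.

Definition stab (f : X -> \bar R) (n : N) := forall x, f (act n x) = f x.

Lemma stabM f n m : stab f n -> stab f m -> stab f (mulN n m).
Proof. by move=> fn fm x; rewrite actM fn fm. Qed.

Lemma stab1 f : stab f (nunit E).
Proof. by move=> x; rewrite act1. Qed.

Definition averaged (f f' : X -> \bar R) :=
  [/\ measurable_fun setT f', forall x, (0 <= f' x)%E
    & forall mu, invariant_probability mu -> (\int[mu]_x f' x = \int[mu]_x f x)%E].

Lemma averaged_trans f g h : averaged f g -> averaged g h -> averaged f h.
Proof. by move=> [_ _ fg] [mh h0 gh]; split => // mu mui; rewrite gh// fg. Qed.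

(** Invariance of [f] under [c 1] makes it periodic along the orbits of [c], so the average over one
    period is invariant under all [c s]. An earlier invariance under [n] survives if [f] does not
    see the order of [c t] and [n]. *)
Lemma average_step (c : R -> N) (f : X -> \bar R) : continuous c ->
  (forall s t, c (s + t) = mulN (c s) (c t)) ->
  measurable_fun setT f -> (forall x, (0 <= f x)%E) -> stab f (c 1) ->
  exists f', [/\ averaged f f', forall s, stab f' (c s) &
    forall n, stab f n -> (forall t x, f (act (mulN (c t) n) x) = f (act (mulN n (c t)) x)) ->
      stab f' n].
Proof.
move=> cc cD mf f0 fc1; have mc := measurable_act_curve cc.
exists (flow_average (fun t => act (c t)) f); split.
- split; first exact: measurable_flow_average.
    exact: flow_average_ge0.
  by move=> mu mui; apply: integral_flow_average => // t A; exact: mui.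
- move=> s x; apply: flow_average_invariant => //.
    by move=> r t y; rewrite cD actM.
  by move=> t y; rewrite addrC cD actM fc1.
- move=> n fn fcn x; apply: eq_integral => t _.
  by rewrite -actM fcn actM fn.
Qed.

End Averages.

Section InvariantProbability.
Context {R : realType} {disp : Order.disp_t} {S : finOrderType disp}.
Variable E : rel S.

Local Notation V := (vspaceV R S).
Local Notation W := (vspaceW R S E).
Local Notation N := (lieN R S E).
Local Notation X := (nilmanifold R E).
Local Notation br := (@bracketV R disp S E).
Local Notation mulN := (@nmul R disp S E).
Local Notation pi := (@piN R disp S E).
Local Notation act := (@act R disp S E).
Local Notation stab := (@stab R disp S E).

Lemma continuous_line (v : V) (w : W) : continuous (fun t : R => (t *: v, t *: w) : N).
Proof.
apply: continuous_N => i.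
  apply: (@eq_continuous _ _ (fun t : R => t * v 0 i)); first by move=> t; rewrite mxE.
  by move=> t; apply: cvgM; [exact: cvg_id|exact: cvg_cst].
apply: (@eq_continuous _ _ (fun t : R => t * w 0 i)); first by move=> t; rewrite mxE.
by move=> t; apply: cvgM; [exact: cvg_id|exact: cvg_cst].
Qed.

Lemma nmul_line (v : V) (w : W) (s t : R) :
  ((s + t) *: v, (s + t) *: w) = mulN (s *: v, s *: w) (t *: v, t *: w).
Proof.
by rewrite /nmul /= bracketVZl bracketVZr bracketVv !scaler0 addr0 !scalerDl.
Qed.

Lemma nmul_centers (w w' : W) : mulN (0, w) (0, w') = (0, w + w').
Proof. by rewrite /nmul /= bracketV0l scaler0 !addr0. Qed.

Lemma NZ_integer (x : N) : integer_points x -> NZ R E x.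
Proof. by move=> Hx H [_]; exact. Qed.

(** The centre can be treated directly because the integral points of [W] act trivially on the
    nilmanifold. *)
Lemma average_center (f : X -> \bar R) :
  measurable_fun setT f -> (forall x, (0 <= f x)%E) ->
  exists f', averaged f f' /\ forall w, stab f' (0, w).
Proof.
move=> mf f0.
have step (l : seq (edge S E)) : exists f', averaged f f' /\
    forall p t, p \in l -> stab f' (0, t *: (wbase p : W)).
  elim: l => [|p l [g [[mg g0 fg] gl]]]; first by exists f; split.
  have [||h [gh hp hn]] := average_step (@continuous_line 0 (wbase p)) _ mg g0.
  - by move=> s t; exact: nmul_line.
  - rewrite scaler0 scale1r => x; congr g; apply: act_center_integral => //.
    apply: NZ_integer; split=> i /=; first by rewrite mxE rpred0.
    by rewrite mxE; apply: rpred_nat.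
  exists h; split; first exact: averaged_trans (And3 mg g0 fg) gh.
  move=> q t; rewrite inE => /predU1P[->|ql]; first by have := hp t; rewrite scaler0.
  apply: hn; first exact: gl.
  by move=> s x; rewrite nmul_center.
have [f' [ff' H]] := step (enum {: edge S E}); exists f'; split => // w.
rewrite [w]wdecomp; apply: (big_ind (fun w => stab f' (0, w))) => [|w1 w2 h1 h2|p _].
- exact: stab1.
- by rewrite -nmul_centers; exact: stabM.
- by apply: H; rewrite mem_enum.
Qed.

(** Elements of [N] commute up to [W]. For a function invariant under [W], integral elements of [V]
    can therefore be moved to the right and absorbed by [NZ], which supplies the periodicity needed
    to average along [V]. *)
Lemma average_constant (f : X -> \bar R) :
  measurable_fun setT f -> (forall x, (0 <= f x)%E) ->
  exists f', averaged f f' /\ forall x, f' x = f' (pi (nunit E)).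
Proof.
move=> mf f0.
have [f1 [[mf1 f10 ff1] f1W]] := average_center mf f0.
have step (l : seq S) : exists f', [/\ averaged f f', forall w, stab f' (0, w) &
    forall a t, a \in l -> stab f' (t *: (vbase a : V), 0)].
  elim: l => [|a l [g [[mg g0 fg] gW gl]]]; first by exists f1; split.
  have swap n m x : g (act (mulN n m) x) = g (act (mulN m n) x).
    by rewrite nmul_swap actM gW.
  have [||h [gh ha hn]] := average_step (@continuous_line (vbase a) 0) _ mg g0.
  - by move=> s t; exact: nmul_line.
  - rewrite scaler0 scale1r => x; have [s ->] := piN_surj x.
    rewrite act_piN nmul_swap -act_piN gW; congr g; apply/esym/piN_eq.
    rewrite nmulKl; apply: NZ_integer; split=> i /=; last by rewrite mxE rpred0.
    by rewrite mxE; apply: rpred_nat.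
  exists h; split; first exact: averaged_trans (And3 mg g0 fg) gh.
    by move=> w; apply: hn.
  move=> b t; rewrite inE => /predU1P[->|bl]; first by have := ha t; rewrite scaler0.
  by apply: hn; first exact: gl.
have [f' [ff' f'W H]] := step (enum S); exists f'; split => // x.
have f'V v : stab f' (v, 0).
  rewrite [v]vdecomp; apply: (big_ind (fun v => stab f' (v, 0))) => [|v1 v2 h1 h2|a _].
  - exact: stab1.
  - have -> : (v1 + v2, 0) = mulN (0, - 2^-1 *: br v1 v2) (mulN (v1, 0) (v2, 0)).
      by rewrite /nmul /= bracketV0l scaler0 !addr0 !add0r scaleNr addNr.
    by apply: stabM => //; exact: stabM.
  - by apply: H; rewrite mem_enum.
have [[v w] ->] := piN_surj x.
have -> : (v, w) = mulN (0, w) (v, 0).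
  by rewrite /nmul /= bracketV0l scaler0 !addr0 add0r.
have -> : mulN (0, w) (v, 0) = mulN (mulN (0, w) (v, 0)) (nunit E) by rewrite nmul1.
by rewrite -act_piN actM f'W f'V.
Qed.

(** The averaged indicator of [A] is a constant built without reference to a measure, and it equals
    the mass of [A] for every invariant probability. *)
Lemma invariant_probability_unique (mu mu' : probability X R) :
  invariant_probability mu -> invariant_probability mu' ->
  forall A, measurable A -> mu A = mu' A.
Proof.
move=> mui mui' A mA.
have mf : measurable_fun setT (fun x : X => (\1_A x)%:E : \bar R).
  by apply/measurable_EFinP; exact: measurable_indic.
have f0 (x : X) : (0 <= (\1_A x)%:E :> \bar R)%E by rewrite lee_fin.
have [f' [[_ _ H] cf']] := average_constant mf f0.
have val (m : probability X R) : invariant_probability m -> m A = f' (pi (nunit E)).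
  move=> mi; have := H m mi.
  rewrite integral_indic // setIT => <-.
  have -> : f' = cst (f' (pi (nunit E))) by apply/funext => x; rewrite cf'.
  by rewrite integral_cst //= probability_setT mule1.
by rewrite !val.
Qed.

Section Automorphism.
Variables f g : 'End(N).
Hypothesis fTL : groupTL R E f.
Hypothesis fK : cancel f g.
Hypothesis gK : cancel g f.
Hypothesis fNZ : f @` NZ R E = NZ R E.

Lemma aut_act (n : N) (x : X) : coset_map E f (act n x) = act (f n) (coset_map E f x).
Proof.
have [s ->] := piN_surj x.
by rewrite act_piN !(aut_coset_map fTL fK fNZ) act_piN aut_nmul.
Qed.

(** The image of [mu] under [f] is invariant again, since a translation by [n] after [f] is a
    translation by [g n] before it. Uniqueness concludes. *)
Lemma aut_invariant (mu : probability X R) : invariant_probability mu ->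
  forall A, measurable A -> mu (coset_map E f @^-1` A) = mu A.
Proof.
move=> mui A mA.
have fc : continuous (coset_map E f) := aut_coset_map_continuous fTL fK fNZ.
have mf := measurable_fun_continuous fc.
pose F : {mfun X >-> X} := HB.pack (coset_map E f) (isMeasurableFun.Build _ _ _ _ _ mf).
pose mu' : probability X R := distribution mu F.
have mui' : invariant_probability mu'.
  move=> n B mB.
  have mB' : measurable (coset_map E f @^-1` B).
    by have := @mf measurableT B mB; rewrite setTI.
  change (mu (coset_map E f @^-1` (act n @^-1` B)) = mu (coset_map E f @^-1` B)).
  rewrite -(mui (g n) _ mB').
  by congr (mu _); apply/seteqP; split => x /=; rewrite aut_act gK.
exact: (invariant_probability_unique mui' mui mA).
Qed.

End Automorphism.

End InvariantProbability.

(** * Central translations *)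

Section GraphCoupling.
Context {R : realType} d (X : measurableType d) (mu : probability X R).

Lemma integrable_mul (u v : X -> R) : measurable_fun setT u -> measurable_fun setT v ->
  bounded_fun u -> bounded_fun v -> mu.-integrable setT (EFin \o (fun x => u x * v x)).
Proof.
move=> mu' mv [M1 [_ ub]] [M2 [_ vb]]; pose M := `|M1| + `|M2| + 1.
have uM x : `|u x| <= M.
  by apply: ub => //; rewrite /M; have := ler_norm M1; have := normr_ge0 M2; lra.
have vM x : `|v x| <= M.
  by apply: vb => //; rewrite /M; have := ler_norm M2; have := normr_ge0 M1; lra.
apply: measurable_bounded_integrable => //.
- exact: le_lt_trans (probability_le1 mu measurableT) (ltry _).
- exact: measurable_funM.
exists (M * M); split; first exact: num_real.
move=> y My x _; apply: le_trans (ltW My) => /=; rewrite normrM.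
by apply: ler_pM.
Qed.

Lemma graph_coupling (T : X -> X) : measurable_fun setT T ->
  exists nu : probability (X * X)%type R,
    (forall A, nu A = mu ((fun x => (x, T x)) @^-1` A)) /\
    forall phi psi : X -> R, measurable_fun setT phi -> bounded_fun phi ->
      measurable_fun setT psi -> bounded_fun psi ->
      (\int[nu]_z (phi z.1 * psi z.2)%:E = \int[mu]_x (phi x * psi (T x))%:E)%E.
Proof.
move=> mT; have mG : measurable_fun setT (fun x => (x, T x)).
  exact: measurable_fun_pair.
pose Z : {mfun X >-> (X * X)%type} :=
  HB.pack (fun x => (x, T x)) (isMeasurableFun.Build _ _ _ _ _ mG).
exists (distribution mu Z : probability (X * X)%type R); split => //.
move=> phi psi mphi bphi mpsi [M [Mr bpsi]].
rewrite integral_distribution //=.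
  apply/measurable_EFinP; apply: measurable_funM.
    exact: measurableT_comp mphi measurable_fst.
  exact: measurableT_comp mpsi measurable_snd.
apply: (@integrable_mul phi (psi \o T)) => //; first exact: measurableT_comp.
by exists M; split => // y My x _; exact: bpsi.
Qed.

End GraphCoupling.

Section AlmostInvariant.
Context {R : realType} d (X : measurableType d) (mu : probability X R).
Variable T : nat -> X -> X.
Hypothesis mT : forall n, measurable_fun setT (T n).
Hypothesis muT : forall n A, measurable A -> mu (T n @^-1` A) = mu A.

(** As [T n] preserves [mu], this is half the mass of the symmetric difference of [A] and its
    preimage. *)
Definition almost_invariant (A : set X) :=
  (fun n => pr mu (A `\` T n @^-1` A)) @ \oo --> 0.

Let mpre n A : measurable A -> measurable (T n @^-1` A).
Proof. by move=> mA; have := @mT n measurableT A mA; rewrite setTI. Qed.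

Let mdiff n A : measurable A -> measurable (A `\` T n @^-1` A).
Proof. by move=> mA; apply: measurableD => //; exact: mpre. Qed.

Let mdiff2 n A B : measurable A -> measurable B ->
  measurable ((A `\` T n @^-1` A) `|` B).
Proof. by move=> mA mB; apply: measurableU => //; exact: mdiff. Qed.

Lemma pr_leU A B : measurable A -> measurable B -> pr mu (A `|` B) <= pr mu A + pr mu B.
Proof.
by move=> mA mB; rewrite -(pr_mod mu mA mB) lerDl pr_ge0.
Qed.

Lemma almost_invariantP A : almost_invariant A <-> forall e, 0 < e ->
  \forall n \near \oo, pr mu (A `\` T n @^-1` A) <= e.
Proof.
split=> [/cvgrPdist_le H e /H|H].
  by apply: filterS => n; rewrite sub0r normrN ger0_norm// pr_ge0.
apply/cvgrPdist_le => e /H.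
by apply: filterS => n; rewrite sub0r normrN ger0_norm// pr_ge0.
Qed.

Lemma almost_invariantC A : measurable A -> almost_invariant A ->
  almost_invariant (~` A).
Proof.
move=> mA; rewrite /almost_invariant.
rewrite [X in X @ _ --> _ -> _](_ : _ = (fun n => pr mu (~` A `\` T n @^-1` (~` A)))) //.
apply/funext => n; have -> : ~` A `\` T n @^-1` (~` A) = T n @^-1` A `\` A.
  by apply/seteqP; split => x /=; [move=> [? /contrapT]|move=> [? ?]; split].
have mA' := mpre n mA.
rewrite !prD // setIC; congr (_ - _).
by rewrite /pr muT.
Qed.

Lemma almost_invariantU A B : measurable A -> measurable B ->
  almost_invariant A -> almost_invariant B -> almost_invariant (A `|` B).
Proof.
move=> mA mB /almost_invariantP HA /almost_invariantP HB.
apply/almost_invariantP => e e0.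
have e2 : 0 < e / 2 by rewrite divr_gt0.
apply: filterS2 (HA _ e2) (HB _ e2) => n hA hB.
have -> : e = e / 2 + e / 2 by rewrite -splitr.
apply: le_trans (lerD hA hB).
apply: le_trans (pr_leU (mdiff n mA) (mdiff n mB)).
apply: pr_mono.
- by apply: mdiff; exact: measurableU.
- by apply: mdiff2 => //; exact: mdiff.
- move=> x [[Ax|Bx] /= nx]; [left|right]; split => //= H; apply: nx; [by left|by right].
Qed.

Lemma almost_invariant_bigcup (A : (set X)^nat) : (forall k, measurable (A k)) ->
  (forall k, almost_invariant (A k)) -> almost_invariant (\bigcup_k A k).
Proof.
move=> mA HA; apply/almost_invariantP => e e0.
have e2 : 0 < e / 2 by rewrite divr_gt0.
pose U K := \big[setU/set0]_(k < K) A k.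
have mU K : measurable (U K) by exact: bigsetU_measurable.
have HU K : almost_invariant (U K).
  rewrite /U; elim: K => [|K IH].
    rewrite big_ord0 /almost_invariant (_ : (fun n => _) = fun=> 0); first exact: cvg_cst.
    by apply/funext => n; rewrite set0D pr0.
  by rewrite big_ord_recr /=; apply: almost_invariantU => //; exact: mU.
have mB : measurable (\bigcup_k A k) by exact: bigcup_measurable.
have UE : \bigcup_k U k = \bigcup_k A k.
  apply/seteqP; split => x [k _].
    by rewrite /U -bigcup_mkord => -[i _ ?]; exists i.
  by move=> Akx; exists k.+1 => //; rewrite /U -bigcup_mkord; exists k => /=.
have : (fun K => pr mu (U K)) @ \oo --> pr mu (\bigcup_k A k).
  have : mu \o U @ \oo --> mu (\bigcup_k U k).
    apply: nondecreasing_cvg_mu => //; first by rewrite UE.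
    move=> i j ij; apply/subsetPset; rewrite /U -!bigcup_mkord => x [k /= ki Akx].
    by exists k => //=; exact: leq_trans ki ij.
  rewrite UE (prE mu mB) => /fine_cvgP[_]; exact.
move=> /cvgrPdist_le/(_ _ e2)[K _ /(_ K (leqnn K)) /= HK].
have /almost_invariantP/(_ _ e2) := HU K; apply: filterS => n Hn.
have UB : U K `<=` \bigcup_k A k by rewrite -UE => x Ux; exists K.
have mBU := measurableD mB (mU K).
apply: (@le_trans _ _ (pr mu ((U K `\` T n @^-1` U K) `|` (\bigcup_k A k `\` U K)))).
  apply: pr_mono.
  - exact: mdiff.
  - exact: mdiff2.
  - move=> x [Bx nx]; have [Ux|Ux] := pselect (U K x); last by right.
    by left; split => // ?; apply: nx; exact: UB.
have -> : e = e / 2 + e / 2 by rewrite -splitr.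
apply: (le_trans (pr_leU (mdiff n (mU K)) mBU)); apply: lerD => //.
rewrite prD // setIidr //; apply: le_trans HK; exact: ler_norm.
Qed.

Lemma integral_affine_indic (a b : R) (A : set X) : measurable A -> 0 <= a -> 0 <= b ->
  (\int[mu]_x (a + b * \1_A x)%:E = (a + b * pr mu A)%:E)%E.
Proof.
move=> mA a0 b0.
have mI : measurable_fun setT (fun x => (\1_A x)%:E : \bar R).
  by apply/measurable_EFinP; exact: measurable_indic.
under eq_integral do rewrite EFinD EFinM.
rewrite ge0_integralD //=; last 2 first.
- by move=> x _; rewrite -EFinM lee_fin mulr_ge0.
- by apply: emeasurable_funM => //; exact: measurable_cst.
rewrite ge0_integralZl_EFin //=.
rewrite integral_cst //= integral_indic // setIT probability_setT mule1 EFinD EFinM.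
congr (_ + _ * _)%E; exact: prE.
Qed.

(** The range of [psi] is cut into finitely many slices of height [r]. Off the set [Bad] of points
    that leave their slice, [psi] moves by at most [r], and almost invariance of the slices makes
    [Bad] negligible. *)
Lemma correlation_cvg (phi psi : X -> R) :
  (forall A, measurable A -> almost_invariant A) ->
  measurable_fun setT phi -> bounded_fun phi ->
  measurable_fun setT psi -> bounded_fun psi ->
  ((\int[mu]_x (phi x * psi (T n x))%:E)%E @[n --> \oo] -->
     (\int[mu]_x (phi x * psi x)%:E)%E).
Proof.
move=> HA mphi bphi mpsi bpsi.
have [[M1 [_ bphi1]] [M2 [_ bpsi1]]] := (bphi, bpsi).
pose M := `|M1| + `|M2| + 1.
have M0 : 0 < M by rewrite ltr_wpDl// addr_ge0.
have phiM x : `|phi x| <= M.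
  by apply: bphi1 => //; rewrite /M; have := ler_norm M1; have := normr_ge0 M2; lra.
have psiM x : `|psi x| <= M.
  by apply: bpsi1 => //; rewrite /M; have := ler_norm M2; have := normr_ge0 M1; lra.
have mpsiT n : measurable_fun setT (fun x => psi (T n x)) by exact: measurableT_comp.
have i0 := integrable_mul mu mphi mpsi bphi bpsi.
have iT n : mu.-integrable setT (EFin \o (fun x => phi x * psi (T n x))).
  apply: integrable_mul => //; case: bpsi => K [Kr HK].
  by exists K; split => // y Ky x _; exact: HK.
have fJ := integrable_fin_num measurableT i0.
have fT n := integrable_fin_num measurableT (iT n).
suff H e : 0 < e -> \forall n \near \oo,
    (`|\int[mu]_x (phi x * psi (T n x))%:E - \int[mu]_x (phi x * psi x)%:E| <= e%:E)%E.
  rewrite -[X in _ --> X](fineK fJ); apply/fine_cvgP; split.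
    by exists 0%N => // n _; exact: fT.
  apply/cvgrPdist_le => e /H; apply: filterS => n /=.
  rewrite -{1}(fineK fJ) -{1}(fineK (fT n)) -EFinB lee_fin distrC; exact.
move=> e0.
(* The integrand changes by at most [M r = e / 2] off [Bad] and by at most [2 M M] on it; the mass
   of [Bad] will be small enough for the other [e / 2]. *)
pose r := e / (2 * M).
have r0 : 0 < r by rewrite divr_gt0// mulr_gt0.
pose A (j : nat) := psi @^-1` `[(j%:R * r - M), (j.+1%:R * r - M)[%classic.
have mA j : measurable (A j).
  have := mpsi measurableT _ (measurable_itv `[(j%:R * r - M), (j.+1%:R * r - M)[).
  by rewrite setTI.
pose K := (Num.trunc (2 * M / r)).+1.
pose Bad n := \big[setU/set0]_(j < K) (A j `\` T n @^-1` A j).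
have mBad n : measurable (Bad n) by apply: bigsetU_measurable => j _; exact: mdiff.
have goodP n x : ~ Bad n x -> `|psi (T n x) - psi x| <= r.
  move=> nB; pose j := Num.trunc ((psi x + M) / r).
  have xM0 : 0 <= psi x + M by have := psiM x; rewrite ler_norml; lra.
  have /andP[j1 j2] := trunc_itv (divr_ge0 xM0 (ltW r0)).
  have Ajx : A j x.
    rewrite /A /= in_itv /= lerBlDr ltrBrDr -ler_pdivlMr// -ltr_pdivrMr//.
    by rewrite j1 j2.
  have jK : (j < K)%N.
    rewrite -(ltr_nat R); apply: (le_lt_trans j1); apply: le_lt_trans (truncnS_gt _).
    rewrite ler_pdivrMr// divfK ?gt_eqF//; have := psiM x; rewrite ler_norml; lra.
  have : A j (T n x).
    apply: contrapT => nA; apply: nB.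
    rewrite /Bad -(bigcup_mkord K (fun j => A j `\` T n @^-1` A j)).
    by exists j => //=; split.
  move: Ajx; rewrite /A /= !in_itv /= -natr1 ler_norml; lra.
have prBad : (fun n => pr mu (Bad n)) @ \oo --> 0.
  apply: (@squeeze_cvgr _ _ _ _ (fun=> 0) (fun n => \sum_(j < K) pr mu (A j `\` T n @^-1` A j))).
  - exists 0%N => // n _; rewrite pr_ge0 /=; rewrite /Bad.
    have [] : measurable (Bad n) /\ pr mu (Bad n) <= \sum_(j < K) pr mu (A j `\` T n @^-1` A j).
      rewrite /Bad; elim/big_ind2: _ => [|B s B' s' [mB h] [mB' h']|j _].
      - by rewrite pr0.
      - split; first exact: measurableU.
        by apply: le_trans (lerD h h'); exact: pr_leU.
      - by split => //; exact: mdiff.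
    by [].
  - exact: cvg_cst.
  - have : (fun n => \sum_(j < K) pr mu (A j `\` T n @^-1` A j)) @ \oo --> \sum_(j < K) (0 : R).
      apply: cvg_big => [|j _]; first exact: add_continuous.
      exact: HA (mA j).
    by rewrite big1.
have M2_0 : 0 < 2 * M * M by rewrite !mulr_gt0.
have e4 : 0 < e / 2 / (2 * M * M) by rewrite !divr_gt0.
move: prBad => /cvgrPdist_le/(_ _ e4); apply: filterS => n.
rewrite sub0r normrN ger0_norm ?pr_ge0// => Hn.
rewrite -integralB_EFin //.
have mdf : measurable_fun setT (fun x => phi x * psi (T n x) - phi x * psi x).
  by apply: measurable_funB; exact: measurable_funM.
apply: le_trans (le_abse_integral mu measurableT _) _.
  by apply/measurable_EFinP; exact: mdf.
apply: (@le_trans _ _ (\int[mu]_x (M * r + (2 * M * M) * \1_(Bad n) x)%:E)%E).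
  apply: ge0_le_integral => //=.
  - by apply/measurable_EFinP; apply: measurableT_comp mdf.
  - apply/measurable_EFinP; apply: measurable_funD; first exact: measurable_cst.
    by apply: measurable_funM; [exact: measurable_cst|exact: measurable_indic].
  move=> x _; rewrite lee_fin -mulrBr normrM indicE.
  have [xB|xB] := boolP (x \in Bad n); rewrite /= ?mulr1 ?mulr0 ?addr0.
    apply: (@le_trans _ _ (2 * M * M)); last by rewrite lerDr mulr_ge0 // ltW.
    rewrite -mulrA mulrCA; apply: ler_pM => //.
    have := psiM x; have := psiM (T n x).
    by have := ler_normB (psi (T n x)) (psi x); lra.
  by apply: ler_pM => //; apply: goodP => xB'; move: xB; rewrite mem_set.
have Mr0 : 0 <= M * r by rewrite mulr_ge0 // ltW.
rewrite (integral_affine_indic (mBad n) Mr0 (ltW M2_0)) lee_fin.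
have -> : M * r = e / 2 by rewrite /r; field; rewrite gt_eqF.
rewrite [leRHS](splitr e); apply: lerD => //.
by rewrite -ler_pdivlMl// mulrC.
Qed.

End AlmostInvariant.

Section CentralTranslations.
Context {R : realType} {disp : Order.disp_t} {S : finOrderType disp}.
Variable E : rel S.

Local Notation V := (vspaceV R S).
Local Notation W := (vspaceW R S E).
Local Notation N := (lieN R S E).
Local Notation X := (nilmanifold R E).
Local Notation mulN := (@nmul R disp S E).
Local Notation pi := (@piN R disp S E).
Local Notation act := (@act R disp S E).

Variable mu : probability X R.
Hypothesis mui : invariant_probability mu.
Variable w : W.

Definition shift (n : nat) : X -> X := act (0, n.+1%:R^-1 *: w).

Lemma measurable_shift n : measurable_fun setT (shift n).
Proof. by apply: measurable_fun_continuous; exact: act_continuous. Qed.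

Lemma shift_open (U : set X) (x : X) : open U -> U x ->
  \forall n \near \oo, U (shift n x).
Proof.
move=> oU; have [s ->] := piN_surj x => Us.
have oU' : open (pi @^-1` U) by apply: open_comp oU => y _; exact: piN_continuous.
have cc : continuous (fun t : R => mulN (t *: 0, t *: w) s).
  by apply: continuous_nmul; [exact: continuous_line|move=> t; exact: cvg_cst].
have : nbhs (0 : R) ((fun t : R => mulN (t *: 0, t *: w) s) @^-1` (pi @^-1` U)).
  apply: cc; apply: open_nbhs_nbhs; split => //=.
  by rewrite !scale0r nmul1l.
move=> nb; have [n0 _ Hn] := @cvg_harmonic R _ nb; exists n0 => // n /Hn.
by rewrite /= scaler0 /shift act_piN.
Qed.

(** Almost invariant measurable sets form a sigma-algebra, so open sets suffice. A point of an open
    [U] stays in [U] for all large [n], so the unions [C n] of the tails of [D] decrease to the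
    empty set. *)
Lemma almost_invariant_shift (A : set X) : measurable A -> almost_invariant mu shift A.
Proof.
have mpre n (B : set X) : measurable B -> measurable (shift n @^-1` B).
  by move=> mB; have := @measurable_shift n measurableT B mB; rewrite setTI.
have muT n (B : set X) : measurable B -> mu (shift n @^-1` B) = mu B by exact: mui.
suff H : <<s @open X>> `<=` [set B : set X | measurable B /\ almost_invariant mu shift B].
  by move=> mA; have [] := H A mA.
apply: smallest_sub; first split.
- split; first exact: measurable0.
  rewrite /almost_invariant (_ : (fun n => _) = fun=> 0); first exact: cvg_cst.
  by apply/funext => n; rewrite set0D pr0.
- move=> B [mB HB]; rewrite setTD; split; first exact: measurableC.
  exact: (almost_invariantC measurable_shift muT mB HB).
- move=> B HB; split; first by apply: bigcup_measurable => k _; have [] := HB k.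
  by apply: (almost_invariant_bigcup measurable_shift) => k; have [] := HB k.
move=> U oU; have mU := measurable_open oU; split => //.
pose D n := U `\` shift n @^-1` U.
have mD n : measurable (D n) by apply: measurableD => //; exact: mpre.
pose C n := \bigcup_(m in [set m | (n <= m)%N]) D m.
have mC n : measurable (C n) by apply: bigcup_measurable => k _.
have C0 : \bigcap_n C n = set0.
  apply/seteqP; split => // x Cx.
  have Ux : U x by have [m _ []] := Cx 0%N I.
  have [n _ Hn] := shift_open oU Ux.
  by have [m nm [_]] := Cx n I; apply; exact: Hn.
have : mu \o C @ \oo --> mu (\bigcap_n C n).
  apply: nonincreasing_cvg_mu => //.
  - exact: le_lt_trans (probability_le1 mu (mC 0%N)) (ltry _).
  - by rewrite C0; exact: measurable0.
  move=> i j ij; apply/subsetPset => x [m /= jm Dx]; exists m => //=.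
  exact: leq_trans ij jm.
rewrite C0 measure0 => /fine_cvgP[_ H].
apply: (squeeze_cvgr _ (cvg_cst 0) H).
exists 0%N => // n _; rewrite pr_ge0 /=; apply: pr_mono; [exact: mD|exact: mC|].
by move=> x Dx; exists n => /=.
Qed.

(** A fixed point puts [w / (n + 1)] in [NZ], whose coordinates along [W] are half-integers. This is
    impossible once [n + 1] exceeds [2 |w_j|] for some non-zero [w_j]. *)
Lemma shift_fixed : w != 0 -> \forall n \near \oo, forall x, shift n x <> x.
Proof.
move=> w0; have [j wj] : exists j, w 0 j != 0.
  by apply/existsP; rewrite -negb_forall; apply: contra w0 => /forallP H;
    apply/eqP/rowP => j; rewrite mxE; exact/eqP.
exists (Num.trunc (2 * `|w 0 j|)) => // n /= jn x.
have [s ->] := piN_surj x; rewrite /shift act_piN nmul_center => /esym/piN_eq.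
rewrite nmulKl => /NZ_half_integral[_ /(_ j)] /=; rewrite mxE => /norm_intr_ge1.
rewrite !mulf_neq0 ?invr_neq0 ?pnatr_eq0// => /(_ isT).
rewrite normrM ger0_norm// normrM normfV normr_nat mulrCA.
rewrite ler_pdivlMl ?ltr0n// mulr1 => H.
have := le_lt_trans H (truncnS_gt (2 * `|w 0 j|)).
by rewrite ltr_nat ltnS ltnNge jn.
Qed.

Variable Gamma : set 'End(N).
Hypothesis Gamma_subgroup : is_subgroupGL Gamma.
Hypothesis Gamma_TL : Gamma `<=` groupTL R E.
Hypothesis Gamma_NZ : forall f, Gamma f -> f @` NZ R E = NZ R E.
Hypothesis w_fixed : forall f, Gamma f -> f (0, w) = (0, w).

Lemma not_rigid : w != 0 ->
  ~ property_T_relative_to_space mu Gamma (fun f : 'End(N) => coset_map E f).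
Proof.
move=> w0 H.
have /choice[nu nuP] := fun n => graph_coupling mu (@measurable_shift n).
have nuE n A : nu n A = mu ((fun x : X => (x, shift n x)) @^-1` A) by have [] := nuP n.
have nu0 : nu n diagonal @[n --> \oo] --> 0%E.
  apply: cvg_near_cst; apply: filterS (shift_fixed w0) => n Hn.
  rewrite nuE (_ : _ @^-1` _ = set0) ?measure0//.
  by apply/seteqP; split => // x /= /esym/Hn.
have muT n (B : set X) : measurable B -> mu (shift n @^-1` B) = mu B by exact: mui.
have h1 n A : measurable A -> pushforward (nu n) fst A = mu A /\ pushforward (nu n) snd A = mu A.
  move=> mA; split; first exact: nuE.
  rewrite -[RHS](muT n A mA); exact: nuE.
have h2 (phi psi : X -> R) :
    measurable_fun setT phi -> bounded_fun phi ->
    measurable_fun setT psi -> bounded_fun psi ->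
    (\int[nu n]_z (phi z.1 * psi z.2)%:E @[n --> \oo] -->
      \int[mu]_x (phi x * psi x)%:E)%E.
  move=> mphi bphi mpsi bpsi.
  have C := correlation_cvg measurable_shift almost_invariant_shift mphi bphi mpsi bpsi.
  rewrite (_ : (fun n => _) = (fun n => \int[mu]_x (phi x * psi (shift n x))%:E)%E) //.
  by apply/funext => n; have [_ ->] := nuP n.
have h3 (f : 'End(N)) : Gamma f -> (total_variation_norm (fun A =>
    pushforward (nu n) (fun z => (coset_map E f z.1, coset_map E f z.2)) A - nu n A)
    @[n --> \oo] --> 0)%E.
  move=> Gf; have [Gbij _ _ _] := Gamma_subgroup.
  have fTL := Gamma_TL Gf; have fNZ := Gamma_NZ Gf.
  have [g fK gK] := bijective_lfun (Gbij f Gf).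
  have com n x : coset_map E f (shift n x) = shift n (coset_map E f x).
    rewrite /shift (aut_act fTL fK fNZ); congr (act _ _).
    have -> : (0, n.+1%:R^-1 *: w) = n.+1%:R^-1 *: (0, w) :> N by rewrite pairZ scaler0.
    by rewrite linearZ /= (w_fixed Gf).
  rewrite (_ : (fun n => _) = fun=> 0%E); first exact: cvg_cst.
  apply/funext => n; apply: total_variation_norm_eq0 => A mA.
  have mA' : measurable ((fun x : X => (x, shift n x)) @^-1` A).
    have := measurable_fun_pair (@measurable_id _ X setT) (@measurable_shift n).
    by move=> /(_ measurableT A mA); rewrite setTI.
  rewrite /pushforward !nuE.
  rewrite (_ : _ @^-1` (_ @^-1` A) =
      coset_map E f @^-1` ((fun x : X => (x, shift n x)) @^-1` A)).
    by rewrite (aut_invariant fTL fK gK fNZ mui mA') subee // fin_num_measure.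
  by apply/funext => x; rewrite /= com.
have nu1 := H nu h1 h2 h3.
have /eqP : 1%E = 0%E :> \bar R.
  by apply: (cvg_unique _ nu1 nu0); exact: ereal_hausdorff.
by rewrite eqe oner_eq0.
Qed.

End CentralTranslations.

Theorem theorem1p4 (R : realType) (disp : Order.disp_t)
  (S : finOrderType disp) (E : rel S)
  (E_sym : symmetric E) (E_irr : irreflexive E) (E_neq0 : exists a b, E a b)
  (mu : probability (nilmanifold R E) R)
  (mu_inv : forall (x : lieN R S E) (A : set (nilmanifold R E)),
     measurable A -> pushforward mu (coset_map E (nmul E x)) A = mu A)
  (Gamma : set 'End(lieN R S E))
  (Gamma_countable : countable Gamma)
  (Gamma_subgroup : is_subgroupGL Gamma)
  (Gamma_TL : Gamma `<=` groupTL R E)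
  (Gamma_NZ : forall f, Gamma f -> f @` NZ R E = NZ R E)
  (Gamma_dense : zariski_dense_in Gamma (groupTL R E)) :
  property_T_relative_to_space mu Gamma
    (fun f : 'End(lieN R S E) => coset_map E f) <->
  (forall w : vspaceW R S E, (forall f, Gamma f -> f (0, w) = (0, w)) -> w = 0).
Proof.
split=> [rigid w w_fixed|no_fixed nu _ nu_mu nu_inv].
  apply/eqP/negPn/negP => w0.
  exact: (not_rigid mu_inv Gamma_subgroup Gamma_TL Gamma_NZ w_fixed w0 rigid).
apply: contrapT => nu_diag.
have [m [m0 mono modular minv mpos]] :=
  @rigidity_mean R disp S E mu nu Gamma Gamma_subgroup Gamma_TL Gamma_NZ nu_mu nu_inv nu_diag.
have [w w0 w_fixed] := Gamma_fixed_vector E_sym E_irr E_neq0 Gamma_subgroup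
  Gamma_dense m0 mono modular minv mpos.
by move/eqP: w0; apply; exact: no_fixed.
Qed.
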